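(* Every homogeneous minimal Lagrangian immersion $f:\mathbb{C}\to\mathbb{C}P^2$ is isometrically isomorphic with the Clifford torus; that is, there exist an isometry $T$ of $\mathbb{C}P^2$ and a biholomorphic change of coordinate $\phi\in\mathrm{Aut}(\mathbb{C})$ such that $f=T\circ f_{\mathrm{Cl}}\circ\phi$.
   Context: $\mathbb{C}P^2$ carries the Fubini–Study metric. For a (conformal) minimal Lagrangian immersion $f:M\to\mathbb{C}P^2$ of a Riemann surface $M$, let $\Gamma^f_M$ be the group of all $\gamma\in\mathrm{Aut}(M)$ (biholomorphic automorphisms) for which there exists $R\in SU(3)$ with $f(\gamma\cdot z)=R\cdot f(z)$ for all $z\in M$. The immersion $f$ is homogeneous if $\Gamma^f_M$ acts transitively on $M$. The Clifford torus is the immersion $f_{\mathrm{Cl}}:\mathbb{C}\to\mathbb{C}P^2$, $f_{\mathrm{Cl}}(z)=[e^{z-\bar z}:e^{\alpha z-\alpha^2\bar z}:e^{\alpha^2z-\alpha\bar z}]$, $\alpha=e^{2\pi i/3}$. *)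

(* Defs.v *)
From HB Require Import structures.
From mathcomp Require Import all_boot all_order all_algebra.
From mathcomp Require Import spectral.
From mathcomp Require Import all_classical all_reals all_analysis.

Set Implicit Arguments.
Unset Strict Implicit.
Unset Printing Implicit Defensive.

Import Order.TTheory GRing.Theory Num.Theory.
Import numFieldNormedType.Exports.
From mathcomp Require Import complex.

Local Open Scope classical_set_scope.
Local Open Scope ring_scope.
Local Open Scope complex_scope.

(** * Calculus *)

(* C^n (resp. C^oo) maps on an open set U of a finite-dimensional space:
   all iterated directional derivatives up to order n (resp. of all orders)
   exist and are continuous on U. *)
Fixpoint Cn_on {R : realType} {V W : normedModType R} (n : nat)
    (U : set V) (F : V -> W) : Prop :=
  {in U, continuous F} /\
  if n is m.+1 then
    forall v : V, {in U, forall x, derivable F x v} /\ Cn_on m U ('D_v F)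
  else True.

Definition smooth_on {R : realType} {V W : normedModType R}
    (U : set V) (F : V -> W) : Prop :=
  forall n, Cn_on n U F.

Definition cexp {R : realType} (z : R[i]) : R[i] :=
  (expR (Re z))%:C * (cos (Im z) +i* sin (Im z)).

Lemma cexp_neq0 {R : realType} (z : R[i]) : cexp z != 0.
Proof.
rewrite mulf_neq0 //; first by rewrite eq_complex /= negb_and expR_eq0.
rewrite eq_complex /=; apply/negP => /andP[/eqP c0 /eqP s0].
by have := cos2Dsin2 (Im z); rewrite c0 s0 expr0n addr0 => /eqP; rewrite eq_sym oner_eq0.
Qed.

Definition holomorphic {R : realType} (h : R[i] -> R[i]) : Prop :=
  forall z, derivable (h : (R[i])^o -> (R[i])^o) z 1.

(* Aut(C) *)
Definition biholomorphic {R : realType} (h : R[i] -> R[i]) : Prop :=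
  exists k : R[i] -> R[i],
    [/\ cancel h k, cancel k h, holomorphic h & holomorphic k].

(** * The complex projective plane: lines through 0 in C^3 *)

Definition CP2 (R : realType) : Type :=
  {L : {vspace 'cV[R[i]]_3} | \dim L == 1%N}.

Lemma line_dim {R : realType} (v : 'cV[R[i]]_3) :
  v != 0 -> \dim <[v]>%VS == 1%N.
Proof. by move=> v0; rewrite dim_vline v0. Qed.

(* The point [v] = [v_0 : v_1 : v_2]. *)
Definition proj_point {R : realType} (v : 'cV[R[i]]_3) (v0 : v != 0) : CP2 R :=
  exist _ <[v]>%VS (line_dim v0).

(* C^2 as a real vector space; (x, y) stands for x + i y. *)
Definition C2 (R : realType) : normedModType R := ('cV[R]_2 * 'cV[R]_2)%type.

Definition C2_complex {R : realType} (w : C2 R) : 'cV[R[i]]_2 :=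
  \col_k (w.1 k 0 +i* w.2 k 0).

Definition C2_J {R : realType} (w : C2 R) : C2 R := (- w.2, w.1).

(* The affine chart [v] |-> (v_k / v_j)_(k <> j) on the domain v_j <> 0. *)
Definition chart_dom {R : realType} (j : 'I_3) (p : CP2 R) : bool :=
  vpick (val p) j 0 != 0.

Definition chart {R : realType} (j : 'I_3) (p : CP2 R) : C2 R :=
  let v := vpick (val p) in
  (\col_k Re (v (lift j k) 0 / v j 0), \col_k Im (v (lift j k) 0 / v j 0)).

(* Its inverse inserts the homogeneous coordinate 1 in position j. *)
Definition affine_vec {R : realType} (j : 'I_3) (w : C2 R) : 'cV[R[i]]_3 :=
  \col_k (if unlift j k is Some l then C2_complex w l 0 else 1).

Lemma affine_vec_neq0 {R : realType} (j : 'I_3) (w : C2 R) :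
  affine_vec j w != 0.
Proof.
apply/eqP => /matrixP /(_ j 0); rewrite !mxE unlift_none => /eqP.
by rewrite oner_eq0.
Qed.

Definition chart_inv {R : realType} (j : 'I_3) (w : C2 R) : CP2 R :=
  proj_point (affine_vec_neq0 j w).

(* Smooth maps into CP^2, read in the charts of the target.  The existence of
   U also gives continuity. *)
Definition smooth_to_CP2 {R : realType} {V : normedModType R}
    (F : V -> CP2 R) : Prop :=
  forall (x : V) (j : 'I_3), chart_dom j (F x) ->
  exists U : set V, [/\ open_nbhs x U, {in U, forall y, chart_dom j (F y)} &
                        smooth_on U (chart j \o F)].

(** * The Fubini-Study metric *)

Definition hdot {R : realType} (u v : 'cV[R[i]]_2) : R[i] :=
  \sum_k u k 0 * (v k 0)^*.

(* The coefficients of the Fubini-Study metric at the point of affine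
   coordinate w; the formula is the same in the three affine charts. *)
Definition fubini_study {R : realType} (w u v : C2 R) : R :=
  let W := C2_complex w in let a := C2_complex u in let b := C2_complex v in
  Re (((1 + hdot W W) * hdot a b - hdot a W * hdot W b) / (1 + hdot W W) ^+ 2).

Definition kahler_form {R : realType} (w u v : C2 R) : R :=
  fubini_study w (C2_J u) v.

(* g(nabla_a b, c) at w for the constant vector fields a, b, c, where nabla is
   the Levi-Civita connection of g (Koszul formula, i.e. the Christoffel
   symbols of the first kind). *)
Definition christoffel {R : realType} {E : normedModType R}
    (g : E -> E -> E -> R) (w a b c : E) : R :=
  ('D_a (fun y => g y b c : R^o) w + 'D_b (fun y => g y a c : R^o) w
   - 'D_c (fun y => g y a b : R^o) w) / 2.

(* A diffeomorphism T with T^* g = g. *)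
Definition CP2_isometry {R : realType} (T : CP2 R -> CP2 R) : Prop :=
  (exists S : CP2 R -> CP2 R,
     [/\ cancel T S, cancel S T,
         forall i, smooth_to_CP2 (T \o chart_inv i) &
         forall i, smooth_to_CP2 (S \o chart_inv i)]) /\
  forall (i j : 'I_3) (w u v : C2 R), chart_dom j (T (chart_inv i w)) ->
    let Tij := chart j \o T \o chart_inv i in
    fubini_study (Tij w) ('D_u Tij w) ('D_v Tij w) = fubini_study w u v.

(** * Surfaces f : C -> CP^2 *)

Definition plane (R : realType) : normedModType R := (R^o * R^o)%type.

(* f in the real coordinates z = x + i y. *)
Definition realify {R : realType} (f : R[i] -> CP2 R) (p : plane R) : CP2 R :=
  f (p.1 +i* p.2).

Section Surface.
Context {R : realType}.
Variable f : R[i] -> CP2 R.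

Definition local_rep (j : 'I_3) : plane R -> C2 R := chart j \o realify f.

(* f^* g *)
Definition induced (j : 'I_3) (p u v : plane R) : R :=
  fubini_study (local_rep j p) ('D_u (local_rep j) p) ('D_v (local_rep j) p).

Definition immersion : Prop :=
  smooth_to_CP2 (realify f) /\
  forall (p : plane R) (j : 'I_3), chart_dom j (realify f p) ->
  forall u, 'D_u (local_rep j) p = 0 -> u = 0.

Definition conformal : Prop :=
  forall (p : plane R) (j : 'I_3), chart_dom j (realify f p) ->
  exists2 lambda : R, 0 < lambda &
    forall u v, induced j p u v = lambda * (u.1 * v.1 + u.2 * v.2).

(* C has half the real dimension of CP^2, so isotropic means Lagrangian. *)
Definition lagrangian : Prop :=
  forall (p : plane R) (j : 'I_3), chart_dom j (realify f p) ->
  forall u v, kahler_form (local_rep j p)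
                ('D_u (local_rep j) p) ('D_v (local_rep j) p) = 0.

Definition normal (j : 'I_3) (p : plane R) (nu : C2 R) : Prop :=
  forall u, fubini_study (local_rep j p) ('D_u (local_rep j) p) nu = 0.

(* The second fundamental form in the normal direction nu:
   g(nabla_u (df v), nu) for constant vector fields u, v on C. *)
Definition second_form (j : 'I_3) (p : plane R) (nu : C2 R) (u v : plane R)
    : R :=
  fubini_study (local_rep j p) ('D_u ('D_v (local_rep j)) p) nu
  + christoffel fubini_study (local_rep j p)
      ('D_u (local_rep j) p) ('D_v (local_rep j) p) nu.

(* The mean curvature vector, i.e. (up to a factor) the trace of the second
   fundamental form with respect to the induced metric, vanishes. *)
Definition minimal : Prop :=
  forall (p : plane R) (j : 'I_3), chart_dom j (realify f p) ->
  forall e1 e2 nu,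
    induced j p e1 e1 = 1 -> induced j p e2 e2 = 1 -> induced j p e1 e2 = 0 ->
    normal j p nu -> second_form j p nu e1 e1 + second_form j p nu e2 e2 = 0.

(* SU(3) acts on lines by R . L = { R v | v in L }. *)
Definition Gamma : set (R[i] -> R[i]) :=
  [set gamma | biholomorphic gamma /\
     exists A : 'M[R[i]]_3, [/\ A \is unitarymx, \det A = 1 &
       forall z, val (f (gamma z)) = (linfun (mulmx A) @: val (f z))%VS]].

Definition homogeneous : Prop :=
  forall z w : R[i], exists2 gamma, Gamma gamma & gamma z = w.

End Surface.

(** * The Clifford torus *)

Definition alpha {R : realType} : R[i] := cexp (0 +i* (2 * pi / 3)).

Definition clifford_vec {R : realType} (z : R[i]) : 'cV[R[i]]_3 :=
  \col_k cexp (nth 0 [:: z - z^*;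
                         alpha * z - alpha ^+ 2 * z^*;
                         alpha ^+ 2 * z - alpha * z^*] k).

Lemma clifford_vec_neq0 {R : realType} (z : R[i]) : clifford_vec z != 0.
Proof.
apply/eqP => /matrixP /(_ 0 0); rewrite !mxE => /eqP.
by rewrite (negPf (cexp_neq0 _)).
Qed.

Definition clifford {R : realType} (z : R[i]) : CP2 R :=
  proj_point (clifford_vec_neq0 z).

(* Main.v *)
(* Let [P z] be the orthogonal projection of C^3 onto the line [f z], and put [a = (d P) P],
   [b = (dbar P) P] with the Wirtinger operators d, dbar.  Then [f] is conformal and
   Lagrangian iff [a^* a = b^* b = lam P] and [b^* a = 0], and in that case it is minimal iff
   [(1 - P) (d dbar P) P = 0].  A symmetry [g] of [f], with [P (g z) = A (P z) A^*], gives
   [lam (g z) |g' z|^2 = lam z].  As [g] is affine, it is a translation or has a fixed point,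
   so [|g'| = 1]; hence [lam] is invariant under a transitive group, that is, constant.
   The cubic differential [psi], [psi P = b^* (d a)], is holomorphic with
   [|psi|^2 = lam^3], hence constant, and then [X = a - b^* + (psi / lam^2) b a^*] is a constant
   matrix with [X X^* = X^* X = lam], [X^3 = - psi], [d P = X P - P X].  So [P] is an orbit of
   conjugation by the unitary flow [exp (z X - X^* conj(z))].  The eigenvalues of [X] are
   [c alpha^k] with [c^3 = - psi], and in an eigenbasis this orbit is the Clifford torus
   at [c z]. *)
From HB Require Import structures.
Require Import Defs.
From mathcomp Require Import all_boot all_order all_algebra complex spectral.
From mathcomp Require Import all_classical all_reals all_analysis.
From mathcomp Require Import ring lra.

Set Implicit Arguments.
Unset Strict Implicit.
Unset Printing Implicit Defensive.

Import Order.TTheory GRing.Theory Num.Theory.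
Import numFieldNormedType.Exports.

Local Open Scope classical_set_scope.
Local Open Scope ring_scope.
Local Open Scope complex_scope.

From mathcomp Require Import complex.
Import Normc.

(** * Differential calculus in the plane *)

(** Horizontal lifts of [f] are defined only up to a phase, and the chosen representative [vpick] of
    a line need not vary continuously. The projection [P] has neither defect and encodes metric,
    Kaehler form and second fundamental form in its first two derivatives, so charts serve only to
    translate the hypotheses. As [f] is conformal and Lagrangian, the images of [P], [a], [b] are
    three orthogonal lines in C^3; every derivative is expanded in them, and differentiating the
    orthogonality relations gives the structure equations. The obstacle is that a symmetry g is
    affine. Its inverse is continuous, so g is proper; 1/(g - g(p0)) is compared with 1/(g'(p0)(z -
    p0)), and a logarithmic barrier takes the place of removing the singularity of the difference.
    This needs a second derivative of g, while [holomorphic] provides one. The extra regularity is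
    read off from the symmetry relation for [a], which expresses g' through g and smooth data. *)

Lemma near_openW {R : realType} {V : normedModType R} (U : set V) x (Q : V -> Prop) :
  open U -> x \in U -> (forall y, y \in U -> Q y) -> \near x, Q x.
Proof.
move=> oU /set_mem xU H; have nU := open_nbhs_nbhs (conj oU xU).
by near=> y; apply/H/mem_set; near: y.
Unshelve. all: by end_near. Qed.

Section SmoothMap.
Context {R : realType} {V W : normedModType R}.
Implicit Types (U : set V) (F G : V -> W).

Lemma Cn_on_ext n U F G : open U -> {in U, F =1 G} -> Cn_on n U F -> Cn_on n U G.
Proof.
elim: n F G => [|n IH] F G oU FG /= [cF H]; split=> //.
- move=> x xU; have FGx : {near x, F =1 G} by apply: (near_openW oU xU).
  rewrite /continuous_at -(FG _ xU); apply: cvg_trans (cF x xU).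
  by apply: near_eq_cvg; apply: filterS FGx => y ->.
- move=> x xU; have FGx : {near x, F =1 G} by apply: (near_openW oU xU).
  rewrite /continuous_at -(FG _ xU); apply: cvg_trans (cF x xU).
  by apply: near_eq_cvg; apply: filterS FGx => y ->.
- move=> v; have [dF CF] := H v; split.
    move=> x xU; apply: near_eq_derivable (dF x xU).
    exact: (near_openW oU xU).
  apply: IH CF => // x xU; apply: near_eq_derive.
  exact: (near_openW oU xU).
Qed.

Lemma Cn_onW n U F : Cn_on n.+1 U F -> Cn_on n U F.
Proof.
elim: n F => [|n IH] F /= [cF H]; first by split.
by split=> // v; have [dF CF] := H v; split=> //; exact: IH.
Qed.

Lemma Cn_on_continuous n U F : Cn_on n U F -> {in U, continuous F}.
Proof. by case: n => [|n] []. Qed.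

Lemma Cn_onD n U F G : open U -> Cn_on n U F -> Cn_on n U G ->
  Cn_on n U (fun x => F x + G x).
Proof.
move=> oU; elim: n F G => [|n IH] F G /= [cF HF] [cG HG]; split=> //.
- by move=> x xU; apply: cvgD; [exact: cF|exact: cG].
- by move=> x xU; apply: cvgD; [exact: cF|exact: cG].
move=> v; have [dF CF] := HF v; have [dG CG] := HG v; split.
  by move=> x xU; apply: derivableD; [exact: dF|exact: dG].
apply: (@Cn_on_ext n U (fun x => 'D_v F x + 'D_v G x)) => //; last exact: IH.
by move=> x xU; rewrite -deriveD //; [exact: dF|exact: dG].
Qed.

End SmoothMap.

Section Smooth.
Context {R : realType} {V : normedModType R}.
Implicit Types (U : set V) (F G : V -> R).

Lemma Cn_on_cst n U (c : R) : Cn_on n U (fun _ : V => c).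
Proof.
elim: n c => [|n IH] c; split=> //=; try by move=> x _; exact: cvg_cst.
move=> v; split; first by move=> x _; exact: derivable_cst.
rewrite (_ : 'D_v _ = fun=> 0) //; apply/funext => x; exact: derive_cst.
Qed.

(** Linearity is expressed by the derivative [F v], the same at every point: the first derivatives
    are constant, so no induction on [n] is needed. *)
Lemma Cn_on_linear n U F : continuous F ->
  (forall x v, is_derive x v F (F v)) -> Cn_on n U F.
Proof.
move=> cF dF; have cFU : {in U, continuous F} by move=> x _; exact: cF.
case: n => [|n]; split=> //= v.
split; first by move=> x _; exact: ex_derive.
rewrite (_ : 'D_v F = fun=> F v); first exact: Cn_on_cst.
by apply/funext => x; rewrite derive_val.
Qed.

Lemma Cn_onM n U F G : open U -> Cn_on n U F -> Cn_on n U G ->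
  Cn_on n U (fun x => F x * G x).
Proof.
move=> oU; elim: n F G => [|n IH] F G /= [cF HF] [cG HG]; split=> //.
- by move=> x xU; apply: cvgM; [exact: cF|exact: cG].
- by move=> x xU; apply: cvgM; [exact: cF|exact: cG].
move=> v; have [dF CF] := HF v; have [dG CG] := HG v; split.
  by move=> x xU; apply: derivableM; [exact: dF|exact: dG].
apply: (@Cn_on_ext _ _ _ n U (fun x => F x * 'D_v G x + G x * 'D_v F x)) => //.
  by move=> x xU; apply/esym/deriveM; [exact: dF|exact: dG].
by apply: Cn_onD => //; apply: IH => //; apply: Cn_onW; split.
Qed.

Lemma Cn_onV n U F : open U -> {in U, forall x, F x != 0} ->
  Cn_on n U F -> Cn_on n U (fun x => (F x)^-1).
Proof.
move=> oU F0; elim: n => [|n IH] /= [cF HF]; split=> //.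
- by move=> x xU; apply: cvgV; [exact: F0|exact: cF].
- by move=> x xU; apply: cvgV; [exact: F0|exact: cF].
move=> v; have [dF CF] := HF v; split.
  by move=> x xU; apply: derivableV; [exact: F0|exact: dF].
(* The derivative is written with factors [(F x)^-1] instead of a negative square, so that the
   induction hypothesis for the inverse covers it. *)
apply: (@Cn_on_ext _ _ _ n U (fun x => (-1) * ((F x)^-1 * ((F x)^-1 * 'D_v F x)))) => //.
  move=> x xU; rewrite [RHS]deriveV ?F0 //; last exact: dF.
  by rewrite mulN1r mulrA -expr2 exprVn scaleNr.
have CV : Cn_on n U (fun x => (F x)^-1) by apply: IH; apply: Cn_onW; split.
by do ?apply: Cn_onM => //; exact: Cn_on_cst.
Qed.

End Smooth.

Section Plane.
Context {R : realType}.

Section Line.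
Context {V : normedModType R}.
Implicit Types (F : V -> R) (x v : V).

(** The difference quotients agree literally, so one-variable calculus applies along lines without
    any differentiability of [F] beyond the one direction. *)
Lemma is_derive_line F x v (t d : R) :
  is_derive (t *: v + x) v F d -> is_derive t 1 (fun s : R => F (s *: v + x)) d.
Proof.
have E : (fun h : R => h^-1 *: (((fun s : R => F (s *: v + x)) \o shift t) (h *: 1)
   - F (t *: v + x))) =
   (fun h => h^-1 *: ((F \o shift (t *: v + x)) (h *: v) - F (t *: v + x))).
  by apply/funext => h /=; rewrite [h%:A]mulr1 scalerDl addrA.
by move=> [dF <-]; apply: DeriveDef; rewrite /derivable /derive E.
Qed.

(** The bound [|c| <= |a|] covers steps of both signs and the degenerate step [a = 0]. *)
Lemma mvt_line F x v (a : R) : (forall y, derivable F y v) ->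
  exists2 c : R, `|c| <= `|a| & F (a *: v + x) - F x = a * 'D_v F (c *: v + x).
Proof.
move=> dF; have dl (t : R) : is_derive t 1 (fun s : R => F (s *: v + x)) ('D_v F (t *: v + x)).
  by apply: is_derive_line; exact: derivableP.
have cl : continuous (fun s : R => F (s *: v + x)).
  by move=> t; apply/differentiable_continuous/derivable1_diffP/ex_derive.
have cw (i : interval R) : {within [set` i], continuous (fun s : R => F (s *: v + x))}.
  exact: continuous_subspaceT.
have [a0|a0|->] := ltgtP a 0; last first.
- by exists 0; rewrite // scale0r !add0r subrr mul0r.
- have [c + E] := MVT a0 (fun t _ => dl t) (cw _).
  rewrite in_itv /= => /andP[c0 ca]; exists c; first by rewrite !gtr0_norm ?ltW.
  by move: E; rewrite scale0r add0r subr0 mulrC.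
- have [c + E] := MVT a0 (fun t _ => dl t) (cw _).
  rewrite in_itv /= => /andP[ac c0]; exists c; first by rewrite !ltr0_norm // lerN2 ltW.
  by apply: oppr_inj; rewrite opprB; move: E; rewrite scale0r add0r sub0r mulrC => ->; rewrite mulNr.
Qed.

Lemma near_line2 F x u w (e : R) : {for x, continuous F} -> 0 < e ->
  exists2 d : R, 0 < d & forall s t : R, `|s| <= d -> `|t| <= d ->
    `|F (s *: u + (t *: w + x)) - F x| <= e.
Proof.
move=> cF e0; pose g (p : R * R) := F (p.1 *: u + (p.2 *: w + x)).
have cg : {for (0, 0), continuous g}.
  apply: continuous_comp; last by rewrite /= !scale0r !add0r.
  apply: cvgD; first by apply: cvgZ; [exact: cvg_fst|exact: cvg_cst].
  apply: cvgD; last exact: cvg_cst.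
  by apply: cvgZ; [exact: cvg_snd|exact: cvg_cst].
move/cvgrPdist_le : cg => /(_ e e0) /nbhs_ballP[d /= d0 H].
exists (d / 2); first by rewrite divr_gt0.
have dd : d / 2 < d by rewrite ltr_pdivrMr // ltr_pMr // ltr1n.
move=> s t sd td; have := H (s, t); rewrite /g /= !scale0r !add0r distrC; apply.
by split; rewrite /ball /= sub0r normrN (le_lt_trans _ dd).
Qed.

(** Schwarz: the second difference of [F] over a small parallelogram equals [h ^+ 2] times either
    mixed derivative at some nearby point, and continuity moves both points to [x]. *)
Lemma derive_sym F x u w :
  (forall y, derivable F y u) -> (forall y, derivable F y w) ->
  (forall y, derivable ('D_u F) y w) -> (forall y, derivable ('D_w F) y u) ->
  {for x, continuous ('D_w ('D_u F))} -> {for x, continuous ('D_u ('D_w F))} ->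
  'D_w ('D_u F) x = 'D_u ('D_w F) x.
Proof.
(* The mean value theorem is used twice: along [u] for [y |-> F (h *: w + y) - F y], then along [w]
   for ['D_u F]. *)
have second : forall (u w : V) (h : R), h != 0 ->
   (forall y, derivable F y u) -> (forall y, derivable ('D_u F) y w) ->
   exists c d : R, [/\ `|c| <= `|h|, `|d| <= `|h| &
   F (h *: w + (h *: u + x)) - F (h *: u + x) - (F (h *: w + x) - F x) =
   h ^+ 2 * 'D_w ('D_u F) (d *: w + (c *: u + x))].
  move=> {}u {}w h h0 dFu dFuw; pose phi y := F (h *: w + y) - F y.
  have dsh y : is_derive y u (fun y => F (h *: w + y)) ('D_u F (h *: w + y)).
    have E : (fun k : R => k^-1 *: (((fun y => F (h *: w + y)) \o shift y) (k *: u)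
       - F (h *: w + y))) =
       (fun k => k^-1 *: ((F \o shift (h *: w + y)) (k *: u) - F (h *: w + y))).
      by apply/funext => k /=; rewrite addrCA.
    by apply: DeriveDef; rewrite /derivable /derive E //; exact: dFu.
  have dphi y : is_derive y u phi ('D_u F (h *: w + y) - 'D_u F y).
    by apply: is_deriveB; exact: derivableP.
  have [c ch E1] := mvt_line x h (fun y => @ex_derive _ _ _ _ _ _ _ (dphi y)).
  have [d dh E2] := mvt_line (c *: u + x) h dFuw.
  exists c, d; split=> //; move: E1; rewrite {1 2}/phi => ->.
  by rewrite (@derive_val _ _ _ _ _ _ _ (dphi _)) E2 mulrA expr2.
move=> dFu dFw dFuw dFwu c1 c2; apply/eqP; rewrite -subr_eq0 -normr_le0.
have tri (M A B e : R) : `|M - A| <= e / 2 -> `|M - B| <= e / 2 -> `|A - B| <= e.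
  rewrite distrC => I1 I2.
  by rewrite -(subrKA M) [leRHS]splitr (le_trans (ler_normD _ _)) // lerD.
apply/ler_addgt0Pr => e e0; rewrite add0r.
have e2 : 0 < e / 2 by rewrite divr_gt0.
have [d1 d10 H1] := near_line2 w u c1 e2.
have [d2 d20 H2] := near_line2 u w c2 e2.
pose h := Num.min d1 d2.
have h0 : 0 < h by rewrite lt_min d10 d20.
have [c [d [cd dd E1]]] := second u w h (lt0r_neq0 h0) dFu dFuw.
have [c' [d' [cd' dd' E2]]] := second w u h (lt0r_neq0 h0) dFw dFwu.
have E : 'D_w ('D_u F) (d *: w + (c *: u + x)) = 'D_u ('D_w F) (d' *: u + (c' *: w + x)).
  suff : h ^+ 2 * 'D_w ('D_u F) (d *: w + (c *: u + x)) =
    h ^+ 2 * 'D_u ('D_w F) (d' *: u + (c' *: w + x)).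
    by move/(mulfI (expf_neq0 2 (lt0r_neq0 h0))).
  have FE : F (h *: w + (h *: u + x)) = F (h *: u + (h *: w + x)).
    by congr F; exact: addrCA.
  apply: (etrans (esym E1)); apply: (etrans _ E2); move: FE.
  move: (F (h *: w + (h *: u + x))) (F (h *: u + (h *: w + x))) (F (h *: u + x)) (F (h *: w + x)) (F x).
  by move=> A0 A B C D ->; ring.
move: cd dd cd' dd'; rewrite (gtr0_norm h0) => cd dd cd' dd'.
have hd1 : h <= d1 by rewrite ge_min lexx.
have hd2 : h <= d2 by rewrite ge_min lexx orbT.
have I1 := H1 _ _ (le_trans dd hd1) (le_trans cd hd1).
have I2 := H2 _ _ (le_trans dd' hd2) (le_trans cd' hd2).
rewrite -E in I2.
exact: tri I1 I2.
Qed.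

End Line.

Definition ex : plane R := (1, 0).
Definition ey : plane R := (0, 1).

Lemma planeE (p : plane R) : p = p.1 *: ex + p.2 *: ey.
Proof.
by case: p => x y; apply/pair_equal_spec; rewrite /= !scaler0 addr0 add0r ![_%:A]mulr1.
Qed.

(** The increment is split into a vertical and a horizontal step; the mean value theorem on each
    leaves only the variation of a continuous partial derivative. *)
Lemma is_diff_plane (F : plane R -> R) (p : plane R) :
  (forall y, derivable F y ex) -> (forall y, derivable F y ey) ->
  {for p, continuous ('D_ex F)} -> {for p, continuous ('D_ey F)} ->
  is_diff p F (fun v => v.1 * 'D_ex F p + v.2 * 'D_ey F p).
Proof.
move=> dx dy cx cy; pose L (v : plane R) : R := v.1 * 'D_ex F p + v.2 * 'D_ey F p.
have linL : linear L.
  move=> k u v; rewrite /L /= /GRing.scale /=.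
  by move: ('D_ex F p) ('D_ey F p) => A B; ring.
pose pL := GRing.isLinear.Build _ _ _ _ _ linL.
pose lL : {linear plane R -> R} := HB.pack L pL.
have cL : continuous lL.
  move=> v; rewrite /continuous_at /= /L; apply: cvgD.
    by apply: cvgM; [exact: cvg_fst|exact: cvg_cst].
  by apply: cvgM; [exact: cvg_snd|exact: cvg_cst].
have bound (a b A B N e : R) : `|a| <= N -> `|b| <= N -> `|A| <= e / 2 -> `|B| <= e / 2 ->
    `|a * A + b * B| <= e * N.
  move=> aN bN Ae Be; rewrite (le_trans (ler_normD _ _)) // [e]splitr mulrDl !normrM.
  by rewrite lerD // mulrC ler_pM.
have H : F \o shift p = cst (F p) + lL +o_ 0 id.
  apply/eqaddoP => _/posnumP[e].
  have e2 : 0 < e%:num / 2 :> R by rewrite divr_gt0.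
  have [d1 d10 H1] := near_line2 ex ey cx e2.
  have [d2 d20 H2] := near_line2 ex ey cy e2.
  pose d := Num.min d1 d2; have d0 : 0 < d by rewrite lt_min d10 d20.
  near=> v => /=.
  have vd : `|v| <= d.
    by near: v; apply: (@cvgr0_norm_le _ _ _ _ _ id) => //; exact: cvg_id.
  have v1v : `|v.1| <= `|v| by rewrite prod_normE le_max lexx.
  have v2v : `|v.2| <= `|v| by rewrite prod_normE le_max lexx orbT.
  have [c1 c1v E1] := mvt_line (v.2 *: ey + p) v.1 dx.
  have [c2 c2v E2] := mvt_line p v.2 dy.
  have hd1 : d <= d1 by rewrite ge_min lexx.
  have hd2 : d <= d2 by rewrite ge_min lexx orbT.
  have I1 := H1 c1 v.2 (le_trans c1v (le_trans v1v (le_trans vd hd1)))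
     (le_trans v2v (le_trans vd hd1)).
  have := H2 0 c2; rewrite scale0r add0r normr0 => /(_ (ltW d20)) H2'.
  have I2 := H2' (le_trans c2v (le_trans v2v (le_trans vd hd2))).
  rewrite !fctE.
  have -> : F (v + p) - (F p + (v.1 * 'D_ex F p + v.2 * 'D_ey F p)) =
     v.1 * ('D_ex F (c1 *: ex + (v.2 *: ey + p)) - 'D_ex F p) +
     v.2 * ('D_ey F (c2 *: ey + p) - 'D_ey F p).
    rewrite !mulrBr -E1 -E2 {1}(planeE v) -addrA.
    by move: ('D_ex F p) ('D_ey F p) (F _) (F _) (F _) => A B X Y Z; ring.
  exact: (bound _ _ _ _ _ _ v1v v2v I1 I2).
have dE := diff_unique cL H.
apply: DiffDef; last by rewrite dE.
by apply/diff_locallyP; rewrite dE.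
Unshelve. all: by end_near. Qed.

End Plane.

(** * Complex-valued functions and the Wirtinger operators *)

Lemma ReM (R : rcfType) (x y : R[i]) :
  Re (x * y) = Re x * Re y - Im x * Im y.
Proof. by case: x; case: y. Qed.
Lemma ImM (R : rcfType) (x y : R[i]) :
  Im (x * y) = Re x * Im y + Im x * Re y.
Proof. by case: x; case: y. Qed.
Lemma ReD (R : rcfType) (x y : R[i]) :
  Re (x + y) = Re x + Re y.
Proof. by case: x; case: y. Qed.
Lemma ImD (R : rcfType) (x y : R[i]) :
  Im (x + y) = Im x + Im y.
Proof. by case: x; case: y. Qed.
Lemma ReN (R : rcfType) (x : R[i]) : Re (- x) = - Re x.
Proof. by case: x. Qed.
Lemma ImN (R : rcfType) (x : R[i]) : Im (- x) = - Im x.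
Proof. by case: x. Qed.
Lemma ReJ (R : rcfType) (x : R[i]) : Re (conjc x) = Re x.
Proof. by case: x. Qed.
Lemma ImJ (R : rcfType) (x : R[i]) : Im (conjc x) = - Im x.
Proof. by case: x. Qed.
Lemma ReV (R : rcfType) (x : R[i]) :
  Re x^-1 = Re x / (Re x ^+ 2 + Im x ^+ 2).
Proof. by case: x. Qed.
Lemma ImV (R : rcfType) (x : R[i]) :
  Im x^-1 = - (Im x / (Re x ^+ 2 + Im x ^+ 2)).
Proof. by case: x. Qed.
Definition ReImE := (ReM, ImM, ReD, ImD, ReN, ImN, ReJ, ImJ).

Section Conj.
Context {R : rcfType}.
Implicit Types x y : R[i].
Lemma conjcD x y : conjc (x + y) = conjc x + conjc y. Proof. exact: rmorphD. Qed.
Lemma conjcN x : conjc (- x) = - conjc x. Proof. exact: rmorphN. Qed.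
Lemma conjcM x y : conjc (x * y) = conjc x * conjc y. Proof. exact: rmorphM. Qed.
Lemma conjcX x n : conjc (x ^+ n) = conjc x ^+ n. Proof. exact: rmorphXn. Qed.
Lemma conjcV x : conjc (x^-1) = (conjc x)^-1. Proof. exact: fmorphV. Qed.
Lemma conjc_nat n : conjc (n%:R : R[i]) = n%:R. Proof. exact: rmorph_nat. Qed.
End Conj.

Lemma complex_ext (R : rcfType) (x y : R[i]) :
  Re x = Re y -> Im x = Im y -> x = y.
Proof. by case: x; case: y => /= ? ? ? ? -> ->. Qed.

Lemma normsq_neq0 (R : rcfType) (x : R[i]) : x != 0 ->
  Re x ^+ 2 + Im x ^+ 2 != 0.
Proof.
by case: x => a b; rewrite eq_complex negb_and /= => h; rewrite paddr_eq0 ?sqr_ge0 // !sqrf_eq0 negb_and.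
Qed.

Section ComplexDerivative.
Context {R : realType} {V : normedModType R}.
Local Notation C := R[i].
Implicit Types (F G : V -> C) (p v : V) (d e : C).

(** All differentiation is over the reals. A relation, unlike a derivative operator, lets each rule
    deliver existence and value together. *)
Definition cder F p v d : Prop :=
  is_derive p v (fun y => Re (F y)) (Re d) /\
  is_derive p v (fun y => Im (F y)) (Im d).

Lemma cder_unique F p v d e : cder F p v d -> cder F p v e -> d = e.
Proof.
move=> [[_ r1] [_ i1]] [[_ r2] [_ i2]]; apply: complex_ext.
  by rewrite -r1 -r2.
by rewrite -i1 -i2.
Qed.

Lemma cder_eq F p v d e : cder F p v d -> d = e -> cder F p v e.
Proof. by move=> ? <-. Qed.

Lemma cder_ext F G p v d : F =1 G -> cder F p v d -> cder G p v d.
Proof. by move=> /funext ->. Qed.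

Lemma cder_near F G p v d : (\near p, F p = G p) -> cder F p v d -> cder G p v d.
Proof.
move=> FG [h1 h2]; split.
  by apply: near_eq_is_derive h1; apply: filterS FG => y ->.
by apply: near_eq_is_derive h2; apply: filterS FG => y ->.
Qed.

Lemma cder_cst (c : C) p v : cder (fun=> c) p v 0.
Proof. by split; exact: is_derive_cst. Qed.

Lemma cderD F G p v d e : cder F p v d -> cder G p v e ->
  cder (fun y => F y + G y) p v (d + e).
Proof.
move=> [h1 h2] [h3 h4]; split; rewrite !ReImE.
  have := is_deriveD h1 h3; congr (is_derive _ _ _ _).
  by apply/funext => y; rewrite /= ReD.
have := is_deriveD h2 h4; congr (is_derive _ _ _ _).
by apply/funext => y; rewrite /= ImD.
Qed.

Lemma cderN F p v d : cder F p v d -> cder (fun y => - F y) p v (- d).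
Proof.
move=> [h1 h2]; split; rewrite !ReImE.
  have := is_deriveN h1; congr (is_derive _ _ _ _).
  by apply/funext => y; rewrite /= ReN.
have := is_deriveN h2; congr (is_derive _ _ _ _).
by apply/funext => y; rewrite /= ImN.
Qed.

Lemma cderJ F p v d : cder F p v d -> cder (fun y => conjc (F y)) p v (conjc d).
Proof.
move=> [h1 h2]; split; rewrite !ReImE.
  move: h1; congr (is_derive _ _ _ _).
  by apply/funext => y; rewrite /= ReJ.
have := is_deriveN h2; congr (is_derive _ _ _ _).
by apply/funext => y; rewrite /= ImJ.
Qed.

Lemma cderM F G p v d e : cder F p v d -> cder G p v e ->
  cder (fun y => F y * G y) p v (d * G p + F p * e).
Proof.
move=> [h1 h2] [h3 h4]; split; rewrite !ReImE.
  have /is_derive_eq := is_deriveB (is_deriveM h1 h3) (is_deriveM h2 h4).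
  move=> /(_ (Re d * Re (G p) - Im d * Im (G p) +
   (Re (F p) * Re e - Im (F p) * Im e))) H.
  have := H _; rewrite (_ : (fun y => Re (F y * G y)) =
   ((fun y => Re (F y)) * (fun y => Re (G y)) -
    (fun y => Im (F y)) * (fun y => Im (G y)))); last first.
    by apply/funext => y; rewrite ReM.
  by apply; rewrite /GRing.scale /=; ring.
have /is_derive_eq := is_deriveD (is_deriveM h1 h4) (is_deriveM h2 h3).
move=> /(_ (Re d * Im (G p) + Im d * Re (G p) +
   (Re (F p) * Im e + Im (F p) * Re e))) H.
have := H _; rewrite (_ : (fun y => Im (F y * G y)) =
   ((fun y => Re (F y)) * (fun y => Im (G y)) +
    (fun y => Im (F y)) * (fun y => Re (G y)))); last first.
  by apply/funext => y; rewrite ImM.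
by apply; rewrite /GRing.scale /=; ring.
Qed.

Lemma cderV F p v d : F p != 0 -> cder F p v d ->
  cder (fun y => (F y)^-1) p v (- (d * ((F p)^-1 * (F p)^-1))).
Proof.
move=> Fp0 [h1 h2].
pose N (y : V) := Re (F y) ^+ 2 + Im (F y) ^+ 2.
have N0 : N p != 0 by exact: normsq_neq0.
have dN := is_deriveD (is_deriveM h1 h1) (is_deriveM h2 h2).
have NE : N = (fun y => Re (F y)) * (fun y => Re (F y)) +
              (fun y => Im (F y)) * (fun y => Im (F y)).
  by apply/funext.
rewrite -NE in dN.
have dN' : derivable N p v by case: dN.
have := derivableP (derivableV N0 dN'); rewrite (deriveV N0 dN') derive_val => dV.
rewrite {1}/N in N0; split.
  rewrite (_ : (fun y => Re (F y)^-1) = (fun y => Re (F y)) * (fun y => (N y)^-1)); last first.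
    by apply/funext => y; rewrite ReV.
  apply: (is_derive_eq (is_deriveM h1 dV)).
  rewrite !ReImE !ReV !ImV /N /GRing.scale /=.
  by move: N0; move: (Re (F p)) (Im (F p)) (Re d) (Im d) => a b x y N0; field.
rewrite (_ : (fun y => Im (F y)^-1) = - ((fun y => Im (F y)) * (fun y => (N y)^-1))); last first.
  by apply/funext => y; rewrite ImV.
apply: (is_derive_eq (is_deriveN (is_deriveM h2 dV))).
rewrite !ReImE !ReV !ImV /N /GRing.scale /=.
by move: N0; move: (Re (F p)) (Im (F p)) (Re d) (Im d) => a b x y N0; field.
Qed.

Lemma cder_sum (I : Type) (r : seq I) (F : I -> V -> C) p v (d : I -> C) :
  (forall i, cder (F i) p v (d i)) ->
  cder (fun y => \sum_(i <- r) F i y) p v (\sum_(i <- r) d i).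
Proof.
move=> H; elim: r => [|i r IH].
  rewrite big_nil; apply: cder_ext (cder_cst 0 p v) => y.
  by rewrite big_nil.
rewrite big_cons; apply: cder_ext (cderD (H i) IH) => y.
by rewrite big_cons.
Qed.

Definition mder m n (M : V -> 'M[C]_(m, n)) p v (D : 'M[C]_(m, n)) : Prop :=
  forall i j, cder (fun y => M y i j) p v (D i j).

End ComplexDerivative.

Definition adj (R : rcfType) m n (M : 'M[R[i]]_(m, n)) : 'M[R[i]]_(n, m) :=
  map_mx (@conjc R) M^T.

Section Wirtinger.
Context {R : realType}.
Local Notation C := R[i].
Implicit Types (F G : plane R -> C) (p : plane R) (d e : C).

(** [d] is the derivative in z and [e] the one in its conjugate: [F_x = d + e] and
    [F_y = i (d - e)]. The Cauchy-Riemann equations are the case [e = 0]. *)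
Definition wder F p d e : Prop :=
  cder F p ex (d + e) /\ cder F p ey ('i%C * (d - e)).

Lemma mulii : 'i%C * 'i%C = -1 :> C.
Proof. by rewrite -expr2 sqr_i. Qed.

Lemma i_neq0 : 'i%C != 0 :> C.
Proof. by rewrite eq_complex negb_and /= oner_eq0 orbT. Qed.

Lemma wder_unique F p d e d' e' : wder F p d e -> wder F p d' e' -> d = d' /\ e = e'.
Proof.
move=> [x1 y1] [x2 y2].
have E1 := cder_unique x1 x2; have E2 := mulfI i_neq0 (cder_unique y1 y2).
have n2 : 2 != 0 :> C by rewrite pnatr_eq0.
split; apply: (mulfI n2).
  have -> : 2 * d = (d + e) + (d - e) by ring.
  by rewrite E1 E2; ring.
have -> : 2 * e = (d + e) - (d - e) by ring.
by rewrite E1 E2; ring.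
Qed.

Lemma wder_eq F p d e d' e' : wder F p d e -> d = d' -> e = e' -> wder F p d' e'.
Proof. by move=> ? <- <-. Qed.

Lemma wder_ext F G p d e : F =1 G -> wder F p d e -> wder G p d e.
Proof. by move=> /funext ->. Qed.

Lemma wder_cst (c : C) p : wder (fun=> c) p 0 0.
Proof.
by split; rewrite ?addr0 ?subr0 ?mulr0; exact: cder_cst.
Qed.

Lemma wderD F G p d e d' e' : wder F p d e -> wder G p d' e' ->
  wder (fun y => F y + G y) p (d + d') (e + e').
Proof.
move=> [h1 h2] [h3 h4]; split.
  by apply: cder_eq (cderD h1 h3) _; ring.
by apply: cder_eq (cderD h2 h4) _; ring.
Qed.

Lemma wderN F p d e : wder F p d e -> wder (fun y => - F y) p (- d) (- e).
Proof.
move=> [h1 h2]; split.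
  by apply: cder_eq (cderN h1) _; ring.
by apply: cder_eq (cderN h2) _; ring.
Qed.

Lemma wderB F G p d e d' e' : wder F p d e -> wder G p d' e' ->
  wder (fun y => F y - G y) p (d - d') (e - e').
Proof. by move=> h1 h2; exact: wderD h1 (wderN h2). Qed.

Lemma wderM F G p d e d' e' : wder F p d e -> wder G p d' e' ->
  wder (fun y => F y * G y) p (d * G p + F p * d') (e * G p + F p * e').
Proof.
move=> [h1 h2] [h3 h4]; split.
  by apply: cder_eq (cderM h1 h3) _; ring.
by apply: cder_eq (cderM h2 h4) _; ring.
Qed.

Lemma wderJ F p d e : wder F p d e -> wder (fun y => conjc (F y)) p (conjc e) (conjc d).
Proof.
move=> [h1 h2]; split.
  by apply: cder_eq (cderJ h1) _; rewrite rmorphD addrC.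
apply: cder_eq (cderJ h2) _.
by rewrite rmorphM rmorphB /= (_ : _ -i* _ = - 'i%C) ?mulNr -?mulrN ?opprB //= /GRing.opp /= oppr0.
Qed.

Lemma wderV F p d e : F p != 0 -> wder F p d e ->
  wder (fun y => (F y)^-1) p (- (d * ((F p)^-1 * (F p)^-1)))
    (- (e * ((F p)^-1 * (F p)^-1))).
Proof.
move=> Fp0 [h1 h2]; split.
  by apply: cder_eq (cderV Fp0 h1) _; ring.
by apply: cder_eq (cderV Fp0 h2) _; ring.
Qed.

Definition mwder m n (M : plane R -> 'M[C]_(m, n)) p (D E : 'M[C]_(m, n)) : Prop :=
  forall i j, wder (fun y => M y i j) p (D i j) (E i j).

End Wirtinger.

Section Adjoint.
Context {R : rcfType}.
Local Notation C := R[i].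

Lemma adjE m n (M : 'M[C]_(m, n)) i j : adj M i j = conjc (M j i).
Proof. by rewrite !mxE. Qed.
Lemma adjK m n (M : 'M[C]_(m, n)) : adj (adj M) = M.
Proof. by apply/matrixP => i j; rewrite !adjE conjcK. Qed.
Lemma adjMm m n k (M : 'M[C]_(m, n)) (N : 'M[C]_(n, k)) :
  adj (M *m N) = adj N *m adj M.
Proof. by rewrite /adj trmx_mul map_mxM. Qed.
Lemma adjD m n (M N : 'M[C]_(m, n)) : adj (M + N) = adj M + adj N.
Proof. by apply/matrixP => i j; rewrite !(adjE, mxE) rmorphD. Qed.
Lemma adjN m n (M : 'M[C]_(m, n)) : adj (- M) = - adj M.
Proof. by apply/matrixP => i j; rewrite !(adjE, mxE) rmorphN. Qed.
Lemma adjB m n (M N : 'M[C]_(m, n)) : adj (M - N) = adj M - adj N.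
Proof. by rewrite adjD adjN. Qed.
Lemma adjZ m n (c : C) (M : 'M[C]_(m, n)) : adj (c *: M) = conjc c *: adj M.
Proof. by apply/matrixP => i j; rewrite !(adjE, mxE) rmorphM. Qed.
Lemma adj0 m n : adj (0 : 'M[C]_(m, n)) = 0.
Proof. by apply/matrixP => i j; rewrite !(adjE, mxE) conjc0. Qed.
Lemma adj1 n : adj (1%:M : 'M[C]_n) = 1%:M.
Proof. by rewrite /adj trmx1 map_mx1. Qed.
Lemma adjM n (M N : 'M[C]_n.+1) : adj (M * N) = adj N * adj M.
Proof. exact: adjMm. Qed.

Lemma tr_adj n (M : 'M[C]_n) : \tr (adj M) = conjc (\tr M).
Proof. by rewrite rmorph_sum; apply: eq_bigr => i _; rewrite adjE. Qed.

Lemma tr_adj_mul m n (M : 'M[C]_(m, n)) :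
  \tr (adj M *m M) = \sum_j \sum_i `|M i j| ^+ 2.
Proof.
apply: eq_bigr => j _; rewrite mxE; apply: eq_bigr => i _.
by rewrite adjE sqr_normc mulrC.
Qed.

(** The trace is the sum of the squared moduli of the entries. This positivity later reduces the
    identity [resolution] to a computation of traces. *)
Lemma adj_mul_eq0 m n (M : 'M[C]_(m, n)) : \tr (adj M *m M) = 0 -> M = 0.
Proof.
rewrite tr_adj_mul => /eqP; rewrite psumr_eq0 => [/allP H|j _]; last first.
  by apply: sumr_ge0 => i _; rewrite exprn_ge0.
apply/matrixP => i j; rewrite mxE.
have /eqP := H j (mem_index_enum _); rewrite /= => /eqP.
rewrite psumr_eq0 => [/allP /(_ i (mem_index_enum _)) /=|k _]; last by rewrite exprn_ge0.
by rewrite expf_eq0 /= normr_eq0 => /eqP.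
Qed.

End Adjoint.

Section MatrixDerivative.
Context {R : realType}.
Local Notation C := R[i].

Section Directional.
Context {V : normedModType R}.
Implicit Types (p v : V).

Lemma mder_mul m n k (M : V -> 'M[C]_(m, n)) (N : V -> 'M[C]_(n, k)) p v D E :
  mder M p v D -> mder N p v E -> mder (fun y => M y *m N y) p v (D *m N p + M p *m E).
Proof.
move=> HM HN i j; apply: (@cder_ext _ _ (fun y => \sum_l M y i l * N y l j)).
  by move=> y; rewrite mxE.
apply: cder_eq; first by apply: cder_sum => l; exact: cderM (HM i l) (HN l j).
by rewrite !mxE -big_split.
Qed.

Lemma mder_cst m n (M : 'M[C]_(m, n)) p v : mder (fun=> M) p v 0.
Proof. by move=> i j; rewrite mxE; exact: cder_cst. Qed.

Lemma mderZ m n (F : V -> C) (M : V -> 'M[C]_(m, n)) p v d D :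
  cder F p v d -> mder M p v D ->
  mder (fun y => F y *: M y) p v (d *: M p + F p *: D).
Proof.
move=> HF HM i j; rewrite !mxE; apply: cder_ext (cderM HF (HM i j)) => y.
by rewrite mxE.
Qed.

Lemma mderD m n (M N : V -> 'M[C]_(m, n)) p v D E :
  mder M p v D -> mder N p v E -> mder (fun y => M y + N y) p v (D + E).
Proof.
move=> HM HN i j; rewrite mxE; apply: cder_ext (cderD (HM i j) (HN i j)) => y.
by rewrite mxE.
Qed.

Lemma mder_eq m n (M : V -> 'M[C]_(m, n)) p v D E :
  mder M p v D -> D = E -> mder M p v E.
Proof. by move=> ? <-. Qed.

Lemma mder_ext m n (M N : V -> 'M[C]_(m, n)) p v D :
  M =1 N -> mder M p v D -> mder N p v D.
Proof. by move=> /funext ->. Qed.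

Lemma mder_near m n (M N : V -> 'M[C]_(m, n)) p v D :
  (\near p, M p = N p) -> mder M p v D -> mder N p v D.
Proof.
by move=> MN H i j; apply: cder_near (H i j); apply: filterS MN => y ->.
Qed.

Lemma mder_unique m n (M : V -> 'M[C]_(m, n)) p v D E :
  mder M p v D -> mder M p v E -> D = E.
Proof. by move=> h1 h2; apply/matrixP => i j; exact: cder_unique (h1 i j) (h2 i j). Qed.

End Directional.

Implicit Types p : plane R.

Lemma mwderP m n (M : plane R -> 'M[C]_(m, n)) p D E :
  mwder M p D E <-> mder M p ex (D + E) /\ mder M p ey ('i%C *: (D - E)).
Proof.
split=> [H|[H1 H2] i j].
  by split=> i j; have [h1 h2] := H i j; rewrite !mxE.
by split; [have := H1 i j|have := H2 i j]; rewrite !mxE.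
Qed.

Lemma mwder_unique m n (M : plane R -> 'M[C]_(m, n)) p D E D' E' :
  mwder M p D E -> mwder M p D' E' -> D = D' /\ E = E'.
Proof.
move=> h1 h2; split; apply/matrixP => i j; first by have [] := wder_unique (h1 i j) (h2 i j).
by have [] := wder_unique (h1 i j) (h2 i j).
Qed.

Lemma mwder_eq m n (M : plane R -> 'M[C]_(m, n)) p D E D' E' :
  mwder M p D E -> D = D' -> E = E' -> mwder M p D' E'.
Proof. by move=> ? <- <-. Qed.

Lemma mwder_ext m n (M N : plane R -> 'M[C]_(m, n)) p D E :
  M =1 N -> mwder M p D E -> mwder N p D E.
Proof. by move=> /funext ->. Qed.

Lemma mwder_cst m n (M : 'M[C]_(m, n)) p : mwder (fun=> M) p 0 0.
Proof. by move=> i j; rewrite !mxE; exact: wder_cst. Qed.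

Lemma mwderD m n (M N : plane R -> 'M[C]_(m, n)) p D E D' E' :
  mwder M p D E -> mwder N p D' E' ->
  mwder (fun y => M y + N y) p (D + D') (E + E').
Proof.
move=> HM HN i j; rewrite !mxE; apply: wder_ext (wderD (HM i j) (HN i j)) => y.
by rewrite mxE.
Qed.

Lemma mwderN m n (M : plane R -> 'M[C]_(m, n)) p D E :
  mwder M p D E -> mwder (fun y => - M y) p (- D) (- E).
Proof.
move=> HM i j; rewrite !mxE; apply: wder_ext (wderN (HM i j)) => y.
by rewrite mxE.
Qed.

Lemma mwderB m n (M N : plane R -> 'M[C]_(m, n)) p D E D' E' :
  mwder M p D E -> mwder N p D' E' ->
  mwder (fun y => M y - N y) p (D - D') (E - E').
Proof. by move=> h1 h2; exact: mwderD h1 (mwderN h2). Qed.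

Lemma mwderZ m n (F : plane R -> C) (M : plane R -> 'M[C]_(m, n)) p d e D E :
  wder F p d e -> mwder M p D E ->
  mwder (fun y => F y *: M y) p (d *: M p + F p *: D) (e *: M p + F p *: E).
Proof.
move=> HF HM i j; rewrite !mxE; apply: wder_ext (wderM HF (HM i j)) => y.
by rewrite mxE.
Qed.

Lemma mwder_adj m n (M : plane R -> 'M[C]_(m, n)) p D E :
  mwder M p D E -> mwder (fun y => adj (M y)) p (adj E) (adj D).
Proof.
move=> HM i j; rewrite !adjE; apply: wder_ext (wderJ (HM j i)) => y.
by rewrite adjE.
Qed.

Lemma mwder_mul m n k (M : plane R -> 'M[C]_(m, n)) (N : plane R -> 'M[C]_(n, k)) p
    D E D' E' :
  mwder M p D E -> mwder N p D' E' ->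
  mwder (fun y => M y *m N y) p (D *m N p + M p *m D') (E *m N p + M p *m E').
Proof.
move=> /mwderP[h1 h2] /mwderP[h3 h4]; apply/mwderP; split.
  apply: mder_eq (mder_mul h1 h3) _.
  by rewrite mulmxDl mulmxDr addrACA.
apply: mder_eq (mder_mul h2 h4) _.
rewrite -scalemxAl -scalemxAr -scalerDr mulmxBl mulmxBr; congr (_ *: _).
by rewrite opprD addrACA.
Qed.

Lemma mwderM n (M N : plane R -> 'M[C]_n.+1) p D E D' E' :
  mwder M p D E -> mwder N p D' E' ->
  mwder (fun y => M y * N y) p (D * N p + M p * D') (E * N p + M p * E').
Proof. exact: mwder_mul. Qed.

End MatrixDerivative.

(** * Smooth complex-valued and matrix-valued functions *)

Section ComplexSmooth.
Context {R : realType} {V : normedModType R}.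
Local Notation C := R[i].
Implicit Types (F G : V -> C) (U : set V).

Definition csmooth_on U F :=
  smooth_on U (fun y => Re (F y)) /\ smooth_on U (fun y => Im (F y)).

Lemma csmooth_on_cst U (c : C) : csmooth_on U (fun=> c).
Proof. by split=> n; exact: Cn_on_cst. Qed.

Lemma csmooth_onD U F G : open U -> csmooth_on U F -> csmooth_on U G ->
  csmooth_on U (fun y => F y + G y).
Proof.
move=> oU [f1 f2] [g1 g2]; split=> n.
  by rewrite (_ : (fun _ => _) = (fun y => Re (F y) + Re (G y))); [exact: Cn_onD|apply/funext => y; rewrite ReD].
by rewrite (_ : (fun _ => _) = (fun y => Im (F y) + Im (G y))); [exact: Cn_onD|apply/funext => y; rewrite ImD].
Qed.

Lemma Cn_onN n U (F : V -> R) : open U -> Cn_on n U F -> Cn_on n U (fun x => - F x).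
Proof.
move=> oU h; rewrite (_ : (fun _ => _) = (fun y => (-1) * F y)).
  by apply: Cn_onM => //; exact: Cn_on_cst.
by apply/funext => y; rewrite mulN1r.
Qed.

Lemma csmooth_onJ U F : open U -> csmooth_on U F -> csmooth_on U (fun y => conjc (F y)).
Proof.
move=> oU [f1 f2]; split=> n.
  by rewrite (_ : (fun _ => _) = (fun y => Re (F y))); [exact: f1|apply/funext => y; rewrite ReJ].
by rewrite (_ : (fun _ => _) = (fun y => - Im (F y))); [exact: Cn_onN|apply/funext => y; rewrite ImJ].
Qed.

Lemma csmooth_onM U F G : open U -> csmooth_on U F -> csmooth_on U G ->
  csmooth_on U (fun y => F y * G y).
Proof.
move=> oU [f1 f2] [g1 g2]; split=> n.
  rewrite (_ : (fun _ => _) = (fun y => Re (F y) * Re (G y) + - (Im (F y) * Im (G y)))).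
    by apply: Cn_onD => //; [|apply: Cn_onN => //]; apply: Cn_onM.
  by apply/funext => y; rewrite ReM.
rewrite (_ : (fun _ => _) = (fun y => Re (F y) * Im (G y) + Im (F y) * Re (G y))).
  by apply: Cn_onD => //; apply: Cn_onM.
by apply/funext => y; rewrite ImM.
Qed.

Lemma csmooth_onV U F : open U -> {in U, forall x, F x != 0} -> csmooth_on U F ->
  csmooth_on U (fun y => (F y)^-1).
Proof.
move=> oU F0 [f1 f2].
have H n : Cn_on n U (fun y => (Re (F y) * Re (F y) + Im (F y) * Im (F y))^-1).
  apply: Cn_onV => //; last by apply: Cn_onD => //; apply: Cn_onM.
  by move=> x xU; rewrite -!expr2; apply/normsq_neq0/F0.
split=> n.
  rewrite (_ : (fun _ => _) = (fun y => Re (F y) * (Re (F y) * Re (F y) + Im (F y) * Im (F y))^-1)).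
    by apply: Cn_onM.
  by apply/funext => y; rewrite ReV -!expr2.
rewrite (_ : (fun _ => _) = (fun y => - (Im (F y) * (Re (F y) * Re (F y) + Im (F y) * Im (F y))^-1))).
  by apply: Cn_onN => //; apply: Cn_onM.
by apply/funext => y; rewrite ImV -!expr2.
Qed.

Lemma csmooth_on_sum (I : Type) (r : seq I) U (F : I -> V -> C) : open U ->
  (forall i, csmooth_on U (F i)) -> csmooth_on U (fun y => \sum_(i <- r) F i y).
Proof.
move=> oU H; elim: r => [|i r IH].
  rewrite (_ : (fun _ => _) = fun=> 0); first exact: csmooth_on_cst.
  by apply/funext => y; rewrite big_nil.
rewrite (_ : (fun _ => _) = fun y => F i y + \sum_(i <- r) F i y).
  exact: csmooth_onD.
by apply/funext => y; rewrite big_cons.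
Qed.

Lemma csmooth_on_ext U F G : open U -> {in U, F =1 G} -> csmooth_on U F -> csmooth_on U G.
Proof.
move=> oU FG [h1 h2]; split=> n.
  by apply: Cn_on_ext (h1 n) => // x xU; rewrite FG.
by apply: Cn_on_ext (h2 n) => // x xU; rewrite FG.
Qed.

(** Derivatives at a point see only a neighbourhood. Charts give smoothness on small open sets,
    while the projection is wanted smooth on the whole plane. *)
Lemma Cn_on_local n (F : V -> R) :
  (forall x, exists2 U, open_nbhs x U & Cn_on n U F) -> Cn_on n setT F.
Proof.
have xin (U : set V) x : open_nbhs x U -> x \in U by move=> [_ ?]; rewrite inE.
elim: n F => [|n IH] F H.
  split=> // x _; have [U /xin xU /Cn_on_continuous cF] := H x; exact: cF.
split.
  move=> x _; have [U /xin xU /Cn_on_continuous cF] := H x; exact: cF.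
move=> v; split.
  by move=> x _; have [U /xin xU [_ /(_ v)[dF _]]] := H x; exact: dF.
by apply: IH => x; have [U xU [_ /(_ v)[_ CF]]] := H x; exists U.
Qed.

Lemma csmooth_on_local F :
  (forall x, exists2 U, open_nbhs x U & csmooth_on U F) -> csmooth_on setT F.
Proof.
move=> H; split=> n; apply: Cn_on_local => x; have [U xU [h1 h2]] := H x; exists U => //.
Qed.

Lemma csmooth_cder U F x v : csmooth_on U F -> x \in U ->
  cder F x v ('D_v (fun y => Re (F y)) x +i* 'D_v (fun y => Im (F y)) x).
Proof.
move=> [h1 h2] xU; split=> /=.
  by apply: derivableP; have [_ /(_ v)[d _]] := h1 1%N; exact: d.
by apply: derivableP; have [_ /(_ v)[d _]] := h2 1%N; exact: d.
Qed.

End ComplexSmooth.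

Lemma Re_lin (R : rcfType) (a b : R) (x y : R[i]) :
  Re (a%:C * x + b%:C * y) = a * Re x + b * Re y.
Proof. by rewrite !ReImE /= !mul0r !subr0. Qed.
Lemma Im_lin (R : rcfType) (a b : R) (x y : R[i]) :
  Im (a%:C * x + b%:C * y) = a * Im x + b * Im y.
Proof. by rewrite !ReImE /= !mul0r !addr0. Qed.

Section PlaneSmooth.
Context {R : realType}.
Local Notation C := R[i].
Implicit Types (F G : plane R -> C) (p : plane R).

Definition csmooth F := csmooth_on setT F.

Definition cpart (v : plane R) F p : C :=
  'D_v (fun y => Re (F y)) p +i* 'D_v (fun y => Im (F y)) p.

Lemma cpartP v F p : csmooth F -> cder F p v (cpart v F p).
Proof. by move=> sF; apply: (csmooth_cder _ sF); rewrite inE. Qed.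

Lemma csmooth_cpart v F : csmooth F -> csmooth (cpart v F).
Proof. by move=> [h1 h2]; split=> n; [have := h1 n.+1|have := h2 n.+1] => -[_ /(_ v)[]]. Qed.

Lemma cpart_sym u w F p : csmooth F -> cpart u (cpart w F) p = cpart w (cpart u F) p.
Proof.
have inT (x : plane R) : x \in setT by rewrite inE.
have key (f : plane R -> R) : smooth_on setT f -> 'D_u ('D_w f) p = 'D_w ('D_u f) p.
  move=> sf; have [_ /= H] := sf 3%N; apply: derive_sym.
  - by move=> y; have [d _] := H w; exact: d.
  - by move=> y; have [d _] := H u; exact: d.
  - by move=> y; have [_ [_ /(_ u)[d _]]] := H w; exact: d.
  - by move=> y; have [_ [_ /(_ w)[d _]]] := H u; exact: d.
  - by have [_ [_ /(_ u)[_ [c _]]]] := H w; exact: c.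
  - by have [_ [_ /(_ w)[_ [c _]]]] := H u; exact: c.
by move=> [h1 h2]; apply: complex_ext; exact: key.
Qed.

Definition dz F p : C := (cpart ex F p - 'i%C * cpart ey F p) / 2.
Definition dzb F p : C := (cpart ex F p + 'i%C * cpart ey F p) / 2.

Lemma wderP F p : csmooth F -> wder F p (dz F p) (dzb F p).
Proof.
move=> sF; have n2 : 2 != 0 :> C by rewrite pnatr_eq0.
split.
  apply: cder_eq (cpartP ex p sF) _; rewrite /dz /dzb.
  by move: (cpart ex F p) (cpart ey F p) => a b; field.
apply: cder_eq (cpartP ey p sF) _; rewrite /dz /dzb.
move: (cpart ey F p) (cpart ex F p) => a b.
transitivity (- ('i%C * 'i%C) * a); last by field.
by rewrite mulii opprK mul1r.
Qed.

Lemma csmooth_cst (c : C) : csmooth (fun=> c).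
Proof. exact: csmooth_on_cst. Qed.
Lemma csmoothD F G : csmooth F -> csmooth G -> csmooth (fun y => F y + G y).
Proof. by move=> ? ?; apply: csmooth_onD => //; exact: openT. Qed.
Lemma csmoothM F G : csmooth F -> csmooth G -> csmooth (fun y => F y * G y).
Proof. by move=> ? ?; apply: csmooth_onM => //; exact: openT. Qed.
Lemma csmoothJ F : csmooth F -> csmooth (fun y => conjc (F y)).
Proof. by move=> ?; apply: csmooth_onJ => //; exact: openT. Qed.
Lemma csmoothN F : csmooth F -> csmooth (fun y => - F y).
Proof.
move=> sF; rewrite (_ : (fun _ => _) = (fun y => (-1) * F y)).
  by apply: csmoothM => //; exact: csmooth_cst.
by apply/funext => y; rewrite mulN1r.
Qed.

Lemma csmooth_dz F : csmooth F -> csmooth (dz F).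
Proof.
move=> sF; have sx := csmooth_cpart ex sF; have sy := csmooth_cpart ey sF.
apply: csmoothM; last exact: csmooth_cst.
by apply: csmoothD => //; apply: csmoothN; apply: csmoothM => //; exact: csmooth_cst.
Qed.

Lemma csmooth_dzb F : csmooth F -> csmooth (dzb F).
Proof.
move=> sF; have sx := csmooth_cpart ex sF; have sy := csmooth_cpart ey sF.
apply: csmoothM; last exact: csmooth_cst.
by apply: csmoothD => //; apply: csmoothM => //; exact: csmooth_cst.
Qed.

Lemma cpartE F p v d : cder F p v d -> cpart v F p = d.
Proof. by move=> [[_ h1] [_ h2]]; apply: complex_ext. Qed.

(** Both sides are a quarter of the Laplacian once the mixed partials are exchanged. *)
Lemma dz_dzb F p : csmooth F -> dz (dzb F) p = dzb (dz F) p.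
Proof.
move=> sF; have sx := csmooth_cpart ex sF; have sy := csmooth_cpart ey sF.
have cc v c G : csmooth G -> cpart v (fun y => c * G y) p = c * cpart v G p.
  move=> sG; apply: cpartE.
  apply: cder_eq (cderM (cder_cst c p v) (cpartP v p sG)) _.
  by rewrite mul0r add0r.
have cE v : cpart v (dzb F) p = (cpart v (cpart ex F) p + 'i%C * cpart v (cpart ey F) p) / 2.
  apply: cpartE; apply: cder_eq.
    apply: cderM (cder_cst _ _ _); apply: cderD (cpartP v p sx) _.
    apply: cderM (cder_cst _ _ _) (cpartP v p sy).
  by rewrite mulr0 addr0 mul0r add0r.
have cE' v : cpart v (dz F) p = (cpart v (cpart ex F) p - 'i%C * cpart v (cpart ey F) p) / 2.
  apply: cpartE; apply: cder_eq.
    apply: cderM (cder_cst _ _ _); apply: cderD (cpartP v p sx) _.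
    apply: cderN; apply: cderM (cder_cst _ _ _) (cpartP v p sy).
  by rewrite mulr0 addr0 mul0r add0r.
apply: etrans (congr2 (fun u v => (u - 'i%C * v) / 2) (cE ex) (cE ey)) _.
apply: etrans _ (esym (congr2 (fun u v => (u + 'i%C * v) / 2) (cE' ex) (cE' ey))).
rewrite (cpart_sym ey ex p sF).
move: (cpart ex (cpart ex F) p) (cpart ex (cpart ey F) p) (cpart ey (cpart ey F) p) => a b c.
by field.
Qed.

Definition msmooth m n (M : plane R -> 'M[C]_(m, n)) :=
  forall i j, csmooth (fun p => M p i j).

Lemma msmooth_ext m n (M N : plane R -> 'M[C]_(m, n)) : M =1 N -> msmooth M -> msmooth N.
Proof. by move=> /funext ->. Qed.

End PlaneSmooth.

HB.lock Definition mdz {R : realType} m n (M : plane R -> 'M[R[i]]_(m, n)) p :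
  'M[R[i]]_(m, n) := \matrix_(i, j) dz (fun y => M y i j) p.
HB.lock Definition mdzb {R : realType} m n (M : plane R -> 'M[R[i]]_(m, n)) p :
  'M[R[i]]_(m, n) := \matrix_(i, j) dzb (fun y => M y i j) p.
Arguments mdz {R m n} M p.
Arguments mdzb {R m n} M p.

Section MatrixSmooth.
Context {R : realType}.
Local Notation C := R[i].
Implicit Types (F G : plane R -> C) (p : plane R).

Lemma mdzE m n (M : plane R -> 'M[C]_(m, n)) p i j :
  mdz M p i j = dz (fun y => M y i j) p.
Proof. by rewrite mdz.unlock mxE. Qed.
Lemma mdzbE m n (M : plane R -> 'M[C]_(m, n)) p i j :
  mdzb M p i j = dzb (fun y => M y i j) p.
Proof. by rewrite mdzb.unlock mxE. Qed.

Lemma mwderE m n (M : plane R -> 'M[C]_(m, n)) p : msmooth M -> mwder M p (mdz M p) (mdzb M p).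
Proof. by move=> sM i j; rewrite mdzE mdzbE; exact: wderP. Qed.

Lemma msmooth_mdz m n (M : plane R -> 'M[C]_(m, n)) : msmooth M -> msmooth (mdz M).
Proof.
move=> sM i j; rewrite (_ : (fun _ => _) = dz (fun y => M y i j)).
  exact: csmooth_dz.
by apply/funext => p; rewrite mdzE.
Qed.

Lemma msmooth_mdzb m n (M : plane R -> 'M[C]_(m, n)) : msmooth M -> msmooth (mdzb M).
Proof.
move=> sM i j; rewrite (_ : (fun _ => _) = dzb (fun y => M y i j)).
  exact: csmooth_dzb.
by apply/funext => p; rewrite mdzbE.
Qed.

Lemma mdz_mdzb m n (M : plane R -> 'M[C]_(m, n)) p : msmooth M ->
  mdz (mdzb M) p = mdzb (mdz M) p.
Proof.
move=> sM; apply/matrixP => i j; rewrite mdzE mdzbE.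
have -> : (fun y => mdzb M y i j) = dzb (fun y => M y i j).
  by apply/funext => q; rewrite mdzbE.
have -> : (fun y => mdz M y i j) = dz (fun y => M y i j).
  by apply/funext => q; rewrite mdzE.
exact: dz_dzb.
Qed.

Lemma msmooth_mul m n k (M : plane R -> 'M[C]_(m, n)) (N : plane R -> 'M[C]_(n, k)) :
  msmooth M -> msmooth N -> msmooth (fun p => M p *m N p).
Proof.
move=> sM sN i j; rewrite (_ : (fun _ => _) = fun p => \sum_l M p i l * N p l j).
  by apply: csmooth_on_sum => [|l]; [exact: openT|exact: csmoothM].
by apply/funext => q; rewrite mxE.
Qed.

Lemma msmoothM n (M N : plane R -> 'M[C]_n.+1) :
  msmooth M -> msmooth N -> msmooth (fun p => M p * N p).
Proof. exact: msmooth_mul. Qed.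

Lemma msmooth_adj m n (M : plane R -> 'M[C]_(m, n)) :
  msmooth M -> msmooth (fun p => adj (M p)).
Proof.
move=> sM i j; rewrite (_ : (fun _ => _) = fun p => conjc (M p j i)).
  exact: csmoothJ.
by apply/funext => q; rewrite adjE.
Qed.

Lemma csmooth_tr n (M : plane R -> 'M[C]_n) : msmooth M -> csmooth (fun p => \tr (M p)).
Proof. by move=> sM; apply: csmooth_on_sum => [|i]; [exact: openT|exact: sM]. Qed.

(** Rescaling the parameter of the line is enough; no full differentiability is used. It serves the
    orthonormal frame of the minimality condition, a rescaling of [ex], [ey]. *)
Lemma cder_scale F p v (k : R) d : cder F p v d -> cder F p (k *: v) (k%:C * d).
Proof.
have key (f : plane R -> R) l : is_derive p v f l -> is_derive p (k *: v) f (k * l).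
  move=> H; have [->|k0] := eqVneq k 0.
    by rewrite scale0r mul0r; exact: is_derive0.
  have H' : is_derive (0 *: v + p) v f l by rewrite scale0r add0r.
  have dl := is_derive_line H'.
  have dk : is_derive (0 : R) 1 (fun s : R => s * k) k.
    apply: (is_derive_eq (is_deriveM (is_derive_id (0 : R) 1) (is_derive_cst k (0 : R) 1))).
    by rewrite /GRing.scale /= mulr0 add0r mulr1.
  have := @is_derive1_comp _ (fun s : R => f (s *: v + p)) (fun s => s * k) 0 l k.
  rewrite mul0r => /(_ dl dk) dd; rewrite mulrC.
  have E : (fun h : R => h^-1 *: (((fun s : R => f ((s * k) *: v + p)) \o shift 0) (h *: 1)
   - f ((0 * k) *: v + p))) =
   (fun h => h^-1 *: ((f \o shift p) (h *: (k *: v)) - f p)).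
    apply/funext => h /=; rewrite addr0 [h%:A]mulr1 mul0r scale0r add0r.
    by rewrite scalerA.
  case: dd => dd1 dd2; apply: DeriveDef.
    by move: dd1; rewrite /derivable -E.
  by rewrite -dd2 /derive -E.
move=> [h1 h2]; split; rewrite !ReImE /= mul0r ?subr0 ?addr0.
  exact: key.
exact: key.
Qed.

(** Every point is reached from the origin by a vertical and then a horizontal segment, and the mean
    value theorem applies on each. *)
Lemma wder_const F : (forall p, wder F p 0 0) -> forall p q, F p = F q.
Proof.
move=> H.
have key (f : plane R -> R) : (forall y v, (v = ex) \/ (v = ey) -> is_derive y v f 0) ->
    forall p, f p = f 0.
  move=> df p.
  have dx y : derivable f y ex by have [] := df y ex (or_introl erefl).
  have dy y : derivable f y ey by have [] := df y ey (or_intror erefl).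
  have [c1 _ E1] := mvt_line (p.2 *: ey) p.1 dx.
  have [c2 _ E2] := mvt_line 0 p.2 dy.
  have [_ d1] := df (c1 *: ex + p.2 *: ey) ex (or_introl erefl).
  have [_ d2] := df (c2 *: ey + 0) ey (or_intror erefl).
  move: E1 E2; rewrite d1 d2 !mulr0 addr0 -planeE => /eqP; rewrite subr_eq0 => /eqP -> /eqP.
  by rewrite subr_eq0 => /eqP.
have z p : cder F p ex 0 /\ cder F p ey 0.
  by have [h1 h2] := H p; rewrite addr0 in h1; rewrite subr0 mulr0 in h2.
have kr : forall p, Re (F p) = Re (F 0).
  by apply: key => y v [->|->]; have [[? ?] [? ?]] := z y.
have ki : forall p, Im (F p) = Im (F 0).
  by apply: key => y v [->|->]; have [[? ?] [? ?]] := z y.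
by move=> p q; apply: complex_ext; [rewrite kr (kr q)|rewrite ki (ki q)].
Qed.

Lemma mwder_const m n (M : plane R -> 'M[C]_(m, n)) :
  (forall p, mwder M p 0 0) -> forall p q, M p = M q.
Proof.
move=> H p q; apply/matrixP => i j; apply: (wder_const (F := fun y => M y i j)) => y.
by have := H y i j; rewrite !mxE.
Qed.

Definition c2p (z : C) : plane R := (Re z, Im z).
Definition p2c (p : plane R) : C := p.1 +i* p.2.

Lemma c2pK : cancel c2p p2c. Proof. by case. Qed.
Lemma p2cK : cancel p2c c2p. Proof. by case. Qed.

Definition cdiff F p :=
  differentiable (fun y => Re (F y)) p /\ differentiable (fun y => Im (F y)) p.

Lemma csmooth_cdiff F p : csmooth F -> cdiff F p.
Proof.
have inT (x : plane R) : x \in setT by rewrite inE.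
have key (f : plane R -> R) : smooth_on setT f -> differentiable f p.
  move=> sf; have [_ /= H] := sf 2%N.
  suff : is_diff p f (fun v => v.1 * 'D_ex f p + v.2 * 'D_ey f p).
    by move=> D; exact: ex_diff.
  apply: is_diff_plane.
  - by move=> y; have [d _] := H ex; exact: d.
  - by move=> y; have [d _] := H ey; exact: d.
  - by have [_ [c _]] := H ex; exact: c.
  - by have [_ [c _]] := H ey; exact: c.
by move=> [h1 h2]; split; exact: key.
Qed.

Lemma cdiff_comp F (h : plane R -> C) p : csmooth F -> cdiff h p ->
  cdiff (fun y => F (c2p (h y))) p.
Proof.
move=> /csmooth_cdiff sF [h1 h2].
have dh : differentiable (fun y => c2p (h y)) p by exact: differentiable_pair.
have [f1 f2] := sF (c2p (h p)).
by split; [exact: (differentiable_comp dh f1)|exact: (differentiable_comp dh f2)].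
Qed.

Lemma wder_comp F (h : plane R -> C) p d e : csmooth F -> cdiff h p -> wder h p d e ->
  wder (fun y => F (c2p (h y))) p
    (dz F (c2p (h p)) * d + dzb F (c2p (h p)) * conjc e)
    (dz F (c2p (h p)) * e + dzb F (c2p (h p)) * conjc d).
Proof.
move=> sF [h1 h2] [wx wy].
have inT (x : plane R) : x \in setT by rewrite inE.
have dh : differentiable (fun y => c2p (h y)) p by exact: differentiable_pair.
have key v (l : C) (f : plane R -> R) : smooth_on setT f -> cder h p v l ->
   is_derive p v (fun y => f (c2p (h y)))
     (Re l * 'D_ex f (c2p (h p)) + Im l * 'D_ey f (c2p (h p))).
  move=> sf [[_ l1] [_ l2]].
  have [_ /= H] := sf 2%N.
  have D : is_diff (c2p (h p)) f (fun v => v.1 * 'D_ex f (c2p (h p)) + v.2 * 'D_ey f (c2p (h p))).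
    apply: is_diff_plane.
    - by move=> y; have [d' _] := H ex; exact: d'.
    - by move=> y; have [d' _] := H ey; exact: d'.
    - by have [_ [c _]] := H ex; exact: c.
    - by have [_ [c _]] := H ey; exact: c.
  have df := @ex_diff _ _ _ _ _ _ _ D.
  have dfh : differentiable (f \o (fun y => c2p (h y))) p by exact: differentiable_comp.
  apply: DeriveDef; first exact: diff_derivable.
  rewrite deriveE // diff_comp //= diff_pair //=.
  have l1' : 'd (fun y => Re (h y)) p v = Re l by rewrite -l1 deriveE.
  have l2' : 'd (fun y => Im (h y)) p v = Im l by rewrite -l2 deriveE.
  apply: etrans (congr2 (fun a b => 'd f (c2p (h p)) (a, b)) l1' l2') _.
  exact: (congr1 (fun g => g (Re l, Im l)) (@diff_val _ _ _ _ _ _ _ D)).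
have n2 : 2 != 0 :> C by rewrite pnatr_eq0.
have ckey v l : cder h p v l -> cder (fun y => F (c2p (h y))) p v
     ((Re l)%:C * cpart ex F (c2p (h p)) + (Im l)%:C * cpart ey F (c2p (h p))).
  move=> cl; have [s1 s2] := sF; split.
    exact: (is_derive_eq (key v l _ s1 cl) (esym (Re_lin (Re l) (Im l)
      (cpart ex F (c2p (h p))) (cpart ey F (c2p (h p)))))).
  exact: (is_derive_eq (key v l _ s2 cl) (esym (Im_lin (Re l) (Im l)
      (cpart ex F (c2p (h p))) (cpart ey F (c2p (h p)))))).
(* A real-linear form in [l] splits into a complex linear and an antilinear part, with coefficients
   [dz F] and [dzb F]. *)
have E l : (Re l)%:C * cpart ex F (c2p (h p)) + (Im l)%:C * cpart ey F (c2p (h p))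
    = dz F (c2p (h p)) * l + dzb F (c2p (h p)) * conjc l.
  rewrite /dz /dzb; move: (cpart ex F _) (cpart ey F _) => a b.
  have -> : (Re l)%:C = (l + conjc l) / 2 by rewrite addcJ mulrC mulKf.
  have -> : (Im l)%:C = - 'i%C * (l - conjc l) / 2.
    rewrite subcJ; transitivity (- ('i%C * 'i%C) * (Im l)%:C).
      by rewrite mulii opprK mul1r.
    by field.
  by field.
split.
  by apply: cder_eq (ckey _ _ wx) _; rewrite E rmorphD; ring.
have Ej : conjc ('i%C * (d - e)) = - 'i%C * (conjc d - conjc e).
  by rewrite rmorphM rmorphB; congr (_ * _); rewrite /= /GRing.opp /= oppr0.
apply: cder_eq (ckey _ _ wy) _; rewrite E Ej; ring.
Qed.

End MatrixSmooth.

(** * Conformal Lagrangian families of projections *)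

(** The multiplication table of [P], [pa P], [pb P] at one point, with [a'], [b'] in the role of the
    adjoints. In an abstract algebra the structure equations become rewriting of words by these
    rules. *)
Record frame (K : fieldType) (A : algType K) (l : K) (P a b a' b' : A) : Prop := Frame {
  frame_PP : P * P = P;
  frame_Pa : P * a = 0; frame_aP : a * P = a;
  frame_Pb : P * b = 0; frame_bP : b * P = b;
  frame_a'P : a' * P = 0; frame_Pa' : P * a' = a';
  frame_b'P : b' * P = 0; frame_Pb' : P * b' = b';
  frame_a'a : a' * a = l *: P; frame_b'b : b' * b = l *: P;
  frame_b'a : b' * a = 0; frame_a'b : a' * b = 0 }.

Section Frame.
Context {K : fieldType} {A : algType K} {l : K} {P a b a' b' : A}.
Hypothesis fr : frame l P a b a' b'.

Let ext (x u v w : A) : u * v = w -> x * u * v = x * w.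
Proof. by move=> <-; rewrite mulrA. Qed.

Lemma frame_aa : a * a = 0.
Proof. by rewrite -{1}(frame_aP fr) -mulrA (frame_Pa fr) mulr0. Qed.
Lemma frame_ab : a * b = 0.
Proof. by rewrite -{1}(frame_aP fr) -mulrA (frame_Pb fr) mulr0. Qed.
Lemma frame_ba : b * a = 0.
Proof. by rewrite -{1}(frame_bP fr) -mulrA (frame_Pa fr) mulr0. Qed.
Lemma frame_bb : b * b = 0.
Proof. by rewrite -{1}(frame_bP fr) -mulrA (frame_Pb fr) mulr0. Qed.
Lemma frame_a'a' : a' * a' = 0.
Proof. by rewrite -{2}(frame_Pa' fr) mulrA (frame_a'P fr) mul0r. Qed.
Lemma frame_a'b' : a' * b' = 0.
Proof. by rewrite -{1}(frame_Pb' fr) mulrA (frame_a'P fr) mul0r. Qed.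
Lemma frame_b'a' : b' * a' = 0.
Proof. by rewrite -{1}(frame_Pa' fr) mulrA (frame_b'P fr) mul0r. Qed.
Lemma frame_b'b' : b' * b' = 0.
Proof. by rewrite -{2}(frame_Pb' fr) mulrA (frame_b'P fr) mul0r. Qed.

Definition frame2 := (frame_PP fr, frame_Pa fr, frame_aP fr, frame_Pb fr, frame_bP fr,
  frame_a'P fr, frame_Pa' fr, frame_b'P fr, frame_Pb' fr, frame_a'a fr, frame_b'b fr,
  frame_b'a fr, frame_a'b fr, frame_aa, frame_ab, frame_ba, frame_bb,
  frame_a'a', frame_a'b', frame_b'a', frame_b'b').

(** The rules of [frame2] in the middle of a left-nested product, where [u * v] is not a subterm. *)
Definition frame3 x := (ext x (frame_PP fr), ext x (frame_Pa fr), ext x (frame_aP fr),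
  ext x (frame_Pb fr), ext x (frame_bP fr), ext x (frame_a'P fr), ext x (frame_Pa' fr),
  ext x (frame_b'P fr), ext x (frame_Pb' fr), ext x (frame_a'a fr), ext x (frame_b'b fr),
  ext x (frame_b'a fr), ext x (frame_a'b fr), ext x frame_aa, ext x frame_ab,
  ext x frame_ba, ext x frame_bb, ext x frame_a'a', ext x frame_a'b', ext x frame_b'a',
  ext x frame_b'b').

End Frame.

Ltac frame_simp fr :=
  rewrite ?(mulrDl, mulrDr, mulrBl, mulrBr, mulrN, mulNr, mulrA) -?scalerAl -?scalerAr
    ?(mulrDl, mulrDr, mulrBl, mulrBr, mulrN, mulNr, mulrA);
  repeat progress (rewrite ?(frame2 fr) ?(frame3 fr) -?scalerAl -?scalerAr
    ?(mulrDl, mulrDr, mulrBl, mulrBr, mulrN, mulNr, mulrA, mulr0, mul0r, addr0, add0r,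
      scaler0, oppr0, mulr1, mul1r, subr0, sub0r)).

Section FrameIdentities.
Context {K : fieldType} {A : algType K} {l : K} {P a b a' b' : A}.
Hypothesis fr : frame l P a b a' b'.

(** [a * a'] and [b * b'] are, up to the factor [l], idempotents that annihilate each other and
    [P]. *)
Lemma frame_resolution_idem : l != 0 ->
  (P + l^-1 *: (a * a' + b * b')) * (P + l^-1 *: (a * a' + b * b')) =
  P + l^-1 *: (a * a' + b * b').
Proof.
move=> l0; frame_simp fr.
by rewrite -scalerDr [l^-1 *: (l *: _)]scalerA mulVf // scale1r.
Qed.

(** [a + b'] and [b + a'] are [mdz P] and [mdzb P], see [DE] and [EE]; the four products here are
    the quadratic terms in the second derivatives of [P * P = P]. *)
Lemma frame_DE : (a + b') * (b + a') = a * a' + l *: P.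
Proof. by frame_simp fr. Qed.

Lemma frame_ED : (b + a') * (a + b') = b * b' + l *: P.
Proof. by frame_simp fr; rewrite addrC. Qed.

Lemma frame_DD : (a + b') * (a + b') = a * b'.
Proof. by frame_simp fr. Qed.

Lemma frame_EE : (b + a') * (b + a') = b * a'.
Proof. by frame_simp fr. Qed.

(** The hypothesis is [P * P = P] differentiated once in each Wirtinger direction, [h] being the
    mixed second derivative; compression by [P] leaves the products of first derivatives. *)
Lemma frame_PHP h :
  h * P + (a + b') * (b + a') + ((b + a') * (a + b') + P * h) = h ->
  P * h * P = - ((l + l) *: P).
Proof.
rewrite frame_DE frame_ED => /(congr1 (fun x => P * x * P)).
frame_simp fr; rewrite -[RHS]add0r !addrA => /addIr E.
by apply/eqP; rewrite -addr_eq0 scalerDl addrA; apply/eqP.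
Qed.

Lemma frame_PSP s :
  s * P + (a + b') * (a + b') + ((a + b') * (a + b') + P * s) = s ->
  P * s * P = 0.
Proof.
rewrite frame_DD => /(congr1 (fun x => P * x * P)).
by frame_simp fr; rewrite -[RHS]add0r => /addIr.
Qed.

Lemma frame_PSP' s :
  s * P + (b + a') * (b + a') + ((b + a') * (b + a') + P * s) = s ->
  P * s * P = 0.
Proof.
rewrite frame_EE => /(congr1 (fun x => P * x * P)).
by frame_simp fr; rewrite -[RHS]add0r => /addIr.
Qed.

(** The left side is the z-derivative of [a' * b], zero in the application; the pairings of [h] with
    [a] and with [b] then determine each other. *)
Lemma frame_minimal h :
  (P * h + (a + b') * (b + a')) * b + a' * (h * P + (b + a') * (a + b')) =
  P * h * b + a' * h * P.
Proof. by rewrite frame_DE frame_ED; frame_simp fr. Qed.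

(** The second hypothesis is the z-derivative of [a' * a = l *: P] for constant [l]: a constant
    metric leaves [s] no component along [a]. *)
Lemma frame_a's s : s * P = s ->
  (a * a' - l *: P) * a + a' * (s + a * b') = l *: (a + b') -> a' * s = 0.
Proof.
move=> sP; frame_simp fr; rewrite scalerDr addrA => /addIr.
by rewrite -[RHS]addr0 => /addrI.
Qed.

Lemma frame_b's s : s * P = s ->
  (b * b' - l *: P) * b + b' * (s + b * a') = l *: (b + a') -> b' * s = 0.
Proof.
move=> sP; frame_simp fr; rewrite scalerDr addrA => /addIr.
by rewrite -[RHS]addr0 => /addrI.
Qed.

(** By the first hypothesis three orthogonal lines fill the space, so [s] is read off from its three
    components. *)
Lemma frame_expand s c : P + l^-1 *: (a * a' + b * b') = 1 ->
  P * s = 0 -> a' * s = 0 -> b' * s = c *: P -> s = (c / l) *: b.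
Proof.
move=> E Ps a's b's; rewrite -[LHS]mul1r -E !mulrDl -scalerAl mulrDl Ps add0r.
by rewrite -!mulrA a's b's mulr0 add0r -scalerAr (frame_bP fr) scalerA mulrC.
Qed.

Lemma frame_expand' s c : P + l^-1 *: (a * a' + b * b') = 1 ->
  P * s = 0 -> b' * s = 0 -> a' * s = c *: P -> s = (c / l) *: a.
Proof.
move=> E Ps b's a's; rewrite -[LHS]mul1r -E !mulrDl -scalerAl mulrDl Ps add0r.
by rewrite -!mulrA a's b's mulr0 addr0 -scalerAr (frame_aP fr) scalerA mulrC.
Qed.

(** The left side is the z-derivative of [b' * a], which vanishes in the application; so the
    coefficients of the two second derivatives satisfy [cc + c = 0]. *)
Lemma frame_chi (cc c : K) : l != 0 ->
  ((cc / l) *: a' + a * b') * a + b' * ((c / l) *: b + a * b') = (cc + c) *: P.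
Proof.
by move=> l0; frame_simp fr; rewrite !scalerA !divfK // scalerDl.
Qed.

(** The identity in the hypothesis says that the two mixed second derivatives of [a] agree, [y]
    being the conjugate derivative of the cubic differential. Its component along [b] is the Codazzi
    equation, its component along [a] the Gauss equation of a flat metric. *)
Lemma frame_gauss (c x y : K) : l != 0 ->
  (y / l) *: b + (c / l) *: ((x / l) *: a + b * a') + (a * a' - l *: P) * b'
    + a * (b * b' - l *: P)
  = ((c / l) *: b + a * b') * a' + a * (a * a' - l *: P) - l *: (a + b') ->
  P != 0 -> y = 0 /\ c * x = - l ^+ 3.
Proof.
move=> l0 E P0.
have inj (u v : K) : u *: P = v *: P -> u = v.
  move/eqP; rewrite -subr_eq0 -scalerBl scaler_eq0 (negPf P0) orbF subr_eq0.
  by move/eqP.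
have E2 := congr1 (fun z => a' * z) E; have E1 := congr1 (fun z => b' * z) E.
split.
  move: E1 => /=; frame_simp fr; rewrite ?scalerA !divfK // -[RHS]add0r => /addIr /eqP.
  by rewrite scaler_eq0 (negPf P0) orbF => /eqP.
move: E2 => /=; frame_simp fr; rewrite ?scalerA -!scaleNr -!scalerDl => /inj key.
have -> : c * x = (c / l * (x / l) * l) * l by field.
by move: key => /(canRL (subrK _)) ->; ring.
Qed.

(** The left side is the z-derivative of [a - b' + k *: (b * a')]. The conjugate derivative is
    [frame_screw'], whose condition on [k] encodes [|psi|^2 = l^3]. *)
Lemma frame_screw (k c : K) : k * l = c / l ->
  (c / l) *: b + a * b' - (- ((c / l) *: a') + a * b') +
    k *: ((b * b' - l *: P) * a' + b * (a * a' - l *: P)) = 0.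
Proof.
move=> kl; rewrite opprD opprK.
have -> : (c / l) *: b + a * b' + ((c / l) *: a' - a * b') = (c / l) *: b + (c / l) *: a'.
  by rewrite addrACA subrr addr0.
frame_simp fr; rewrite -opprD scalerN scalerDr !scalerA kl.
by rewrite [X in _ - X]addrC subrr.
Qed.

Lemma frame_screw' (k d : K) : k * - (d / l) = -1 ->
  a * a' - l *: P - (b * b' - l *: P) +
    k *: ((- ((d / l) *: a) + b * a') * a' + b * ((d / l) *: b' + b * a')) = 0.
Proof.
move=> kl; frame_simp fr.
have kt : k * (d / l) = 1 by rewrite -[LHS]opprK -mulrN kl opprK.
rewrite -[- (_ *: (a * a'))]scaleNr scalerDr !scalerA kl kt scaleN1r scale1r.
have -> : a * a' - l *: P - (b * b' - l *: P) = a * a' - b * b'.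
  by rewrite opprB addrA subrK.
by rewrite [- _ + _]addrC -[X in X + _]opprB addNr.
Qed.

End FrameIdentities.

HB.lock Definition pa {R : realType} (P : plane R -> 'M[R[i]]_3) p := mdz P p * P p.
HB.lock Definition pb {R : realType} (P : plane R -> 'M[R[i]]_3) p := mdzb P p * P p.
HB.lock Definition plam {R : realType} (P : plane R -> 'M[R[i]]_3) p :=
  \tr (adj (pa P p) * pa P p).

(* [P p] is the orthogonal projection onto the line [f p].  For a horizontal unit
   lift [F] one has [pa P = F_z F^*] and [pb P = F_zbar F^*], so that the last four
   fields say that [f] is a conformal Lagrangian immersion. *)
Record conformal_lagrangian {R : realType} (P : plane R -> 'M[R[i]]_3) : Prop := {
  cl_smooth : msmooth P;
  cl_unit : forall p, exists2 v : 'cV_3, P p = v *m adj v & adj v *m v = 1%:M;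
  cl_lam : forall p, plam P p != 0;
  cl_aa : forall p, adj (pa P p) * pa P p = plam P p *: P p;
  cl_bb : forall p, adj (pb P p) * pb P p = plam P p *: P p;
  cl_ba : forall p, adj (pb P p) * pa P p = 0 }.

Section RankOne.
Context {R : realType} (P : plane R -> 'M[R[i]]_3).
Hypothesis cl : conformal_lagrangian P.

Lemma cl_idem p : P p * P p = P p.
Proof.
have [v -> v1] := cl_unit cl p.
by rewrite -[_ * _]/(_ *m _) mulmxA -(mulmxA v) v1 mulmx1.
Qed.

Lemma cl_adj p : adj (P p) = P p.
Proof. by have [v -> _] := cl_unit cl p; rewrite adjMm adjK. Qed.

(** For [P p = v *m adj v] the middle of the product is the number [adj v *m M *m v]. *)
Lemma cl_rank1 p M : P p * M * P p = \tr (P p * M) *: P p.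
Proof.
have [v -> v1] := cl_unit cl p.
rewrite -![_ * _]/(_ *m _) -!mulmxA mxtrace_mulC.
rewrite (mulmxA M) (mulmxA (adj v)) [adj v *m _ in LHS]mx11_scalar.
by rewrite mul_scalar_mx -scalemxAr -mulmxA /mxtrace big_ord1.
Qed.

End RankOne.

(** * Structure equations of a conformal Lagrangian family *)

Section Projection.
Context {R : realType}.
Local Notation C := R[i].
Local Notation mat := 'M[C]_3.
Variable P : plane R -> mat.
Hypothesis cl : conformal_lagrangian P.
Local Notation D := (mdz P).
Local Notation E := (mdzb P).
Local Notation H := (mdz (mdzb P)).
Local Notation a := (pa P).
Local Notation b := (pb P).
Local Notation lam := (plam P).
Local Notation as_ p := (adj (pa P p)).
Local Notation bs p := (adj (pb P p)).
Let P_smooth := cl_smooth cl.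
Let PP := cl_idem cl.
Let P_adj := cl_adj cl.
Let P_rank1 := cl_rank1 cl.
Let lam_neq0 := cl_lam cl.
Let aa := cl_aa cl.
Let bb := cl_bb cl.
Let ba := cl_ba cl.

Lemma daE p : a p = D p * P p. Proof. by rewrite pa.unlock. Qed.
Lemma dbE p : b p = E p * P p. Proof. by rewrite pb.unlock. Qed.
Lemma plamE p : \tr (as_ p * a p) = lam p. Proof. by rewrite plam.unlock. Qed.

Lemma proj_der p : mwder P p (D p) (E p).
Proof. exact: mwderE. Qed.

Lemma D_smooth : msmooth D. Proof. exact: msmooth_mdz. Qed.
Lemma E_smooth : msmooth E. Proof. exact: msmooth_mdzb. Qed.

Lemma DE_split p : D p = D p * P p + P p * D p /\ E p = E p * P p + P p * E p.
Proof.
have h := mwderM (proj_der p) (proj_der p).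
have h' : mwder P p _ _ := mwder_ext PP h.
by have [e1 e2] := mwder_unique (proj_der p) h'.
Qed.

Lemma adjD_E p : adj (D p) = E p /\ adj (E p) = D p.
Proof.
have h : mwder P p _ _ := mwder_ext P_adj (mwder_adj (proj_der p)).
by have [e1 e2] := mwder_unique (proj_der p) h; rewrite -e1 -e2.
Qed.

Lemma PDP p : P p * D p * P p = 0.
Proof.
have [/(congr1 (fun M => P p * M * P p)) + _] := DE_split p.
rewrite mulrDr mulrDl !mulrA !PP -!mulrA PP !mulrA => /eqP.
by rewrite -subr_eq0 opprD addrA subrr add0r oppr_eq0 => /eqP.
Qed.

Lemma PEP p : P p * E p * P p = 0.
Proof.
have [_ /(congr1 (fun M => P p * M * P p)) +] := DE_split p.
rewrite mulrDr mulrDl !mulrA !PP -!mulrA PP !mulrA => /eqP.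
by rewrite -subr_eq0 opprD addrA subrr add0r oppr_eq0 => /eqP.
Qed.


Lemma asE p : as_ p = P p * E p.
Proof. by rewrite daE adjM P_adj (adjD_E p).1. Qed.
Lemma bsE p : bs p = P p * D p.
Proof. by rewrite dbE adjM P_adj (adjD_E p).2. Qed.

Lemma DE p : D p = a p + bs p.
Proof. by rewrite daE bsE; exact: (DE_split p).1. Qed.
Lemma EE p : E p = b p + as_ p.
Proof. by rewrite dbE asE; exact: (DE_split p).2. Qed.

Lemma Pa p : P p * a p = 0. Proof. by rewrite daE mulrA PDP. Qed.
Lemma aP p : a p * P p = a p. Proof. by rewrite daE -mulrA PP. Qed.
Lemma Pb p : P p * b p = 0. Proof. by rewrite dbE mulrA PEP. Qed.
Lemma bP p : b p * P p = b p. Proof. by rewrite dbE -mulrA PP. Qed.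
Lemma asP p : as_ p * P p = 0. Proof. by rewrite asE PEP. Qed.
Lemma Pas p : P p * as_ p = as_ p. Proof. by rewrite asE mulrA PP. Qed.
Lemma bsP p : bs p * P p = 0. Proof. by rewrite bsE PDP. Qed.
Lemma Pbs p : P p * bs p = bs p. Proof. by rewrite bsE mulrA PP. Qed.
Lemma as_b p : as_ p * b p = 0.
Proof. by rewrite -[b p]adjK -adjM [X in adj X]ba adj0. Qed.

Lemma frame_at p : frame (lam p) (P p) (a p) (b p) (as_ p) (bs p).
Proof.
split; [exact: PP|exact: Pa|exact: aP|exact: Pb|exact: bP|exact: asP|exact: Pas|
  exact: bsP|exact: Pbs|exact: aa|exact: bb|exact: ba|exact: as_b].
Qed.

Lemma lam_conj p : conjc (lam p) = lam p.
Proof. by rewrite -plamE -tr_adj adjM adjK. Qed.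

(** Taking traces in [cl_aa] gives [plam = plam * tr P], and [plam] is nonzero. *)
Lemma tr_P p : \tr (P p) = 1.
Proof.
have /(congr1 (@mxtrace _ _)) := aa p.
rewrite plamE mxtraceZ => /eqP.
by rewrite -subr_eq0 -{1}[lam p]mulr1 -mulrBr mulf_eq0 (negPf (lam_neq0 p)) /= subr_eq0 => /eqP.
Qed.

(** The images of [P], [a], [b] are three orthogonal lines, which must fill a space of dimension 3.
    Formally, [Q] is an orthogonal projection of trace 3, so [1 - Q] is one of trace 0. *)
Lemma resolution p : P p + (lam p)^-1 *: (a p * as_ p + b p * bs p) = 1.
Proof.
set Q := _ + _.
have QQ : Q * Q = Q.
  exact: (frame_resolution_idem (frame_at p) (lam_neq0 p)).
have Qadj : adj Q = Q.
  rewrite /Q adjD adjZ P_adj adjD !adjM !adjK.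
  by congr (_ + _ *: _); rewrite conjc_inv lam_conj.
have trQ : \tr Q = 3%:R.
  rewrite /Q mxtraceD mxtraceZ mxtraceD tr_P ![\tr (_ * adj _)]mxtrace_mulC.
  rewrite -!/(_ * _) [X in \tr X + _]aa [X in _ + \tr X]bb mxtraceZ tr_P mulr1.
  by rewrite mulrDr mulVf //; ring.
apply/esym/eqP; rewrite -subr_eq0; apply/eqP; apply: adj_mul_eq0.
have -> : adj (1 - Q) *m (1 - Q) = 1 - Q.
  rewrite adjB Qadj (_ : adj 1 = 1); last exact: adj1.
  by rewrite -[_ *m _]/(_ * _) mulrBr mulr1 mulrBl mul1r QQ subrr subr0.
by rewrite raddfB /= trQ mxtrace1 subrr.
Qed.

(** The harmonic map equation: up to a factor, the tension field is the part of [H] that maps the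
    line to its orthogonal complement. *)
Definition is_harmonic := forall p, (1 - P p) * H p * P p = 0.

Lemma dD p : mwder D p (mdz D p) (H p).
Proof. by rewrite mdz_mdzb //; exact: mwderE D_smooth. Qed.

Lemma dE p : mwder E p (H p) (mdzb E p).
Proof. exact: mwderE E_smooth. Qed.

Lemma H_adj p : adj (H p) = H p.
Proof.
have h := mwder_adj (dE p).
have h' : mwder D p _ _ := mwder_ext (fun q => (adjD_E q).2) h.
by have [_ e] := mwder_unique (dD p) h'.
Qed.

Lemma da p : mwder a p (mdz D p * P p + D p * D p) (H p * P p + D p * E p).
Proof.
by rewrite (_ : a = fun q => D q * P q); [exact: mwderM (dD p) (proj_der p)|exact/funext/daE].
Qed.

Lemma db p : mwder b p (H p * P p + E p * D p) (mdzb E p * P p + E p * E p).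
Proof.
by rewrite (_ : b = fun q => E q * P q); [exact: mwderM (dE p) (proj_der p)|exact/funext/dbE].
Qed.

Lemma ddP p :
  [/\ mdz D p * P p + D p * D p + (D p * D p + P p * mdz D p) = mdz D p,
      H p * P p + D p * E p + (E p * D p + P p * H p) = H p &
      mdzb E p * P p + E p * E p + (E p * E p + P p * mdzb E p) = mdzb E p].
Proof.
have e1 : mwder (fun q => D q * P q + P q * D q) p _ _ :=
  mwderD (mwderM (dD p) (proj_der p)) (mwderM (proj_der p) (dD p)).
have e2 : mwder (fun q => E q * P q + P q * E q) p _ _ :=
  mwderD (mwderM (dE p) (proj_der p)) (mwderM (proj_der p) (dE p)).
have [h1 h2] := mwder_unique (mwder_ext (fun q => esym (DE_split q).1) e1) (dD p).
have [h3 h4] := mwder_unique (mwder_ext (fun q => esym (DE_split q).2) e2) (dE p).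
exact: And3 h1 h2 h4.
Qed.

Lemma PHP p : P p * H p * P p = - ((lam p + lam p) *: P p).
Proof. by have [_ + _] := ddP p; rewrite DE EE; exact: (frame_PHP (frame_at p)). Qed.

Lemma rank1_scalar p (N : mat) : P p * N = N -> N * P p = \tr (N * P p) *: P p.
Proof. by move=> PN; rewrite -{1}PN P_rank1 mxtrace_mulC. Qed.

(** [a + b] and [i (a - b)] represent the two real tangent vectors. The normal space of a Lagrangian
    surface is i times its tangent space, so minimality controls imaginary parts only. The
    derivative of [adj a * b = 0] supplies the rest: it gives [k = - conjc be], and then the two
    real equations kill both parts of [be]. *)
Lemma harmonic_of_trace :
  (forall p, Im (\tr (adj (a p + b p) * H p * P p)) = 0) ->
  (forall p, Im (\tr (adj ('i%C *: (a p - b p)) * H p * P p)) = 0) ->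
  is_harmonic.
Proof.
move=> m1 m2 p.
pose k := \tr (as_ p * H p * P p); pose be := \tr (bs p * H p * P p).
have asHP : as_ p * H p * P p = k *: P p.
  by apply: rank1_scalar; rewrite mulrA Pas.
have bsHP : bs p * H p * P p = be *: P p.
  by apply: rank1_scalar; rewrite mulrA Pbs.
have e0 : k = - conjc be.
  have h : mwder (fun q => adj (a q) * b q) p _ _ := mwderM (mwder_adj (da p)) (db p).
  have [e _] := mwder_unique (mwder_ext as_b h) (mwder_cst 0 p).
  move: e; rewrite adjD !adjM H_adj P_adj (adjD_E p).1 (adjD_E p).2 DE EE.
  rewrite (frame_minimal (frame_at p)) => /(congr1 (@mxtrace _ _)).
  rewrite mxtraceD mxtrace0 asHP mxtraceZ tr_P mulr1.
  have -> : P p * H p * b p = adj (bs p * H p * P p).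
    by rewrite !adjM adjK H_adj P_adj mulrA.
  by rewrite tr_adj bsHP mxtraceZ tr_P mulr1 => /eqP; rewrite addrC addr_eq0 => /eqP.
have T1 : \tr (adj (a p + b p) * H p * P p) = k + be.
  by rewrite adjD !mulrDl mxtraceD.
have T2 : \tr (adj ('i%C *: (a p - b p)) * H p * P p) = conjc 'i%C * (k - be).
  by rewrite adjZ adjB -!scalerAl mxtraceZ !mulrBl raddfB.
have := m1 p; have := m2 p; rewrite T1 T2 e0 !ReImE /= => i2 i1.
have be0 : be = 0.
  by apply: complex_ext => /=; move: i1 i2; lra.
have k0 : k = 0 by rewrite e0 be0 conjc0 oppr0.
suff e : H p * P p = P p * H p * P p by rewrite mulrBl mul1r mulrBl e subrr.
rewrite -[LHS]mul1r -(resolution p) mulrDl -scalerAl mulrDl mulrA.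
rewrite -(mulrA (a p)) -(mulrA (b p)) !(mulrA _ (H p)) asHP bsHP k0 be0.
by rewrite !scale0r !mulr0 addr0 scaler0 addr0.
Qed.

Lemma a_smooth : msmooth a.
Proof. exact: msmooth_ext (fun q => esym (daE q)) (msmoothM D_smooth P_smooth). Qed.
Lemma b_smooth : msmooth b.
Proof. exact: msmooth_ext (fun q => esym (dbE q)) (msmoothM E_smooth P_smooth). Qed.

Section Harmonic.
Hypothesis P_harmonic : is_harmonic.

Lemma HP p : H p * P p = - ((lam p + lam p) *: P p).
Proof.
have := P_harmonic p; rewrite mulrBl mul1r mulrBl PHP => /eqP.
by rewrite subr_eq0 => /eqP.
Qed.

(** Harmonicity makes [H * P] a multiple of [P], so this derivative of [a] contains no second
    derivative of [P]. Both the structure equations and [holomorphic_h1] rest on it. *)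
Lemma dza p : mdzb a p = a p * as_ p - lam p *: P p.
Proof.
have [_ ->] := mwder_unique (mwderE p a_smooth) (da p).
rewrite HP DE EE (frame_DE (frame_at p)) scalerDl.
by rewrite addrC opprD addrA addrK.
Qed.

Lemma dzb' p : mdz b p = b p * bs p - lam p *: P p.
Proof.
have [-> _] := mwder_unique (mwderE p b_smooth) (db p).
rewrite HP DE EE (frame_ED (frame_at p)) scalerDl.
by rewrite addrC opprD addrA addrK.
Qed.

Section ConstantMetric.
Variable l : C.
Hypothesis lamE : forall p, lam p = l.

Let l0 : l != 0. Proof. by rewrite -(lamE 0); exact: lam_neq0. Qed.
Let lJ : conjc l = l. Proof. by rewrite -(lamE 0); exact: lam_conj. Qed.

Lemma frame_l p : frame l (P p) (a p) (b p) (as_ p) (bs p).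
Proof. by rewrite -(lamE p); exact: frame_at. Qed.

Lemma resolution_l p : P p + l^-1 *: (a p * as_ p + b p * bs p) = 1.
Proof. by rewrite -(lamE p); exact: resolution. Qed.

(** The coefficient of the cubic form of the surface. [mdz a] and [mdz D * P] differ by [a * adj b],
    which [adj b] annihilates, so either may be paired with [b]. *)
Definition cubic p := \tr (bs p * (mdz D p * P p)).

Local Notation s p := (mdz (mdz P) p * P p).
Local Notation s' p := (mdzb (mdzb P) p * P p).

Lemma mdza p : mdz a p = s p + a p * bs p.
Proof.
have [-> _] := mwder_unique (mwderE p a_smooth) (da p).
by rewrite DE (frame_DD (frame_at p)).
Qed.

Lemma mdzbb p : mdzb b p = s' p + b p * as_ p.
Proof.
have [_ ->] := mwder_unique (mwderE p b_smooth) (db p).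
by rewrite EE (frame_EE (frame_at p)).
Qed.

Lemma a_wder p : mwder a p (mdz a p) (a p * as_ p - l *: P p).
Proof. by rewrite -(lamE p) -dza; exact/mwderE/a_smooth. Qed.

Lemma b_wder p : mwder b p (b p * bs p - l *: P p) (mdzb b p).
Proof. by rewrite -(lamE p) -dzb'; exact/mwderE/b_smooth. Qed.

Lemma aas_adj p : adj (a p * as_ p - l *: P p) = a p * as_ p - l *: P p.
Proof. by rewrite adjB adjZ adjM adjK P_adj lJ. Qed.
Lemma bbs_adj p : adj (b p * bs p - l *: P p) = b p * bs p - l *: P p.
Proof. by rewrite adjB adjZ adjM adjK P_adj lJ. Qed.

Lemma lP_wder p : mwder (fun q => l *: P q) p (l *: D p) (l *: E p).
Proof.
apply: mwder_eq (mwderZ (wder_cst l p) (proj_der p)) _ _; by rewrite scale0r add0r.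
Qed.

(** Of the components of [mdz D * P], the one along [P] vanishes by idempotency, the one along [a]
    because the metric is constant, and the one along [b] is [cubic]. *)
Lemma cubicE p : mdz a p = (cubic p / l) *: b p + a p * bs p.
Proof.
rewrite mdza; congr (_ + _); apply: (frame_expand (frame_l p) (resolution_l p)).
- have [e _ _] := ddP p; rewrite DE in e.
  by rewrite mulrA; exact: (frame_PSP (frame_at p) e).
- apply: (frame_a's (frame_l p)); first by rewrite -mulrA PP.
  have h := mwderM (mwder_adj (a_wder p)) (a_wder p).
  have aal q : adj (a q) * a q = l *: P q by rewrite aa lamE.
  have [e _] := mwder_unique (mwder_ext aal h) (lP_wder p).
  by rewrite aas_adj mdza DE in e.
- by rewrite /cubic mulrA; apply: rank1_scalar; rewrite mulrA Pbs.
Qed.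

(** The same argument for the conjugate derivative of [b]; the remaining coefficient is fixed by
    differentiating [adj b * a = 0]. *)
Lemma cubicE' p : mdzb b p = - ((conjc (cubic p) / l) *: a p) + b p * as_ p.
Proof.
pose c := \tr (as_ p * s' p).
have e' : s' p = (c / l) *: a p.
  apply: (frame_expand' (frame_l p) (resolution_l p)).
  - have [_ _ e] := ddP p; rewrite EE in e.
    by rewrite mulrA; exact: (frame_PSP' (frame_at p) e).
  - apply: (frame_b's (frame_l p)); first by rewrite -mulrA PP.
    have h := mwderM (mwder_adj (b_wder p)) (b_wder p).
    have bbl q : adj (b q) * b q = l *: P q by rewrite bb lamE.
    have [_ e] := mwder_unique (mwder_ext bbl h) (lP_wder p).
    by rewrite bbs_adj mdzbb EE in e.
  - by rewrite /c mulrA; apply: rank1_scalar; rewrite mulrA Pas.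
have h := mwderM (mwder_adj (b_wder p)) (a_wder p).
have [e _] := mwder_unique (mwder_ext ba h) (mwder_cst 0 p).
move: e; rewrite cubicE mdzbb e' adjD adjZ adjM adjK => e.
have := frame_chi (frame_l p) (conjc (c / l) * l) (cubic p) l0.
rewrite mulfK // e => /esym /eqP; rewrite scaler_eq0.
have -> : P p == 0 = false.
  by apply/negP => /eqP P0; have := tr_P p; rewrite P0 mxtrace0 => /esym /eqP; rewrite oner_eq0.
rewrite orbF addr_eq0 => /eqP; set d := c / l => ec.
have -> : d = - (conjc (cubic p) / l).
  have := congr1 (@conjc R) ec; rewrite [LHS]rmorphM [RHS]rmorphN /= lJ (conjcK d) => dl.
  by rewrite -mulNr -dl mulfK.
by rewrite scaleNr.
Qed.

Lemma cubic_smooth : csmooth cubic.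
Proof.
apply/csmooth_tr/msmoothM; first exact/msmooth_adj/b_smooth.
exact/msmoothM/P_smooth/msmooth_mdz/D_smooth.
Qed.

(** Integrability: [mdz (mdzb a) = mdzb (mdz a)], both sides expanded by the structure equations. *)
Lemma cubic_gauss p : dzb cubic p = 0 /\ cubic p * conjc (cubic p) = l ^+ 3.
Proof.
have P0 : P p != 0.
  by apply/negP => /eqP P0; have := tr_P p; rewrite P0 mxtrace0 => /esym /eqP; rewrite oner_eq0.
have e := mdz_mdzb p a_smooth.
have h1 : mwder (mdzb a) p _ _ := mwder_ext
  (fun q => esym (etrans (dza q) (congr1 (fun k => a q * as_ q - k *: P q) (lamE q))))
  (mwderB (mwderM (a_wder p) (mwder_adj (a_wder p))) (lP_wder p)).
have [e1 _] := mwder_unique (mwderE p (msmooth_mdzb a_smooth)) h1.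
have hc : wder (fun q => cubic q / l) p _ _ :=
  wderM (wderP p cubic_smooth) (wder_cst l^-1 p).
have h2 : mwder (mdz a) p _ _ := mwder_ext (fun q => esym (cubicE q))
  (mwderD (mwderZ hc (b_wder p)) (mwderM (a_wder p) (mwder_adj (b_wder p)))).
have [_ e2] := mwder_unique (mwderE p (msmooth_mdz a_smooth)) h2.
move: e; rewrite e1 e2 aas_adj bbs_adj cubicE cubicE' DE !mulr0 !addr0 => e.
have [] := @frame_gauss _ _ _ _ _ _ _ _ (frame_l p) (cubic p) (- conjc (cubic p))
  (dzb cubic p) l0 _ P0.
  by rewrite mulNr scaleNr; apply: etrans _ (esym e); exact/esym/addrA.
by move=> -> /eqP; rewrite mulrN eqr_opp => /eqP.
Qed.

(** As [cubic] has zero conjugate derivative, the z-derivative of the constant [cubic * conjc cubic]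
    is [dz cubic * conjc cubic], whose second factor is nonzero. *)
Lemma cubic_const p : cubic p = cubic 0.
Proof.
apply: wder_const => q.
have w := wderP q cubic_smooth; have [b0 n3] := cubic_gauss q.
rewrite b0 in w; apply: (wder_eq w _ erefl).
have h := wderM w (wderJ w).
have [e _] := wder_unique (wder_ext (fun q => (cubic_gauss q).2) h) (wder_cst _ q).
move: e; rewrite conjc0 mulr0 addr0 => /eqP; rewrite mulf_eq0 => /orP[/eqP //|].
rewrite conjc_eq0 => /eqP c0; move: n3; rewrite c0 mul0r => /esym /eqP.
by rewrite expf_eq0 (negPf l0).
Qed.

(* Maps a horizontal lift [F] to [F_z], [F_z] to [F_zz], and [F_zbar] to [F_zzbar]. *)
Definition screw p := a p - bs p + (cubic p / l ^+ 2) *: (b p * as_ p).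

Lemma screw_const p : screw p = screw 0.
Proof.
pose k := cubic 0 / l ^+ 2.
have n3 : cubic 0 * conjc (cubic 0) = l ^+ 3 := (cubic_gauss 0).2.
have kl : k * l = cubic 0 / l by rewrite /k; field.
(* The Gauss equation enters here: [k] times the coefficient of [a] in [mdzb b] is -1 because
   [|cubic|^2 = l ^+ 3]. *)
have kc : k * (- (conjc (cubic 0) / l)) = -1.
  have -> : k * (- (conjc (cubic 0) / l)) = - ((cubic 0 * conjc (cubic 0)) / l ^+ 3).
    by rewrite /k; field.
  by rewrite n3 divff // expf_neq0.
have d q : mwder screw q 0 0.
  have hs : mwder (fun q => a q - bs q + k *: (b q * as_ q)) q _ _ :=
    mwderD (mwderB (a_wder q) (mwder_adj (b_wder q)))
      (mwderZ (wder_cst k q) (mwderM (b_wder q) (mwder_adj (a_wder q)))).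
  have hE : (fun q => a q - bs q + k *: (b q * as_ q)) =1 screw.
    by move=> r; rewrite /screw cubic_const.
  have fr := frame_l q.
  apply: (mwder_eq (mwder_ext hE hs)).
    rewrite aas_adj cubicE cubicE' cubic_const.
    rewrite adjD adjN adjZ adjM adjK scale0r add0r rmorphM /= conjcK conjc_inv lJ.
    exact: (frame_screw fr kl).
  rewrite bbs_adj cubicE cubicE' cubic_const.
  rewrite adjD adjZ !adjM adjK scale0r add0r rmorphM /= conjc_inv lJ.
  exact: (frame_screw' fr kc).
exact: (mwder_const d).
Qed.

End ConstantMetric.
End Harmonic.
End Projection.

(** * The maximum principle on the punctured plane *)

Section MaximumPrinciple.
Context {R : realType}.

Lemma is_derive_linear (V : normedModType R) (f : V -> R) (x v : V) :
  linear f -> continuous f -> is_derive x v f (f v).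
Proof.
move=> lf cf.
pose pL := GRing.isLinear.Build _ _ _ _ _ lf.
pose lL : {linear V -> R} := HB.pack f pL.
have cL : continuous lL by exact: cf.
have df : differentiable f x := linear_differentiable x cL.
apply: DeriveDef; first exact: diff_derivable.
by rewrite deriveE // (diff_lin x cL).
Qed.

Lemma is_derive_comp1 (V : normedModType R) (g : R -> R) (f : V -> R) (x v : V) (d e : R) :
  is_derive (f x) 1 g e -> is_derive x v f d -> is_derive x v (fun y => g (f y)) (e * d).
Proof.
move=> dg df.
have df' : is_derive (0 *: v + x) v f d by rewrite scale0r add0r.
have dl := is_derive_line df'.
have dg' : is_derive (f (0 *: v + x)) 1 g e by rewrite scale0r add0r.
have dd := @is_derive1_comp _ g (fun s : R => f (s *: v + x)) 0 e d dg' dl.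
have E : (fun h : R => h^-1 *: (((fun s : R => g (f (s *: v + x))) \o shift 0) (h *: 1)
   - g (f (0 *: v + x)))) =
   (fun h => h^-1 *: (((fun y => g (f y)) \o shift x) (h *: v) - g (f x))).
  by apply/funext => h /=; rewrite addr0 [h%:A]mulr1 scale0r add0r.
case: dd => dd1 dd2; apply: DeriveDef.
  by move: dd1; rewrite /derivable -E.
by rewrite -dd2 /derive -E.
Qed.

Lemma is_derive_inv (V : normedModType R) (f : V -> R) (x v : V) (d : R) :
  f x != 0 -> is_derive x v f d -> is_derive x v (fun y => (f y)^-1) (- (f x) ^- 2 * d).
Proof.
move=> f0 [df <-]; apply: DeriveDef; first exact: derivableV.
by rewrite deriveV.
Qed.

(** If [A > 0], then [f'] vanishes at the maximum and is positive just to its right, so [f] exceeds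
    [f 0] there. *)
Lemma second_derivative_test (f f' : R -> R) (A : R) :
  (\forall t \near (0 : R), is_derive (t : R) 1 f (f' t)) -> is_derive (0 : R) 1 f' A ->
  (\forall t \near (0 : R), f t <= f 0) -> A <= 0.
Proof.
move=> df df' fmax; rewrite leNgt; apply/negP => A0.
have [d /= d0 Hd] : exists2 d : R, 0 < d & forall t : R, `|t| < d -> is_derive t 1 f (f' t) /\ f t <= f 0.
  have [d d0 H] := iffLR (nbhs_ballP _ _) (filterI df fmax).
  by exists d => // t td; apply: H; rewrite /ball /= sub0r normrN.
have f'0 : f' 0 = 0.
  have h0 : (0 : R) \in `]-d, d[ by rewrite in_itv /= oppr_lt0 d0.
  have H : is_derive (0 : R) 1 f 0.
    apply: (@derive1_at_max _ _ (- d) d) => //.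
    - by rewrite (le_trans _ (ltW d0)) // oppr_le0 ltW.
    - by move=> t; rewrite in_itv /= -ltr_norml => /Hd[[]].
    - by move=> t; rewrite in_itv /= -ltr_norml => /Hd[_].
  have zd : `|0 : R| < d by rewrite normr0.
  have [H1 _] := Hd 0 zd.
  by have [_ <-] := H1; have [_ ->] := H.
have [d' d'0 Hd'] : exists2 d' : R, 0 < d' & forall t, 0 < t -> t < d' -> 0 < f' t.
  have [ /cvgrPdist_lt + E] := df'; rewrite -/('D_1 f' 0) E => /(_ A A0).
  move=> /nbhs_ballP [d' /= d'0 H]; exists d' => // t t0 td.
  have := H t; rewrite /ball /= sub0r normrN gtr0_norm // => /(_ td (lt0r_neq0 t0)).
  rewrite addr0 f'0 subr0 [t%:A]mulr1 ltr_norml => /andP[_].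
  rewrite ltrBlDr ltrDl /GRing.scale /= pmulr_rgt0 ?invr_gt0 //.
pose t := Num.min d d' / 2.
have m0 : 0 < Num.min d d' by rewrite lt_min d0 d'0.
have t0 : 0 < t by rewrite divr_gt0.
have tm : t < Num.min d d' by rewrite ltr_pdivrMr // ltr_pMr // ltr1n.
have [td td'] : t < d /\ t < d' by move: tm; rewrite lt_min => /andP[].
have df0 s : s \in `[0, t] -> is_derive s 1 f (f' s).
  rewrite in_itv /= => /andP[s0 st].
  have sd : `|s| < d by rewrite ger0_norm // (le_lt_trans st).
  by have [] := Hd s sd.
have h1 s : s \in `]0, t[ -> is_derive s 1 f (f' s).
  by rewrite in_itv /= => /andP[s0 st]; apply: df0; rewrite in_itv /= !ltW.
have h2 : {within `[0, t], continuous f}.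
  by apply: derivable_within_continuous => s /df0[].
have [c + E] := MVT t0 h1 h2.
rewrite in_itv /= => /andP[c0 ct]; rewrite subr0 in E.
have td0 : `|t| < d by rewrite gtr0_norm.
have [_] := Hd t td0.
by apply/negP; rewrite -ltNge -subr_gt0 E mulr_gt0 // Hd' // (lt_trans ct).
Qed.

Lemma no_interior_max (v vx vy : plane R -> R) (p : plane R) (A B : R) :
  (\forall q \near p, is_derive q ex v (vx q)) ->
  (\forall q \near p, is_derive q ey v (vy q)) ->
  is_derive p ex vx A -> is_derive p ey vy B ->
  (\forall q \near p, v q <= v p) -> A + B <= 0.
Proof.
move=> hx hy hA hB vmax.
have key (e : plane R) (w : plane R -> R) (L : R) : (\forall q \near p, is_derive q e v (w q)) ->
    is_derive p e w L -> L <= 0.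
  move=> hw hL.
  have cl : (fun t : R => t *: e + p) @ (0 : R) --> p.
    rewrite -{2}[p]add0r -[X in X + p](scale0r e); apply: cvgD; last exact: cvg_cst.
    by apply: cvgZ; [exact: cvg_id|exact: cvg_cst].
  apply: (@second_derivative_test (fun t => v (t *: e + p)) (fun t => w (t *: e + p))).
  - have h := cl _ hw; near=> t; have h' : is_derive (t *: e + p) e v (w (t *: e + p)).
      by near: t; exact: h.
    exact: (is_derive_line h').
  - have hL' : is_derive (0 *: e + p) e w L by rewrite scale0r add0r.
    exact: (is_derive_line hL').
  - by rewrite scale0r add0r; exact: (cl _ vmax).
by rewrite -[leRHS]addr0 lerD // ?(key _ _ _ hx hA) ?(key _ _ _ hy hB).
Unshelve. all: by end_near. Qed.

Section Punctured.
Variables (p0 : plane R) (u ux uy uxx : plane R -> R).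

Definition sqdist (p : plane R) : R := (p.1 - p0.1) ^+ 2 + (p.2 - p0.2) ^+ 2.

Lemma sqdist_gt0 p : (0 < sqdist p) = (p != p0).
Proof.
rewrite lt0r addr_ge0 ?sqr_ge0 // andbT paddr_eq0 ?sqr_ge0 // !sqrf_eq0 !subr_eq0.
by case: p => x y; case: p0 => x0 y0.
Qed.

Lemma fst_derive p v : is_derive p v (fun q : plane R => q.1 : R) v.1.
Proof. by apply: is_derive_linear => // q; exact: cvg_fst. Qed.

Lemma snd_derive p v : is_derive p v (fun q : plane R => q.2 : R) v.2.
Proof. by apply: is_derive_linear => // q; exact: cvg_snd. Qed.

Lemma sqdist_derive p v :
  is_derive p v sqdist (2 * (v.1 * (p.1 - p0.1) + v.2 * (p.2 - p0.2))).
Proof.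
have d1 := is_deriveB (fst_derive p v) (is_derive_cst (p0.1 : R) p v).
have d2 := is_deriveB (snd_derive p v) (is_derive_cst (p0.2 : R) p v).
apply: (is_derive_eq (is_deriveD (is_deriveM d1 d1) (is_deriveM d2 d2))).
rewrite -![(_ - _) p]/(_ - _) /= /GRing.scale /= !subr0.
ring.
Qed.

Lemma sqdist_continuous : continuous sqdist.
Proof.
move=> p; apply: cvgD; apply: cvgM; apply: cvgB; try exact: cvg_cst.
- exact: cvg_fst.
- exact: cvg_fst.
- exact: cvg_snd.
- exact: cvg_snd.
Qed.

Lemma annulus_compact s S : compact [set p | s <= sqdist p <= S].
Proof.
pose r := Num.sqrt S.
have c0 : compact (`[p0.1 - r, p0.1 + r]%classic `*` `[p0.2 - r, p0.2 + r]%classic).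
  by apply: compact_setX; exact: segment_compact.
apply: (subclosed_compact _ c0).
  rewrite (_ : [set p | _] = sqdist @^-1` `[s, S]%classic).
    apply: preimage_closed; first by move=> p _; exact: sqdist_continuous.
    exact: interval_closed.
  by apply/seteqP; split=> p /=; rewrite in_itv.
move=> p /andP[_ pS] /=; rewrite !in_itv /=.
have key (x y z : R) : x ^+ 2 + y ^+ 2 <= z -> `|x| <= Num.sqrt z.
  move=> h; rewrite -sqrtr_sqr; apply: ler_wsqrtr; apply: le_trans h.
  by rewrite lerDl sqr_ge0.
have h1 := key _ _ _ pS.
have h2 : `|p.2 - p0.2| <= r by apply: (key _ (p.1 - p0.1)); rewrite addrC.
by split; rewrite -ler_distlC distrC.
Qed.

Definition lin (w p : plane R) : R := w.1 * (p.1 - p0.1) + w.2 * (p.2 - p0.2).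

Lemma lin_derive p v w : is_derive p v (lin w) (w.1 * v.1 + w.2 * v.2).
Proof.
have d1 := is_deriveB (fst_derive p v) (is_derive_cst (p0.1 : R) p v).
have d2 := is_deriveB (snd_derive p v) (is_derive_cst (p0.2 : R) p v).
apply: (is_derive_eq (is_deriveD (is_deriveM (is_derive_cst (w.1 : R) p v) d1)
  (is_deriveM (is_derive_cst (w.2 : R) p v) d2))).
by rewrite /GRing.scale /= !subr0 !mulr0 !addr0.
Qed.

Lemma perturb_derive (eps eta c : R) w (f : plane R -> R) (d : R) p : p != p0 ->
  is_derive p w f d ->
  is_derive p w (fun p => f p + eps * (ln (sqdist p) - c) + eta * sqdist p)
    (d + eps * (2 * lin w p / sqdist p) + eta * (2 * lin w p)).
Proof.
move=> pp0 df; have N0 : 0 < sqdist p by rewrite sqdist_gt0.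
have dN := sqdist_derive p w.
have dl := is_derive_comp1 (is_derive1_ln N0) dN.
have dlc := is_deriveB dl (is_derive_cst c p w).
apply: (is_derive_eq (is_deriveD (is_deriveD df (is_deriveM (is_derive_cst eps p w) dlc))
  (is_deriveM (is_derive_cst eta p w) dN))).
rewrite /GRing.scale /= !subr0 !mulr0 !addr0 /lin.
by rewrite [_^-1 * _]mulrC.
Qed.

Lemma perturb_derive2 (eps eta : R) w (g : plane R -> R) (d : R) p : p != p0 ->
  is_derive p w g d ->
  is_derive p w (fun p => g p + eps * (2 * lin w p / sqdist p) + eta * (2 * lin w p))
    (d + eps * (2 * (w.1 ^+ 2 + w.2 ^+ 2) / sqdist p - (2 * lin w p) ^+ 2 / sqdist p ^+ 2)
       + eta * (2 * (w.1 ^+ 2 + w.2 ^+ 2))).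
Proof.
move=> pp0 df; have N0 : sqdist p != 0 by rewrite lt0r_neq0 // sqdist_gt0.
have dN := is_derive_inv N0 (sqdist_derive p w).
have dL := is_deriveM (is_derive_cst (2 : R) p w) (lin_derive p w w).
apply: (is_derive_eq (is_deriveD (is_deriveD df (is_deriveM (is_derive_cst eps p w)
  (is_deriveM dL dN))) (is_deriveM (is_derive_cst eta p w) dL))).
rewrite /GRing.scale /= -![(_ * _) p]/(_ * _) /= -/(lin w p).
move: (lin w p) (sqdist p) N0 => L N N0.
by field.
Qed.

Hypotheses (du : forall p, p != p0 -> [/\ is_derive p ex u (ux p),
    is_derive p ey u (uy p), is_derive p ex ux (uxx p) & is_derive p ey uy (- uxx p)])
  (cu : forall p, p != p0 -> {for p, continuous u}).

(* Compare [u] with [eps * ln |p - p0|^2 + eta * |p - p0|^2], whose Laplacian is positive. *)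
Lemma punctured_max :
  (exists2 r : R, 0 < r & exists B, forall p, 0 < sqdist p <= r -> u p <= B) ->
  (forall e, 0 < e -> exists S, forall p, S <= sqdist p -> u p <= e) ->
  forall p, p != p0 -> u p <= 0.
Proof.
move=> [r r0 [B uB]] uinf p1 p1p0; rewrite leNgt; apply/negP => u1.
have [S0 HS0] := uinf (u p1 / 2) (divr_gt0 u1 (ltr0n _ 2)).
have N1 : 0 < sqdist p1 by rewrite sqdist_gt0.
pose S := Num.max S0 (2 * sqdist p1).
have S1 : sqdist p1 < S by rewrite lt_max ltr_pMl // ltr1n orbT.
have S_gt0 : 0 < S by rewrite (lt_trans N1).
have lnS : 0 < ln S - ln (sqdist p1) by rewrite subr_gt0 ltr_ln ?posrE.
(* The factors 8 make each perturbation cost at most [u p1 / 8]: the logarithmic term is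
   [- u p1 / 8] at [p1], and [eta * sqdist] stays below [u p1 / 8] as long as [sqdist <= S]. *)
pose eps := u p1 / (8 * (ln S - ln (sqdist p1))).
have eps0 : 0 < eps by rewrite divr_gt0 // mulr_gt0.
pose eta := u p1 / (8 * S).
have eta0 : 0 < eta by rewrite divr_gt0 // mulr_gt0.
(* The inner circle is so small that the logarithmic term outweighs the bound [B], whence
   [v <= u p1 / 8] on it. *)
pose s := Num.min (Num.min r (sqdist p1 / 2)) (S * expR (- (`|B| / eps))).
have s0 : 0 < s by rewrite !lt_min r0 divr_gt0 // mulr_gt0 // expR_gt0.
have s1 : s < sqdist p1.
  by rewrite !gt_min ltr_pdivrMr // ltr_pMr // ltr1n orbT.
have sr : s <= r by rewrite !ge_min lexx.
have slnS : eps * (ln s - ln S) <= - `|B|.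
  have E : ln (S * expR (- (`|B| / eps))) = ln S - `|B| / eps.
    by rewrite lnM ?posrE ?expR_gt0 // expRK.
  have : ln s <= ln S - `|B| / eps.
    rewrite -E ler_ln ?posrE ?mulr_gt0 ?expR_gt0 //.
    by rewrite /s ge_min lexx orbT.
  rewrite -lerBlDl => /(ler_wpM2l (ltW eps0)) /le_trans; apply.
  by rewrite mulrN mulrC divfK // lt0r_neq0.
pose v p := u p + eps * (ln (sqdist p) - ln S) + eta * sqdist p.
have v1 : 7 / 8 * u p1 <= v p1.
  rewrite /v.
  have -> : eps * (ln (sqdist p1) - ln S) = - (u p1 / 8).
    by rewrite /eps; field; rewrite lt0r_neq0.
  have : 0 <= eta * sqdist p1 by rewrite mulr_ge0 // ltW.
  by move: (eta * _) => X; move: (u p1) => Y; lra.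
have etaS p : sqdist p <= S -> eta * sqdist p <= u p1 / 8.
  move=> pS; have -> : u p1 / 8 = eta * S by rewrite /eta; field; rewrite lt0r_neq0.
  by rewrite ler_pM2l.
pose K := [set p | s <= sqdist p <= S].
have Kp0 p : K p -> p != p0.
  by move=> /andP[sp _]; rewrite -sqdist_gt0 (lt_le_trans s0).
have cv p : p != p0 -> {for p, continuous v}.
  move=> pp0; apply: cvgD; first apply: cvgD; first exact: cu.
    apply: cvgM; first exact: cvg_cst.
    apply: cvgB; last exact: cvg_cst.
    apply: continuous_comp; first exact: sqdist_continuous.
    by apply: continuous_ln; rewrite sqdist_gt0.
  by apply: cvgM; [exact: cvg_cst|exact: sqdist_continuous].
have K1 : K !=set0 by exists p1; rewrite /K /= !ltW.
have Kv : {within K, continuous v}.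
  by apply: continuous_in_subspaceT => p /set_mem /Kp0; exact: cv.
have [q /set_mem Kq vmax] := compact_EVT_max K1 (@annulus_compact s S) Kv.
have vq : 7 / 8 * u p1 <= v q.
  by apply: le_trans v1 _; apply: vmax; apply/mem_set; rewrite /K /= !ltW.
have qp0 := Kp0 _ Kq; have := Kq => /andP[sq qS].
(* On the inner circle [v] is at most 1/8, on the outer one at most 5/8 of [u p1]; the maximum is at
   least 7/8 of it, so it is attained inside. *)
have {}sq : s < sqdist q.
  rewrite lt_neqAle sq andbT; apply/eqP => Eq.
  have : u q <= B by apply: uB; rewrite -Eq s0.
  have := etaS _ qS; move: vq slnS (ler_norm B); rewrite /v -Eq.
  by move: (eps * _) (eta * _) (`|B|) (u q) u1 => X Y Z T; move: (u p1) => W; lra.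
have {}qS : sqdist q < S.
  rewrite lt_neqAle qS andbT; apply/eqP => Eq.
  have : u q <= u p1 / 2 by apply: HS0; rewrite Eq le_max lexx.
  have := etaS _ qS; move: vq; rewrite /v Eq subrr mulr0 addr0.
  by move: (eta * _) (u q) u1 => Y T; move: (u p1) => W; lra.
have near_q : \forall p \near q, K p /\ p != p0.
  have : \forall p \near q, s < sqdist p < S.
    have cq := @sqdist_continuous q.
    by near=> p; apply/andP; split; near: p; [exact: (cvgr_gt _ cq)|exact: (cvgr_lt _ cq)].
  apply: filterS => p /andP[h1 h2]; have Kp : K p by rewrite /K /= !ltW.
  by split=> //; exact: Kp0.
pose vx p := ux p + eps * (2 * lin ex p / sqdist p) + eta * (2 * lin ex p).
pose vy p := uy p + eps * (2 * lin ey p / sqdist p) + eta * (2 * lin ey p).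
have hx p : p != p0 -> is_derive p ex v (vx p).
  by move=> pp0; have [d1 _ _ _] := du pp0; exact: perturb_derive.
have hy p : p != p0 -> is_derive p ey v (vy p).
  by move=> pp0; have [_ d2 _ _] := du pp0; exact: perturb_derive.
have [_ _ d3 d4] := du qp0.
have hA := perturb_derive2 eps eta qp0 d3.
have hB := perturb_derive2 eps eta qp0 d4.
have nx : \forall p \near q, is_derive p ex v (vx p).
  by apply: filterS near_q => p [_]; exact: hx.
have ny : \forall p \near q, is_derive p ey v (vy p).
  by apply: filterS near_q => p [_]; exact: hy.
have nv : \forall p \near q, v p <= v q.
  by apply: filterS near_q => p [Kp _]; apply: vmax; apply/mem_set.
have := no_interior_max nx ny hA hB nv.
rewrite /lin /= !mul0r !mul1r !add0r !addr0 expr1n expr0n /= addr0 add0r !mulr1.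
rewrite leNgt; apply/negP; rewrite negbK.
have N0 : sqdist q != 0 by rewrite lt0r_neq0 // sqdist_gt0.
(* Off [p0] the function [ln sqdist] is harmonic, so the Laplacian of [v] comes from the quadratic
   term alone. *)
set L := (X in 0 < X); have -> : L = 4 * eta; last by rewrite mulr_gt0.
move: N0; rewrite /L /sqdist.
move: (q.1 - p0.1) (q.2 - p0.2) (uxx q) => x y w N0.
by field.
Unshelve. all: by end_near. Qed.

End Punctured.
End MaximumPrinciple.

(** * The Fubini-Study metric in affine charts *)

Section LinearComposition.
Context {R : realType} {V W W' : normedModType R}.

Lemma is_derive_comp_linear (f : W -> W') (F : V -> W) x v :
  linear f -> continuous f -> derivable F x v ->
  is_derive x v (fun y => f (F y)) (f ('D_v F x)).
Proof.
move=> lf cf dF.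
have lB y z : f (y - z) = f y - f z.
  by rewrite -[y - z]addrC -scaleN1r lf /= scaleN1r addrC.
have f0 : f 0 = 0 by rewrite -(subrr (0 : W)) lB subrr.
have lZ k y : f (k *: y) = k *: f y by rewrite -[k *: y]addr0 lf f0 addr0.
have E : (fun h : R => h^-1 *: (((fun y => f (F y)) \o shift x) (h *: v) - f (F x))) =
    f \o (fun h : R => h^-1 *: ((F \o shift x) (h *: v) - F x)).
  by apply/funext => h /=; rewrite lZ lB.
have cv : f \o (fun h : R => h^-1 *: ((F \o shift x) (h *: v) - F x)) @ 0^' --> f ('D_v F x).
  by apply: cvg_comp; [exact: dF|exact: cf].
have d1 : derivable (fun y => f (F y)) x v.
  by rewrite /derivable E; apply/cvg_ex; exists (f ('D_v F x)).
have d2 : 'D_v (fun y => f (F y)) x = f ('D_v F x).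
  by rewrite /derive E; apply: cvg_lim.
by split.
Qed.

Lemma Cn_on_comp_linear n (U : set V) (f : W -> W') (F : V -> W) :
  linear f -> continuous f -> open U -> Cn_on n U F -> Cn_on n U (fun y => f (F y)).
Proof.
move=> lf cf oU; elim: n F => [|n IH] F /= [cF HF]; split=> //.
- by move=> x xU; apply: continuous_comp; [exact: cF|exact: cf].
- by move=> x xU; apply: continuous_comp; [exact: cF|exact: cf].
move=> v; have [dF CF] := HF v; split.
  by move=> x xU; have [] := is_derive_comp_linear lf cf (dF x xU).
apply: Cn_on_ext (IH _ CF) => // x xU.
by have [_ ->] := is_derive_comp_linear lf cf (dF x xU).
Qed.

End LinearComposition.

Lemma Cn_on_scale (R : realType) (V W : normedModType R) n (U : set V) (F : V -> R) (e : W) :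
  open U -> Cn_on n U F -> Cn_on n U (fun y => F y *: e).
Proof.
move=> oU; apply: (Cn_on_comp_linear (f := fun k : R => k *: e)) => //.
  by move=> k a b /=; rewrite scalerDl scalerA.
exact: scalel_continuous.
Qed.

Section Charts.
Context {R : realType}.
Local Notation C := R[i].

Definition re_coord (l : 'I_2) (w : C2 R) : R := w.1 l 0.
Definition im_coord (l : 'I_2) (w : C2 R) : R := w.2 l 0.

Lemma re_coord_linear l : linear (re_coord l).
Proof. by move=> k u v; rewrite /re_coord /= !mxE. Qed.
Lemma im_coord_linear l : linear (im_coord l).
Proof. by move=> k u v; rewrite /im_coord /= !mxE. Qed.
Lemma re_coord_continuous l : continuous (re_coord l).
Proof.
move=> w; apply: (@continuous_comp _ _ _ fst (fun M : 'cV[R]_2 => M l 0)).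
  exact: cvg_fst.
exact: coord_continuous.
Qed.
Lemma im_coord_continuous l : continuous (im_coord l).
Proof.
move=> w; apply: (@continuous_comp _ _ _ snd (fun M : 'cV[R]_2 => M l 0)).
  exact: cvg_snd.
exact: coord_continuous.
Qed.

Lemma C2_complexE (w : C2 R) l : C2_complex w l 0 = re_coord l w +i* im_coord l w.
Proof. by rewrite mxE. Qed.

Section Domain.
Context {V : normedModType R}.

Lemma cder_C2_complex (F : V -> C2 R) x v l : derivable F x v ->
  cder (fun y => C2_complex (F y) l 0) x v (C2_complex ('D_v F x) l 0).
Proof.
move=> dF; split.
  rewrite (_ : (fun _ => _) = fun y => re_coord l (F y)); last first.
    by apply/funext => y; rewrite C2_complexE.
  rewrite C2_complexE; apply: is_derive_comp_linear => //.
    exact: re_coord_linear.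
  exact: re_coord_continuous.
rewrite (_ : (fun _ => _) = fun y => im_coord l (F y)); last first.
  by apply/funext => y; rewrite C2_complexE.
rewrite C2_complexE; apply: is_derive_comp_linear => //.
  exact: im_coord_linear.
exact: im_coord_continuous.
Qed.

Lemma csmooth_C2_complex (U : set V) (F : V -> C2 R) l : open U -> smooth_on U F ->
  csmooth_on U (fun y => C2_complex (F y) l 0).
Proof.
move=> oU sF; split=> n.
  rewrite (_ : (fun _ => _) = fun y => re_coord l (F y)); last first.
    by apply/funext => y; rewrite C2_complexE.
  by apply: Cn_on_comp_linear => //; [exact: re_coord_linear|exact: re_coord_continuous].
rewrite (_ : (fun _ => _) = fun y => im_coord l (F y)); last first.
  by apply/funext => y; rewrite C2_complexE.
by apply: Cn_on_comp_linear => //; [exact: im_coord_linear|exact: im_coord_continuous].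
Qed.

End Domain.

Lemma smooth_on_C2 {V : normedModType R} (U : set V) (F : V -> C2 R) : open U ->
  (forall l, csmooth_on U (fun y => C2_complex (F y) l 0)) -> smooth_on U F.
Proof.
move=> oU sF n.
have cre l : Cn_on n U (fun y => re_coord l (F y)).
  by have [h _] := sF l; apply: Cn_on_ext (h n) => // y _; rewrite C2_complexE.
have cim l : Cn_on n U (fun y => im_coord l (F y)).
  by have [_ h] := sF l; apply: Cn_on_ext (h n) => // y _; rewrite C2_complexE.
pose e l : C2 R := (delta_mx l 0, 0); pose e' l : C2 R := (0, delta_mx l 0).
rewrite (_ : F = fun y => (re_coord 0 (F y) *: e 0 + re_coord 1 (F y) *: e 1) +
   (im_coord 0 (F y) *: e' 0 + im_coord 1 (F y) *: e' 1)).
  by do !apply: Cn_onD => //; exact: Cn_on_scale.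
have col_delta (x : 'cV[R]_2) : x = x 0 0 *: delta_mx 0 0 + x 1 0 *: delta_mx 1 0.
  apply/matrixP => i k; rewrite !mxE !ord1 eqxx !andbT.
  by case: i => -[|[|//]] hi; rewrite /= ?(mulr1, mulr0, addr0, add0r); congr (x _ _); apply: val_inj.
apply/funext => y; case: (F y) => a b.
rewrite /e /e' /re_coord /im_coord /= {1}(col_delta a) {1}(col_delta b).
by congr (_, _); rewrite /= !scaler0 !(addr0, add0r).
Qed.

(** The derivative of [affine_vec j]: the coordinate normalised to 1 contributes 0. *)
Definition tangent_vec (j : 'I_3) (u : C2 R) : 'cV[C]_3 :=
  \col_k (if unlift j k is Some l then C2_complex u l 0 else 0).

Lemma mder_affine_vec {V : normedModType R} (F : V -> C2 R) j x v : derivable F x v ->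
  mder (fun y => affine_vec j (F y)) x v (tangent_vec j ('D_v F x)).
Proof.
move=> dF k i; rewrite mxE.
rewrite (_ : (fun _ => _) = fun y => if unlift j k is Some l then C2_complex (F y) l 0 else 1).
  by case: unlift => [l|]; [exact: cder_C2_complex|exact: cder_cst].
by apply/funext => y; rewrite mxE.
Qed.

Lemma mder_tangent_vec {V : normedModType R} (F : V -> C2 R) j x v : derivable F x v ->
  mder (fun y => tangent_vec j (F y)) x v (tangent_vec j ('D_v F x)).
Proof.
move=> dF k i; rewrite mxE.
rewrite (_ : (fun _ => _) = fun y => if unlift j k is Some l then C2_complex (F y) l 0 else 0).
  by case: unlift => [l|]; [exact: cder_C2_complex|exact: cder_cst].
by apply/funext => y; rewrite mxE.
Qed.

(** The Hermitian metric whose real part is [fubini_study]. As [C2_J] is multiplication by i,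
    [kahler_form] is the real part of i times it, so conformal and Lagrangian become one complex
    identity. *)
Definition hermitian_fs (w u v : C2 R) : C :=
  let W := C2_complex w in let a := C2_complex u in let b := C2_complex v in
  ((1 + hdot W W) * hdot a b - hdot a W * hdot W b) / (1 + hdot W W) ^+ 2.

Lemma fubini_studyE w u v : fubini_study w u v = Re (hermitian_fs w u v).
Proof. by []. Qed.

Lemma hdotE (u v : 'cV[C]_2) : hdot u v = u 0 0 * conjc (v 0 0) + u 1 0 * conjc (v 1 0).
Proof.
rewrite /hdot big_ord_recl big_ord1; have -> : lift ord0 ord0 = 1 :> 'I_2 by apply: val_inj.
by [].
Qed.

Lemma hdot_tangent j (u v : C2 R) :
  (adj (tangent_vec j v) *m tangent_vec j u) 0 0 = hdot (C2_complex u) (C2_complex v).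
Proof.
rewrite mxE (bigD1_ord j) //= adjE !mxE unlift_none mulr0 add0r.
by apply: eq_bigr => l _; rewrite adjE [tangent_vec j v _ _]mxE [tangent_vec j u _ _]mxE liftK mulrC.
Qed.

Lemma hdot_affine_tangent j (w u : C2 R) :
  (adj (affine_vec j w) *m tangent_vec j u) 0 0 = hdot (C2_complex u) (C2_complex w).
Proof.
rewrite mxE (bigD1_ord j) //= adjE !mxE unlift_none mulr0 add0r.
by apply: eq_bigr => l _; rewrite adjE [affine_vec j w _ _]mxE [tangent_vec j u _ _]mxE liftK mulrC.
Qed.

Lemma hdot_affine j (w : C2 R) :
  (adj (affine_vec j w) *m affine_vec j w) 0 0 = 1 + hdot (C2_complex w) (C2_complex w).
Proof.
rewrite mxE (bigD1_ord j) //= adjE !mxE unlift_none conjc1 mulr1; congr (_ + _).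
by apply: eq_bigr => l _; rewrite adjE [affine_vec j w _ _]mxE liftK mulrC.
Qed.

Lemma hdotC (u v : 'cV[C]_2) : hdot u v = conjc (hdot v u).
Proof. by rewrite !hdotE rmorphD !rmorphM /= !conjcK; congr (_ + _); rewrite mulrC. Qed.


Lemma hdot_ge0 (u : 'cV[C]_2) : exists2 r : R, 0 <= r & hdot u u = r%:C.
Proof.
exists (Re (u 0 0) ^+ 2 + Im (u 0 0) ^+ 2 + (Re (u 1 0) ^+ 2 + Im (u 1 0) ^+ 2)).
  by rewrite !addr_ge0 // sqr_ge0.
by rewrite hdotE; apply: complex_ext; rewrite !ReImE /=; ring.
Qed.

Lemma cder_hdot (w d : C2 R) (a b : 'cV[C]_2) :
  [/\ cder (fun y : C2 R => hdot a (C2_complex y)) w d (hdot a (C2_complex d)),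
      cder (fun y : C2 R => hdot (C2_complex y) b) w d (hdot (C2_complex d) b) &
      cder (fun y : C2 R => hdot (C2_complex y) (C2_complex y)) w d
        (hdot (C2_complex d) (C2_complex w) + hdot (C2_complex w) (C2_complex d))].
Proof.
have h l : cder (fun y : C2 R => C2_complex y l 0) w d (C2_complex d l 0).
  have := cder_C2_complex l (@derivable_id _ _ w d).
  by rewrite derive_id.
split.
- apply: (@cder_ext _ _ (fun y => a 0 0 * conjc (C2_complex y 0 0) + a 1 0 * conjc (C2_complex y 1 0))).
    by move=> y; rewrite hdotE.
  apply: cder_eq (cderD (cderM (cder_cst (a 0 0) w d) (cderJ (h 0)))
    (cderM (cder_cst (a 1 0) w d) (cderJ (h 1)))) _.
  by rewrite hdotE !mul0r !add0r.
- apply: (@cder_ext _ _ (fun y => C2_complex y 0 0 * conjc (b 0 0) + C2_complex y 1 0 * conjc (b 1 0))).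
    by move=> y; rewrite hdotE.
  apply: cder_eq (cderD (cderM (h 0) (cder_cst (conjc (b 0 0)) w d))
    (cderM (h 1) (cder_cst (conjc (b 1 0)) w d))) _.
  by rewrite hdotE !mulr0 !addr0.
- apply: (@cder_ext _ _ (fun y => C2_complex y 0 0 * conjc (C2_complex y 0 0)
      + C2_complex y 1 0 * conjc (C2_complex y 1 0))).
    by move=> y; rewrite hdotE.
  apply: cder_eq (cderD (cderM (h 0) (cderJ (h 0))) (cderM (h 1) (cderJ (h 1)))) _.
  by rewrite !hdotE addrACA.
Qed.

Lemma cder_hermitian_fs (w d a b : C2 R) :
  let W := C2_complex w in let D := C2_complex d in
  let A := C2_complex a in let B := C2_complex b in
  let n := 1 + hdot W W in
  cder (fun y => hermitian_fs y a b) w d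
    (((hdot D W + hdot W D) * hdot A B - hdot A D * hdot W B - hdot A W * hdot D B) / n ^+ 2
     - 2 * (hdot D W + hdot W D) * (n * hdot A B - hdot A W * hdot W B) / n ^+ 3).
Proof.
move=> W D A B n.
have n0 : n != 0.
  have [r r0 e] := hdot_ge0 W; rewrite /n e -[1]/((1 : R)%:C) -raddfD /=.
  by rewrite eq_complex negb_and /= gt_eqF // ltr_pwDl.
have [h1 _ h3] := cder_hdot w d A B; have [_ h2 _] := cder_hdot w d A B.
have hn := cderD (cder_cst (1 : C) w d) h3.
have hn2 := cderM hn hn.
have n20 : n * n != 0 by rewrite mulf_neq0.
have hnum := cderD (cderM hn (cder_cst (hdot A B) w d)) (cderN (cderM h1 h2)).
have := cderM hnum (cderV n20 hn2).
move=> h; apply: cder_eq (cder_ext _ h) _; first by move=> y; rewrite /hermitian_fs expr2.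
rewrite -/W -/D -/n; move: (hdot D W) (hdot W D) (hdot A B) (hdot A D) (hdot W B) (hdot A W) (hdot D B) n0.
move: (n) => {n20 hnum h hn2 hn h1 h2 h3 n} n x1 x2 x3 x4 x5 x6 x7 n0.
by field.
Qed.

(** The metric is Kaehler, so its Levi-Civita connection is complex linear, and in an affine chart
    the covariant derivative of the constant field [a] along itself is [-2 <a, w> / (1 + |w|^2)]
    times [a]. *)
Lemma christoffel_fs (w a c : C2 R) :
  christoffel fubini_study w a a c =
  Re (- 2 * hdot (C2_complex a) (C2_complex w) / (1 + hdot (C2_complex w) (C2_complex w))
      * hermitian_fs w a c).
Proof.
have E X1 X2 : 'D_a (fun y => Re (hermitian_fs y a c)) w = X1 ->
    'D_c (fun y => Re (hermitian_fs y a a)) w = X2 ->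
    christoffel fubini_study w a a c = (X1 + X1 - X2) / 2.
  by move=> <- <-.
have [[_ e1] _] := cder_hermitian_fs w a a c.
have [[_ e2] _] := cder_hermitian_fs w c a a.
set W := C2_complex w in e1 e2 *; set A := C2_complex a in e1 e2 *; set B := C2_complex c in e1 e2 *.
rewrite (E _ _ e1 e2) /hermitian_fs -/W -/A -/B {e1 e2}.
have [r r0 ->] := hdot_ge0 W; have [t t0 ->] := hdot_ge0 A.
rewrite (hdotC W A) (hdotC W B) (hdotC B A).
have n0 : 1 + r != 0 by rewrite gt_eqF // ltr_pwDl.
have -> : 1 + r%:C = (1 + r)%:C by rewrite rmorphD.
(* Real parts are compared through [x + conjc x], which gives an identity of rational functions in
   the inner products and their conjugates. *)
have re_eq (x y : C) : x + conjc x = (y + conjc y) + (y + conjc y) -> Re x / 2 = Re y.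
  by case: x y => x1 x2 [y1 y2] /(congr1 (@Re _)) /= h; lra.
rewrite -ReD -ReN -ReD; apply: re_eq.
have : (1 + r)%:C != 0 :> C by rewrite eq_complex /= negb_and n0.
have : conjc (1 + r)%:C = (1 + r)%:C :> C by rewrite /= oppr0.
have : conjc (t%:C) = t%:C :> C by rewrite /= oppr0.
move: ((1 + r)%:C) (t%:C) (hdot A W) (hdot A B) (hdot B W) => n s x1 x2 x3 cs cn n0'.
rewrite !(conjcD, conjcN) !conjcM !(conjcV, conjcX) !conjcD !conjcM !conjcN !conjcD !conjcM ?conjcK ?cn ?cs ?conjc_nat.
move: (conjc x1) (conjc x2) (conjc x3) => y1 y2 y3.
by field.
Qed.

End Charts.

(** * The projection onto the lines of a surface *)

Section LineProjection.
Context {R : rcfType}.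
Local Notation C := R[i].

Definition sqn (v : 'cV[C]_3) : C := (adj v *m v) 0 0.

Lemma sqnE v : adj v *m v = (sqn v)%:M.
Proof. by rewrite [LHS]mx11_scalar. Qed.

Lemma sqn_eq0 v : (sqn v == 0) = (v == 0).
Proof.
apply/eqP/eqP => [h|->]; last by rewrite /sqn mulmx0 mxE.
by apply: adj_mul_eq0; rewrite /mxtrace big_ord1.
Qed.

Lemma sqnJ v : conjc (sqn v) = sqn v.
Proof. by rewrite -adjE adjMm adjK. Qed.

Lemma sqnZ (k : C) v : sqn (k *: v) = conjc k * k * sqn v.
Proof. by rewrite /sqn adjZ -scalemxAr -scalemxAl !mxE mulrA [k * _]mulrC. Qed.

Definition line_proj (v : 'cV[C]_3) : 'M[C]_3 := (sqn v)^-1 *: (v *m adj v).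

Lemma line_projZ (k : C) v : k != 0 -> line_proj (k *: v) = line_proj v.
Proof.
move=> k0; have [->|v0] := eqVneq v 0; first by rewrite scaler0.
have n0 : sqn v != 0 by rewrite sqn_eq0.
have k0' : conjc k != 0 by rewrite conjc_eq0.
rewrite /line_proj sqnZ adjZ -scalemxAr -scalemxAl !scalerA; congr (_ *: _).
by field; rewrite n0 k0 k0'.
Qed.

Lemma line_proj_id v : v != 0 -> line_proj v *m v = v.
Proof.
rewrite -sqn_eq0 => n0.
by rewrite -scalemxAl -mulmxA sqnE mul_mx_scalar scalerA mulVf // scale1r.
Qed.

Lemma line_proj_adj v : adj (line_proj v) = line_proj v.
Proof. by rewrite /line_proj adjZ adjMm adjK conjcV sqnJ. Qed.

Lemma tr_line_proj v : v != 0 -> \tr (line_proj v) = 1.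
Proof.
rewrite -sqn_eq0 => n0.
by rewrite mxtraceZ mxtrace_mulC sqnE mxtrace_scalar mulr1n mulVf.
Qed.

Lemma line_proj_idem v : v != 0 -> line_proj v *m line_proj v = line_proj v.
Proof. by move=> v0; rewrite {2}/line_proj -scalemxAr mulmxA line_proj_id. Qed.

Lemma sqn_real v : exists2 r : R, 0 <= r & sqn v = r%:C.
Proof.
exists (\sum_l (Re (v l 0) ^+ 2 + Im (v l 0) ^+ 2)).
  by apply: sumr_ge0 => l _; rewrite addr_ge0 ?sqr_ge0.
rewrite /sqn mxE (rmorph_sum (@real_complex R)); apply: eq_bigr => l _.
by rewrite adjE; apply: complex_ext; rewrite !ReImE /=; ring.
Qed.

Lemma unit_representative v : v != 0 ->
  exists2 u : 'cV_3, line_proj v = u *m adj u & adj u *m u = 1%:M.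
Proof.
move=> v0; have [r r0 rE] := sqn_real v.
have rn0 : r != 0 by move: v0; rewrite -sqn_eq0 rE eq_complex eqxx andbT.
pose k : C := ((Num.sqrt r)^-1)%:C.
have kJ : conjc k = k by apply: complex_ext => //=; rewrite oppr0.
have kk : k * k = (sqn v)^-1.
  rewrite rE -fmorphV -rmorphM /= -invfM -expr2 sqr_sqrtr //.
exists (k *: v); rewrite adjZ -scalemxAl -scalemxAr scalerA kJ kk //.
by rewrite sqnE scale_scalar_mx mulVf // sqn_eq0.
Qed.

End LineProjection.

Section Lift.
Context {R : rcfType}.
Local Notation C := R[i].
Variables (P : 'M[C]_3) (x : 'cV[C]_3).
Hypotheses (x0 : x != 0) (PE : P = line_proj x).

Let n0 : sqn x != 0. Proof. by rewrite sqn_eq0. Qed.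
Let P_idem : P *m P = P. Proof. by rewrite PE line_proj_idem. Qed.

(** The tangent space of CP^2 at a line L is Hom(L, L^perp). For [P] the projection onto the line of
    [x], this is the element sending [x] to the part of [t] orthogonal to [x], extended by zero on
    L^perp. *)
Definition horizontal (t : 'cV[C]_3) : 'M[C]_3 :=
  (sqn x)^-1 *: ((1%:M - P) *m t *m adj x).

(** The hypothesis is the derivative of [P *m x = x]. *)
Lemma lift_first (D : 'M[C]_3) (xv : 'cV[C]_3) :
  D *m x + P *m xv = xv -> D *m P = horizontal xv.
Proof.
move=> h; have {}h : D *m x = (1%:M - P) *m xv by rewrite mulmxBl mul1mx -[X in X - _]h addrK.
by rewrite /horizontal -h PE /line_proj -scalemxAr mulmxA.
Qed.

(** The hypotheses are the derivatives of [P *m P = P] and, once and twice, of [P *m x = x]. The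
    subtracted multiple of [xv] comes from the two terms [D *m xv]; it is the Christoffel term of
    [christoffel_fs]. *)
Lemma lift_second (D DD : 'M[C]_3) (xv xvv : 'cV[C]_3) :
  D *m P + P *m D = D -> D *m x + P *m xv = xv ->
  DD *m x + D *m xv + (D *m xv + P *m xvv) = xvv ->
  (1%:M - P) *m DD *m P =
    horizontal (xvv - (2 * (adj x *m xv) 0 0 / sqn x) *: xv).
Proof.
move=> hD h1 h2.
have {h2}e2 : DD *m x = (1%:M - P) *m xvv - (D *m xv + D *m xv).
  rewrite mulmxBl mul1mx -[X in _ = X - _ - _]h2; move: (DD *m x) (D *m xv) (P *m xvv) => X Y Z.
  by rewrite addrAC [_ + (Y + Z)]addrC -addrA; apply/matrixP => a b; rewrite !mxE; ring.
have QQ : (1%:M - P) *m (1%:M - P) = 1%:M - P.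
  by rewrite mulmxBl !mulmxBr !mul1mx mulmx1 P_idem subrr subr0.
have QD : (1%:M - P) *m D = (1%:M - P) *m (D *m P).
  rewrite -{1}hD mulmxDr [(1%:M - P) *m (P *m D)]mulmxA.
  by rewrite [(1%:M - P) *m P]mulmxBl mul1mx P_idem subrr mul0mx addr0.
have QDx : (1%:M - P) *m (D *m xv) = ((adj x *m xv) 0 0 / sqn x) *: ((1%:M - P) *m xv).
  rewrite mulmxA QD (lift_first h1) /horizontal -scalemxAr !mulmxA QQ -scalemxAl -!mulmxA.
  by rewrite {1}[adj x *m xv]mx11_scalar mul_mx_scalar -scalemxAr scalerA mulrC.
rewrite [X in _ *m X = _]PE /line_proj -scalemxAr mulmxA -[(1%:M - P) *m DD *m x]mulmxA e2 /horizontal.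
suff -> : (1%:M - P) *m ((1%:M - P) *m xvv - (D *m xv + D *m xv)) =
  (1%:M - P) *m (xvv - (2 * (adj x *m xv) 0 0 / sqn x) *: xv) by [].
rewrite mulmxBr mulmxA QQ mulmxDr QDx [RHS]mulmxBr -scalemxAr -scalerDl.
by congr (_ - _ *: _); rewrite mulr2n mulrDl mul1r mulrDl.
Qed.

Lemma horizontal_pairing (t s : 'cV[C]_3) :
  adj (horizontal t) *m horizontal s =
    ((sqn x)^-1 * (adj t *m (1%:M - P) *m s) 0 0) *: P.
Proof.
have QQ : (1%:M - P) *m (1%:M - P) = 1%:M - P.
  by rewrite mulmxBl !mulmxBr !mul1mx mulmx1 P_idem subrr subr0.
have QJ : adj (1%:M - P) = 1%:M - P by rewrite adjB adj1 PE line_proj_adj.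
rewrite /horizontal adjZ !adjMm adjK QJ -scalemxAr -scalemxAl conjcV sqnJ scalerA.
rewrite -!mulmxA [(1%:M - P) *m ((1%:M - P) *m _)]mulmxA QQ.
rewrite [adj t *m (_ *m (s *m adj x))]mulmxA [adj t *m (1%:M - P) *m (s *m adj x)]mulmxA.
rewrite {1}[adj t *m (1%:M - P) *m s]mx11_scalar mul_scalar_mx -scalemxAr scalerA.
rewrite -[adj t *m (1%:M - P) *m s]mulmxA; move: ((adj t *m ((1%:M - P) *m s)) 0 0) => k.
rewrite PE /line_proj scalerA.  by congr (_ *: _); rewrite mulrAC.
Qed.

Lemma horizontalD t s : horizontal (t + s) = horizontal t + horizontal s.
Proof. by rewrite /horizontal mulmxDr mulmxDl scalerDr. Qed.
Lemma horizontalZ k t : horizontal (k *: t) = k *: horizontal t.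
Proof. by rewrite /horizontal -scalemxAr -scalemxAl !scalerA mulrC. Qed.

End Lift.

(** The chart formula is the inner product of the components orthogonal to the line, over the
    squared length of the lift. This is the number produced by [horizontal_pairing]. *)
Lemma hermitian_fsE (R : realType) j (w u v : C2 R) :
  hermitian_fs w u v =
  (sqn (affine_vec j w))^-1 * (adj (tangent_vec j v)
    *m (1%:M - line_proj (affine_vec j w)) *m tangent_vec j u) 0 0.
Proof.
set X := affine_vec j w; have n0 : sqn X != 0 by rewrite sqn_eq0 affine_vec_neq0.
rewrite mulmxBr mulmx1 mulmxBl /line_proj -scalemxAr -scalemxAl.
have -> : adj (tangent_vec j v) *m (X *m adj X) *m tangent_vec j u =
    (adj (tangent_vec j v) *m X) *m (adj X *m tangent_vec j u) by rewrite !mulmxA.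
have -> : adj (tangent_vec j v) *m X = adj (adj X *m tangent_vec j v) by rewrite adjMm adjK.
rewrite [adj X *m tangent_vec j v]mx11_scalar [adj X *m tangent_vec j u]mx11_scalar.
rewrite !hdot_affine_tangent [adj _ *m tangent_vec j u]mx11_scalar hdot_tangent.
rewrite mul_mx_scalar !mxE /= !mulr1n.
rewrite /hermitian_fs -(hdot_affine j) -/X -/(sqn X) (hdotC (C2_complex w) (C2_complex v)).
by field.
Qed.

HB.lock Definition mpart {R : realType} (v : plane R) m n (M : plane R -> 'M[R[i]]_(m, n)) p :
  'M[R[i]]_(m, n) := \matrix_(i, j) cpart v (fun y => M y i j) p.
Arguments mpart {R} v {m n} M p.

Section DirectionalPart.
Context {R : realType}.
Local Notation C := R[i].
Variables (m n : nat) (M : plane R -> 'M[C]_(m, n)).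
Hypothesis sM : msmooth M.

Lemma mpartE v p i j : mpart v M p i j = cpart v (fun y => M y i j) p.
Proof. by rewrite mpart.unlock mxE. Qed.

Lemma mpartP v p : mder M p v (mpart v M p).
Proof. by move=> i j; rewrite mpartE; exact: cpartP. Qed.

Lemma msmooth_mpart v : msmooth (mpart v M).
Proof.
move=> i j; rewrite (_ : (fun _ => _) = cpart v (fun y => M y i j)).
  exact: csmooth_cpart.
by apply/funext => p; rewrite mpartE.
Qed.

Lemma mpart_scale (k : R) v p : mpart (k *: v) M p = k%:C *: mpart v M p.
Proof.
apply/matrixP => i j; rewrite mpartE mxE mpartE; apply: cpartE.
exact: cder_scale (cpartP _ _ _).
Qed.

Lemma mdz_mpart p : mdz M p = 2^-1 *: (mpart ex M p - 'i%C *: mpart ey M p).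
Proof. by apply/matrixP => i j; rewrite mdzE !mxE !mpartE mulrC. Qed.

Lemma mdzb_mpart p : mdzb M p = 2^-1 *: (mpart ex M p + 'i%C *: mpart ey M p).
Proof. by apply/matrixP => i j; rewrite mdzbE !mxE !mpartE mulrC. Qed.

End DirectionalPart.

Lemma mpartZ (R : realType) m n (M : plane R -> 'M[R[i]]_(m, n)) (k : R[i]) v p : msmooth M ->
  mpart v (fun y => k *: M y) p = k *: mpart v M p.
Proof.
move=> sM; apply/matrixP => i j; rewrite mpartE mxE mpartE; apply: cpartE.
apply: (@cder_ext _ _ (fun y => k * M y i j)); first by move=> y; rewrite mxE.
by apply: cder_eq (cderM (cder_cst k p v) (cpartP v p (sM i j))) _; rewrite mul0r add0r.
Qed.

Lemma mpart_comm (R : realType) m n (M : plane R -> 'M[R[i]]_(m, n)) u v p : msmooth M ->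
  mpart u (mpart v M) p = mpart v (mpart u M) p.
Proof.
move=> sM; apply/matrixP => i j; rewrite !mpartE.
rewrite (_ : (fun y => mpart v M y i j) = cpart v (fun y => M y i j)); last first.
  by apply/funext => y; rewrite mpartE.
rewrite (_ : (fun y => mpart u M y i j) = cpart u (fun y => M y i j)); last first.
  by apply/funext => y; rewrite mpartE.
exact: cpart_sym.
Qed.

Lemma laplacian_mpart (R : realType) m n (M : plane R -> 'M[R[i]]_(m, n)) p : msmooth M ->
  mdz (mdzb M) p = 4^-1 *: (mpart ex (mpart ex M) p + mpart ey (mpart ey M) p).
Proof.
move=> sM; have sb := msmooth_mdzb sM.
have e v : mpart v (mdzb M) p = 2^-1 *: (mpart v (mpart ex M) p + 'i%C *: mpart v (mpart ey M) p).
  apply: (mder_unique (mpartP sb v p)).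
  apply: (@mder_ext _ _ _ _ (fun y => 2^-1 *: (mpart ex M y + 'i%C *: mpart ey M y))).
    by move=> y; rewrite mdzb_mpart.
  have hx := mpartP (msmooth_mpart sM ex) v p; have hy := mpartP (msmooth_mpart sM ey) v p.
  apply: mder_eq (mderZ (cder_cst _ p v) (mderD hx (mderZ (cder_cst _ p v) hy))) _.
  by rewrite !scale0r !add0r.
rewrite mdz_mpart // !e (mpart_comm ey ex p sM).
move: (mpart ex (mpart ex M) p) (mpart ex (mpart ey M) p) (mpart ey (mpart ey M) p) => X Y Z.
apply/matrixP => i j; rewrite !mxE.
move: (X i j) (Y i j) (Z i j) => x y z.
have -> : 2^-1 * (2^-1 * (x + 'i%C * y) - 'i%C * (2^-1 * (y + 'i%C * z))) =
  2^-1 * 2^-1 * (x - 'i%C * 'i%C * z) by ring.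
by rewrite mulii; field.
Qed.

Section Projection.
Context {R : realType}.
Local Notation C := R[i].

Lemma vpick_neq0 (L : CP2 R) : vpick (val L) != 0.
Proof. by rewrite vpick0 -dimv_eq0 (eqP (valP L)). Qed.

Lemma chart_dom_exists (L : CP2 R) : exists j, chart_dom j L.
Proof.
apply: contrapT => /forallNP h; have /eqP[] := vpick_neq0 L; apply/matrixP => i k.
by rewrite ord1 mxE; apply/eqP/negPn/negP; exact: h.
Qed.

Lemma vpick_chart j (L : CP2 R) : chart_dom j L ->
  vpick (val L) = vpick (val L) j 0 *: affine_vec j (chart j L).
Proof.
rewrite /chart_dom => d; apply/matrixP => i k; rewrite ord1 !mxE.
case: unliftP => [l ->|->]; last by rewrite mulr1.
rewrite !mxE /=.
have reim (z : C) : Re z +i* Im z = z by case: z.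
by rewrite reim mulrC divfK.
Qed.

Lemma line_proj_chart j (L : CP2 R) : chart_dom j L ->
  line_proj (vpick (val L)) = line_proj (affine_vec j (chart j L)).
Proof. by move=> d; rewrite (vpick_chart d) line_projZ. Qed.

Definition projection (f : C -> CP2 R) (p : plane R) := line_proj (vpick (val (realify f p))).

Lemma csmooth_affine_vec (V : normedModType R) (U : set V) (F : V -> C2 R) j k : open U ->
  smooth_on U F -> csmooth_on U (fun y => affine_vec j (F y) k 0).
Proof.
move=> oU sF.
rewrite (_ : (fun _ => _) = fun y => if unlift j k is Some l then C2_complex (F y) l 0 else 1).
  by case: unlift => [l|]; [exact: csmooth_C2_complex|exact: csmooth_on_cst].
by apply/funext => y; rewrite mxE.
Qed.

Lemma csmooth_line_proj (V : normedModType R) (U : set V) (X : V -> 'cV[C]_3) i k : open U ->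
  (forall l, csmooth_on U (fun y => X y l 0)) -> {in U, forall y, X y != 0} ->
  csmooth_on U (fun y => line_proj (X y) i k).
Proof.
move=> oU sX X0.
apply: (@csmooth_on_ext _ _ _ (fun y => (\sum_l conjc (X y l 0) * X y l 0)^-1 * (X y i 0 * conjc (X y k 0)))) => //.
  move=> y yU; rewrite /line_proj /sqn !mxE big_ord1 adjE; congr (_^-1 * _).
  by apply: eq_bigr => l _; rewrite adjE.
apply: csmooth_onM => //.
  apply: csmooth_onV => //.
    move=> y yU; have := X0 y yU; rewrite -sqn_eq0 /sqn mxE; apply: contra => /eqP h.
    by apply/eqP; rewrite -[RHS]h; apply: eq_bigr => l _; rewrite adjE.
  by apply: csmooth_on_sum => // l; apply: csmooth_onM => //; exact: csmooth_onJ.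
by apply: csmooth_onM => //; exact: csmooth_onJ.
Qed.

(** Near each point [vpick] may be replaced by the affine representative of a chart, which is
    smooth, without changing the projection. *)
Lemma msmooth_projection f : smooth_to_CP2 (realify f) -> msmooth (projection f).
Proof.
move=> sf i k; apply: csmooth_on_local => x.
have [j jx] := chart_dom_exists (realify f x).
have [U [xU dU sU]] := sf x j jx; exists U => //; have [oU _] := xU.
apply: (@csmooth_on_ext _ _ _ (fun y => line_proj (affine_vec j (chart j (realify f y))) i k)) => //.
  by move=> y yU; rewrite /projection (line_proj_chart (dU y yU)).
apply: csmooth_line_proj => // [l|y _]; last exact: affine_vec_neq0.
exact: csmooth_affine_vec.
Qed.

End Projection.

(** In the application the normal vector is i times a tangent vector, which turns real into
    imaginary parts; the two second derivatives add up to 4 times [mdz (mdzb P)]. *)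
Lemma trace_sum_Im (R : rcfType) (L K D1 D2 N : 'M[R[i]]_3) (k : R) :
  L = conjc 'i%C *: K ->
  Re (\tr (L *m ((k%:C * k%:C) *: D1 *m N))) +
  Re (\tr (L *m ((k%:C * k%:C) *: D2 *m N))) =
  k * k * 4 * Im (\tr (K *m (4^-1 *: (D1 + D2) *m N))).
Proof.
move=> hL.
have E (M D : 'M[R[i]]_3) c : \tr (M *m (c *: D *m N)) = c * \tr (M *m (D *m N)).
  by rewrite -scalemxAl -scalemxAr mxtraceZ.
have F (D : 'M[R[i]]_3) : \tr (L *m D) = conjc 'i%C * \tr (K *m D).
  by rewrite hL -scalemxAl mxtraceZ.
have G : \tr (K *m ((D1 + D2) *m N)) = \tr (K *m (D1 *m N)) + \tr (K *m (D2 *m N)).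
  by rewrite (mulmxDl D1 D2 N) (mulmxDr K) mxtraceD.
have re (D : 'M[R[i]]_3) : Re (\tr (L *m ((k%:C * k%:C) *: D *m N))) =
    k * k * Im (\tr (K *m (D *m N))).
  by rewrite E F; case: (\tr _) => x y; rewrite /=; ring.
have im : Im (\tr (K *m (4^-1 *: (D1 + D2) *m N))) =
    4^-1 * (Im (\tr (K *m (D1 *m N))) + Im (\tr (K *m (D2 *m N)))).
  rewrite E G (_ : 4^-1 = (4^-1)%:C); last by rewrite fmorphV rmorph_nat.
  by rewrite ImM ImD /= mul0r addr0.
apply: (etrans (congr2 +%R (re D1) (re D2))); apply: (etrans _ (congr1 ( *%R _) (esym im))).
by field.
Qed.

Section SurfaceProjection.
Context {R : realType}.
Local Notation C := R[i].
Variable f : C -> CP2 R.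
Hypothesis sf : smooth_to_CP2 (realify f).

Local Notation P := (projection f).
Let sP : msmooth P := msmooth_projection sf.

Lemma smooth_on_derivable (V W : normedModType R) (U : set V) (F : V -> W) x v :
  smooth_on U F -> x \in U -> derivable F x v.
Proof. by move=> sF xU; have [_ /(_ v)[d _]] := sF 1%N; exact: d. Qed.

Lemma smooth_on_derive (V W : normedModType R) (U : set V) (F : V -> W) v :
  smooth_on U F -> smooth_on U ('D_v F).
Proof. by move=> sF n; have [_ /(_ v)[_ h]] := sF n.+1. Qed.

Lemma projection_idem p : P p *m P p = P p.
Proof. by rewrite /projection line_proj_idem ?vpick_neq0. Qed.

Lemma projection_derivative_idem v p : mpart v P p *m P p + P p *m mpart v P p = mpart v P p.
Proof.
have h := mpartP sP v p; apply: mder_unique (mder_ext projection_idem (mder_mul h h)) h.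
Qed.

Arguments smooth_on_derivable {V W U F x} v.
Arguments smooth_on_derive {V W U F} v.

Section Chart.
Variables (j : 'I_3) (p : plane R) (U : set (plane R)).
Hypotheses (pU : open_nbhs p U) (dU : {in U, forall y, chart_dom j (realify f y)}).
Hypothesis sU : smooth_on U (local_rep f j).
Local Notation w := (local_rep f j).
Local Notation X y := (affine_vec j (w y)).
Local Notation T u := (tangent_vec j u).

Let oU : open U. Proof. by case: pU. Qed.
Let pinU : p \in U. Proof. by case: pU => _ ?; rewrite inE. Qed.

Lemma projection_chart y : y \in U -> P y = line_proj (X y).
Proof. by move=> yU; rewrite /projection (line_proj_chart (dU yU)). Qed.

Lemma lift_derivative v y : y \in U ->
  mpart v P y *m X y + P y *m T ('D_v w y) = T ('D_v w y).
Proof.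
move=> yU; have hw := mder_affine_vec j (smooth_on_derivable v sU yU).
apply: (mder_unique _ hw); apply: mder_near (mder_mul (mpartP sP v y) hw).
apply: (near_openW oU yU) => z zU.
by rewrite projection_chart // line_proj_id // affine_vec_neq0.
Qed.

Lemma lift_derivative2 v :
  mpart v (mpart v P) p *m X p + mpart v P p *m T ('D_v w p)
   + (mpart v P p *m T ('D_v w p) + P p *m T ('D_v ('D_v w) p)) = T ('D_v ('D_v w) p).
Proof.
have hw := mder_affine_vec j (smooth_on_derivable v sU pinU).
have hw2 := mder_tangent_vec j (smooth_on_derivable v (smooth_on_derive v sU) pinU).
apply: (mder_unique _ hw2).
apply: mder_near (mderD (mder_mul (mpartP (msmooth_mpart sP v) v p) hw) (mder_mul (mpartP sP v p) hw2)).
by apply: (near_openW oU pinU) => z zU; exact: lift_derivative.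
Qed.

Lemma projection_derivative v :
  mpart v P p *m P p = horizontal (P p) (X p) (T ('D_v w p)).
Proof.
apply: lift_first; [exact: projection_chart|exact: lift_derivative].
Qed.

Lemma projection_derivative2 v :
  (1%:M - P p) *m mpart v (mpart v P) p *m P p =
  horizontal (P p) (X p) (T ('D_v ('D_v w) p)
    - (2 * (adj (X p) *m T ('D_v w p)) 0 0 / sqn (X p)) *: T ('D_v w p)).
Proof.
apply: lift_second; [exact: affine_vec_neq0|exact: projection_chart| | |].
- exact: projection_derivative_idem.
- exact: lift_derivative.
- exact: lift_derivative2.
Qed.

Lemma horizontal_hermitian u v :
  adj (horizontal (P p) (X p) (T v)) *m horizontal (P p) (X p) (T u) =
  hermitian_fs (w p) u v *: P p.
Proof.
rewrite (hermitian_fsE j) -projection_chart //.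
by apply: horizontal_pairing; [exact: affine_vec_neq0|exact: projection_chart].
Qed.

Lemma derivative_pairing u v :
  adj (mpart v P p *m P p) *m (mpart u P p *m P p) =
  hermitian_fs (w p) ('D_u w p) ('D_v w p) *: P p.
Proof. by rewrite !projection_derivative horizontal_hermitian. Qed.

(** The Christoffel term is exactly the correction of [lift_second], so the covariant second
    derivative is the second derivative of [P]; the factor [1 - P] is absorbed because [horizontal]
    already maps into the complement. *)
Lemma second_form_trace c v :
  second_form f j p c v v =
  Re (\tr (adj (horizontal (P p) (X p) (T c)) *m (mpart v (mpart v P) p *m P p))).
Proof.
have QH : adj (horizontal (P p) (X p) (T c)) *m (1%:M - P p) = adj (horizontal (P p) (X p) (T c)).
  rewrite /horizontal adjZ !adjMm adjK -scalemxAl -!mulmxA; congr (_ *: (_ *m (_ *m _))).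
  rewrite adjB adj1 projection_chart // line_proj_adj -projection_chart //.
  by rewrite mulmxBl mul1mx mulmxBr mulmx1 projection_idem subrr subr0.
rewrite -QH -mulmxA [(1%:M - P p) *m (_ *m _)]mulmxA projection_derivative2.
rewrite /second_form fubini_studyE christoffel_fs -ReD horizontalD -scaleNr horizontalZ {QH}.
move: ('D_v ('D_v w) p) => d2; move: ('D_v w p) => d1.
have := horizontal_hermitian d1 c; have := horizontal_hermitian d2 c.
move: (horizontal (P p) (X p) (T c)) (horizontal (P p) (X p) (T d1)) => Hc H1.
move: (horizontal (P p) (X p) (T d2)) => H2 h2 h1.
have trP : \tr (P p) = 1 by rewrite projection_chart // tr_line_proj ?affine_vec_neq0.
move: (P p) trP h1 h2 => P0 trP h1 h2.
rewrite mulmxDr -scalemxAr h1 h2 scalerA -scalerDl mxtraceZ trP mulr1.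
congr (Re (_ + _ * _)).
by rewrite hdot_affine_tangent /sqn hdot_affine -!mulNr.
Qed.

Lemma tangent_vec_J (c : C2 R) : T (C2_J c) = 'i%C *: T c.
Proof.
apply/matrixP => k i; rewrite !mxE; case: unlift => [l|]; last by rewrite mulr0.
by rewrite !mxE; apply: complex_ext; rewrite !ReImE /= ?mxE; ring.
Qed.

Lemma hermitian_fs_J u v : hermitian_fs (w p) (C2_J u) v = 'i%C * hermitian_fs (w p) u v.
Proof. by rewrite !(hermitian_fsE j) tangent_vec_J -scalemxAr mxE mulrCA. Qed.

Lemma hermitian_fsC u v : hermitian_fs (w p) u v = conjc (hermitian_fs (w p) v u).
Proof.
rewrite !(hermitian_fsE j) conjcM conjcV sqnJ; congr (_ * _).
by rewrite -adjE !adjMm adjK adjB adj1 line_proj_adj mulmxA.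
Qed.

End Chart.

Hypothesis f_conformal : conformal f.
Hypothesis f_lagrangian : lagrangian f.

(** Conformality is the real part of this identity, the Lagrangian condition its imaginary part. *)
Lemma derivative_orthogonal p : exists2 r : R, 0 < r & forall u v,
  adj (mpart v P p *m P p) *m (mpart u P p *m P p) =
  (r * (u.1 * v.1 + u.2 * v.2))%:C *: P p.
Proof.
have [j jp] := chart_dom_exists (realify f p).
have [U [pU dU sU]] := sf jp.
have [r r0 H] := f_conformal jp; exists r => // u v.
rewrite (derivative_pairing pU dU sU); congr (_ *: _).
apply: complex_ext; first by rewrite -fubini_studyE; exact: H.
have := f_lagrangian jp u v; rewrite /kahler_form fubini_studyE hermitian_fs_J ReM /=.
by move=> /eqP; rewrite mul0r mul1r sub0r oppr_eq0 => /eqP.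
Qed.

(** [P_x P] and [P_y P] are orthogonal with equal squared length [r], so their combinations [a],
    [b], with coefficients 1/2 and -i/2 or i/2, are orthogonal with squared length [r / 2]. *)
Lemma conformal_lagrangian_projection : conformal_lagrangian P.
Proof.
have i2 : conjc 'i%C = - 'i%C :> C by apply: complex_ext; rewrite !ReImE /=; ring.
have half : conjc (2^-1) = 2^-1 :> C by rewrite conjcV conjc_nat.
have aE p : pa P p = 2^-1 *: (mpart ex P p *m P p - 'i%C *: (mpart ey P p *m P p)).
  by rewrite daE mdz_mpart -[_ * _]/(_ *m _) -scalemxAl mulmxBl -scalemxAl.
have bE p : pb P p = 2^-1 *: (mpart ex P p *m P p + 'i%C *: (mpart ey P p *m P p)).
  by rewrite dbE mdzb_mpart -[_ * _]/(_ *m _) -scalemxAl mulmxDl -scalemxAl.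
have key p : exists2 r : R, 0 < r & [/\ adj (pa P p) * pa P p = (r / 2)%:C *: P p,
    adj (pb P p) * pb P p = (r / 2)%:C *: P p & adj (pb P p) * pa P p = 0].
  have [r r0 H] := derivative_orthogonal p; exists r => //.
  have := H ex ex; have := H ex ey; have := H ey ex; have := H ey ey.
  rewrite aE bE.
  move: (mpart ex P p *m P p) (mpart ey P p *m P p) => px py.
  rewrite /ex /ey /= !(mulr0, mulr1, addr0, add0r) => hyy hxy hyx hxx.
  have z : (0%:C) = 0 :> C by [].
  rewrite z scale0r in hxy hyx.
  have hr : (r / 2)%:C = r%:C / 2 :> C by rewrite rmorphM fmorphV rmorph_nat.
  move: hr hxx hyy; move: (r%:C) ((r / 2)%:C) (P p) => s s2 P0 -> hxx hyy.
  split; rewrite -[_ * _]/(_ *m _) !adjZ !(adjD, adjN, adjZ) half i2;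
    rewrite -scalemxAl -scalemxAr !(mulmxDl, mulmxDr, mulNmx, mulmxN, =^~ scalemxAl, =^~ scalemxAr);
    rewrite hyy hxx hxy hyx !(scaler0, oppr0, addr0, add0r, subr0);
    apply/matrixP => i k; rewrite !mxE; move: (P0 i k) => x.
  - transitivity (2^-1 * 2^-1 * (s * x - 'i%C * 'i%C * s * x)); first by ring.
    by rewrite mulii; field.
  - transitivity (2^-1 * 2^-1 * (s * x - 'i%C * 'i%C * s * x)); first by ring.
    by rewrite mulii; field.
  - transitivity (2^-1 * 2^-1 * (s * x + 'i%C * 'i%C * s * x)); first by ring.
    by rewrite mulii; ring.
have trP p : \tr (P p) = 1 by rewrite /projection tr_line_proj ?vpick_neq0.
have lamE p r : adj (pa P p) * pa P p = (r / 2)%:C *: P p -> plam P p = (r / 2)%:C.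
  by move=> h; rewrite -plamE h mxtraceZ trP mulr1.
split=> // p.
- exact: unit_representative (vpick_neq0 _).
- have [r r0 [h1 _ _]] := key p; rewrite (lamE _ _ h1).
  by rewrite eq_complex negb_and /= gt_eqF // divr_gt0.
- by have [r r0 [h1 _ _]] := key p; rewrite (lamE _ _ h1).
- by have [r r0 [h1 h2 _]] := key p; rewrite (lamE _ _ h1).
- by have [r r0 []] := key p.
Qed.

Lemma harmonic_projection : minimal f -> is_harmonic P.
Proof.
move=> f_minimal.
have key p v : Im (\tr (adj (mpart v P p *m P p) *m (mdz (mdzb P) p *m P p))) = 0.
  have [j jp] := chart_dom_exists (realify f p).
  have [U [pU dU sU]] := sf jp.
  have [r r0 H] := f_conformal jp.
  (* For a conformal metric with factor [r], the vectors [k *: ex] and [k *: ey] are orthonormal. *)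
  pose k := (Num.sqrt r)^-1.
  have k2 : k * k * r = 1 by rewrite -invfM -expr2 sqr_sqrtr ?ltW // mulVf ?gt_eqF.
  have pin : p \in U by case: pU => _ ?; rewrite inE.
  set w := local_rep f j in sU.
  (* By the Lagrangian condition i times a tangent vector is normal; [harmonic_of_trace] asks for
     just these normals. *)
  have nJ : normal f j p (C2_J ('D_v w p)).
    move=> u.
    have := f_lagrangian jp v u; rewrite /kahler_form !fubini_studyE.
    by rewrite [in X in _ -> X](hermitian_fsC j) ReJ.
  have kA : k *: (1 : R^o) = k by exact: mulr1.
  have e1 : Defs.induced f j p (k *: ex) (k *: ex) = 1.
    by rewrite H /= kA scaler0 mulr0 addr0 mulrC.
  have e2 : Defs.induced f j p (k *: ey) (k *: ey) = 1.
    by rewrite H /= kA scaler0 mulr0 add0r mulrC.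
  have e3 : Defs.induced f j p (k *: ex) (k *: ey) = 0.
    by rewrite H /= !(scaler0, mulr0, mul0r, addr0).
  have := f_minimal p j jp _ _ _ e1 e2 e3 nJ.
  rewrite !(second_form_trace pU dU sU) (tangent_vec_J j) horizontalZ.
  rewrite -(projection_derivative pU dU sU).
  have mm u : mpart (k *: u) (mpart (k *: u) P) p = (k%:C * k%:C) *: mpart u (mpart u P) p.
    rewrite mpart_scale; last exact: msmooth_mpart.
    rewrite (_ : mpart (k *: u) P = fun y => k%:C *: mpart u P y); last first.
      by apply/funext => y; rewrite mpart_scale.
    by rewrite mpartZ ?scalerA //; exact: msmooth_mpart.
  rewrite !mm laplacian_mpart // {mm}.
  rewrite (trace_sum_Im _ _ _ _ (adjZ _ _)) => /eqP; rewrite mulf_eq0 => /orP[/eqP k0|/eqP //].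
  suff : (k * k) * 4 * r = 0 by rewrite mulrAC k2 mul1r => /eqP; rewrite pnatr_eq0.
  by rewrite k0 mul0r.
have aE p : pa P p + pb P p = mpart ex P p *m P p.
  rewrite daE dbE -![_ * P p]/(_ *m _) -mulmxDl; congr (_ *m _).
  rewrite mdz_mpart mdzb_mpart; move: (mpart ex P p) (mpart ey P p) => X Y.
  by apply/matrixP => i k; rewrite !mxE; move: (X i k) (Y i k) => x y; field.
have bE p : 'i%C *: (pa P p - pb P p) = mpart ey P p *m P p.
  rewrite daE dbE -![_ * P p]/(_ *m _) -mulmxBl scalemxAl; congr (_ *m _).
  rewrite mdz_mpart mdzb_mpart; move: (mpart ex P p) (mpart ey P p) => X Y.
  apply/matrixP => i k; rewrite !mxE; move: (X i k) (Y i k) => x y.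
  transitivity (- ('i%C * 'i%C) * y : C); first by field.
  by rewrite mulii opprK mul1r.
apply: (harmonic_of_trace conformal_lagrangian_projection) => p.
  rewrite aE -mulrA; exact: key.
rewrite bE -mulrA; exact: key.
Qed.
End SurfaceProjection.

(** * Injective entire functions *)

Section ComplexNorm.
Context {R : rcfType}.
Implicit Types (x y : R[i]).

Lemma normcE x : normc x = Num.sqrt (Re x ^+ 2 + Im x ^+ 2).
Proof. by case: x. Qed.
Lemma normc_ge0 x : 0 <= normc x.
Proof. by rewrite normcE sqrtr_ge0. Qed.
Lemma normc_sqr x : normc x ^+ 2 = Re x ^+ 2 + Im x ^+ 2.
Proof. by rewrite normcE sqr_sqrtr // addr_ge0 ?sqr_ge0. Qed.
Lemma normc_gt0 x : (0 < normc x) = (x != 0).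
Proof.
rewrite lt0r normc_ge0 andbT; congr (~~ _); apply/eqP/eqP; first exact: eq0_normc.
by move=> ->; rewrite normc0.
Qed.
Lemma Re_le_normc x : `|Re x| <= normc x.
Proof. by rewrite normcE -sqrtr_sqr ler_wsqrtr // lerDl sqr_ge0. Qed.
Lemma Im_le_normc x : `|Im x| <= normc x.
Proof. by rewrite normcE -sqrtr_sqr ler_wsqrtr // lerDr sqr_ge0. Qed.
Lemma normc_le_ReIm x : normc x <= `|Re x| + `|Im x|.
Proof.
rewrite -(@ler_pXn2r _ 2) ?nnegrE ?normc_ge0 ?addr_ge0 //.
rewrite normc_sqr -[Re x ^+ 2]real_normK ?num_real // -[Im x ^+ 2]real_normK ?num_real //.
by rewrite sqrrD -addrA lerD2l lerDr mulrn_wge0 // mulr_ge0.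
Qed.
Lemma normc_triangle x y : normc x <= normc (x - y) + normc y.
Proof. by rewrite -{1}[x](subrK y) le_normcD. Qed.
Lemma normc_sub x y : normc (x - y) <= normc x + normc y.
Proof. by rewrite -(normcN y) le_normcD. Qed.
End ComplexNorm.

Section Entire.
Context {R : realType}.
Local Notation C := R[i].

Lemma cder_cdiff (F : plane R -> C) p v d e : cdiff F p -> wder F p d e ->
  cder F p v (d * p2c v + e * conjc (p2c v)).
Proof.
move=> [f1 f2] [[x1 x2] [y1 y2]].
have key (f : plane R -> R) (a b : R) : differentiable f p -> is_derive p ex f a ->
   is_derive p ey f b -> is_derive p v f (v.1 * a + v.2 * b).
  move=> df [_ fa] [_ fb]; apply: DeriveDef; first exact: diff_derivable.
  rewrite deriveE // {1}(planeE v) linearD !linearZ /=.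
  by rewrite -!deriveE // fa fb.
split.
  by apply: (is_derive_eq (key _ _ _ f1 x1 y1)); rewrite !ReImE /=; ring.
by apply: (is_derive_eq (key _ _ _ f2 x2 y2)); rewrite !ReImE /=; ring.
Qed.

Lemma normc_p2c (v : plane R) : `|v| <= normc (p2c v).
Proof.
rewrite prod_normE ge_max.
by rewrite (Re_le_normc (p2c v)) (Im_le_normc (p2c v)).
Qed.

Lemma differentiable_lipschitz (f : plane R -> R) p : differentiable f p ->
  exists L r, [/\ 0 < r, 0 <= L & forall v, `|v| <= r -> `|f (v + p) - f p| <= L * `|v|].
Proof.
move=> df; have [k k0 Hk] := linear_lipschitz (diff_continuous df).
have := diff_locally df => /eqaddoP /(_ 1 ltr01) /nbhs_ballP [r /= r0 H].
exists (k + 1), (r / 2); split; [by rewrite divr_gt0|by rewrite addr_ge0 // ltW|].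
move=> v vr.
have vr' : `|v| < r by rewrite (le_lt_trans vr) // ltr_pdivrMr // ltr_pMr // ltr1n.
have := H v; rewrite -ball_normE /ball_ /= sub0r normrN => /(_ vr').
rewrite -![(_ - _) v]/(_ - _) /= mul1r opprD addrA => h.
rewrite mulrDl mul1r.
rewrite -[X in `|X|](subrK ('d f p v)) (le_trans (ler_normD _ _)) // addrC lerD //.
Qed.

Lemma cdiff_lipschitz (F : plane R -> C) p : cdiff F p ->
  exists L r, [/\ 0 < r, 0 < L & forall v, normc (p2c v) <= r ->
    normc (F (v + p) - F p) <= L * normc (p2c v)].
Proof.
move=> [/differentiable_lipschitz[L1 [r1 [r10 L10 H1]]]].
move=> /differentiable_lipschitz[L2 [r2 [r20 L20 H2]]].
exists (L1 + L2 + 1), (Num.min r1 r2); split.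
- by rewrite lt_min r10.
- by rewrite ltr_wpDl // addr_ge0.
move=> v; rewrite le_min => /andP[v1 v2].
have h1 := H1 v (le_trans (normc_p2c v) v1); have h2 := H2 v (le_trans (normc_p2c v) v2).
apply: le_trans (normc_le_ReIm _) _; rewrite !ReImE.
apply: le_trans (lerD h1 h2) _; rewrite -mulrDl.
apply: ler_pM; rewrite ?addr_ge0 // ?lerDl //.
exact: normc_p2c.
Qed.

Lemma wder_p2c (p : plane R) : wder (@p2c R) p 1 0.
Proof.
have key v : cder (@p2c R) p v (p2c v) := conj (fst_derive p v) (snd_derive p v).
split; apply: cder_eq (key _) _; first by rewrite addr0; exact: complex_ext.
by rewrite subr0 mulr1; exact: complex_ext.
Qed.

Definition ccont (F : plane R -> C) p :=
  {for p, continuous (fun y => Re (F y))} /\ {for p, continuous (fun y => Im (F y))}.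

Lemma cdiff_ccont F p : cdiff F p -> ccont F p.
Proof. by move=> [f1 f2]; split; exact: differentiable_continuous. Qed.

Lemma ccont_cst (c : C) p : ccont (fun=> c) p.
Proof. by split; exact: cvg_cst. Qed.

Lemma ccont_p2c p : ccont (@p2c R) p.
Proof. by split; [exact: cvg_fst|exact: cvg_snd]. Qed.

Lemma ccontD F G p : ccont F p -> ccont G p -> ccont (fun y => F y + G y) p.
Proof.
move=> [f1 f2] [g1 g2]; split.
  by rewrite (_ : (fun _ => _) = (fun y => Re (F y) + Re (G y))); [exact: cvgD|apply/funext => y; rewrite ReD].
by rewrite (_ : (fun _ => _) = (fun y => Im (F y) + Im (G y))); [exact: cvgD|apply/funext => y; rewrite ImD].
Qed.

Lemma ccontN F p : ccont F p -> ccont (fun y => - F y) p.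
Proof.
move=> [f1 f2]; split.
  by rewrite (_ : (fun _ => _) = (fun y => - Re (F y))); [exact: cvgN|apply/funext => y; rewrite ReN].
by rewrite (_ : (fun _ => _) = (fun y => - Im (F y))); [exact: cvgN|apply/funext => y; rewrite ImN].
Qed.

Lemma ccontM F G p : ccont F p -> ccont G p -> ccont (fun y => F y * G y) p.
Proof.
move=> [f1 f2] [g1 g2]; split.
  rewrite (_ : (fun _ => _) = (fun y => Re (F y) * Re (G y) - Im (F y) * Im (G y))).
    by apply: cvgB; apply: cvgM.
  by apply/funext => y; rewrite ReM.
rewrite (_ : (fun _ => _) = (fun y => Re (F y) * Im (G y) + Im (F y) * Re (G y))).
  by apply: cvgD; apply: cvgM.
by apply/funext => y; rewrite ImM.
Qed.

Lemma ccontV F p : F p != 0 -> ccont F p -> ccont (fun y => (F y)^-1) p.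
Proof.
move=> F0 [f1 f2]; have N0 := normsq_neq0 F0.
have cN : {for p, continuous (fun y => (Re (F y) * Re (F y) + Im (F y) * Im (F y))^-1)}.
  by apply: cvgV; [rewrite -!expr2|apply: cvgD; apply: cvgM].
split.
  rewrite (_ : (fun _ => _) = (fun y => Re (F y) * (Re (F y) * Re (F y) + Im (F y) * Im (F y))^-1)).
    exact: cvgM.
  by apply/funext => y; rewrite ReV -!expr2.
rewrite (_ : (fun _ => _) = (fun y => - (Im (F y) * (Re (F y) * Re (F y) + Im (F y) * Im (F y))^-1))).
  by apply: cvgN; apply: cvgM.
by apply/funext => y; rewrite ImV -!expr2.
Qed.

Section Affine.
Variables (h h1 h2 : plane R -> C) (p0 : plane R).
Hypotheses (dh : forall p, cdiff h p) (wh : forall p, wder h p (h1 p) 0)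
  (dh1 : forall p, cdiff h1 p) (wh1 : forall p, wder h1 p (h2 p) 0)
  (h1_neq0 : h1 p0 != 0)
  (h_inj : forall p, p != p0 -> h p != h p0)
  (h_proper : forall M, exists S, forall p, S <= sqdist p0 p -> M <= normc (h p - h p0)).

Let a := h1 p0.
Let d p := h p - h p0.
Let z p := p2c p - p2c p0.

Let dE p : d p = h p - h p0. Proof. by []. Qed.

Let sq_z p : normc (z p) ^+ 2 = sqdist p0 p.
Proof. by rewrite normc_sqr /z !ReImE. Qed.

Let z_neq0 p : p != p0 -> z p != 0.
Proof.
by rewrite -sqdist_gt0 -sq_z => h'; apply/eqP => z0; move: h'; rewrite z0 normc0 expr0n ltxx.
Qed.

Let d_neq0 p : p != p0 -> d p != 0.
Proof. by move=> /h_inj; rewrite subr_eq0. Qed.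

Let a0 : 0 < normc a. Proof. by rewrite normc_gt0. Qed.

(** The function [h - a z] has derivative [h1 - a], which is O(|z|) since [h1] is differentiable at
    [p0]; the mean value theorem on the segment gains another factor |z|. *)
Lemma remainder_bound : exists K r, [/\ 0 < r, 0 < K & forall p, normc (z p) <= r ->
  normc (d p - a * z p) <= K * normc (z p) ^+ 2].
Proof.
have [L [r [r0 L0 H]]] := cdiff_lipschitz (dh1 p0).
(* The factor 2 accounts for real and imaginary parts, which have separate intermediate points. *)
exists (2 * L), r; split=> //; first by rewrite mulr_gt0.
move=> p pr.
pose F q := h q - a * p2c q.
pose v : plane R := p - p0.
have vz : p2c v = z p.
  by apply: complex_ext; rewrite /z !ReImE.
have dF q : cder F q v ((h1 q - a) * z p).
  have w : wder F q (h1 q - (0 * p2c q + a * 1)) (0 - (0 * p2c q + a * 0)).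
    exact: wderB (wh q) (wderM (wder_cst a q) (wder_p2c q)).
  have cF := cder_cdiff v (dh q) (wh q).
  have cz := cderM (cder_cst a q v) (conj (fst_derive q v) (snd_derive q v) : cder (@p2c R) q v (p2c v)).
  apply: cder_eq (cderD cF (cderN cz)) _.
  by rewrite vz; ring.
have bound c : `|c| <= 1 -> normc ((h1 (c *: v + p0) - a) * z p) <= L * normc (z p) ^+ 2.
  move=> c1; have cz : normc (p2c (c *: v)) <= normc (z p).
    rewrite (_ : p2c (c *: v) = c%:C * z p); last first.
      by rewrite -vz; apply: complex_ext; rewrite !ReImE /= mul0r ?subr0 ?addr0.
    by rewrite normcM /= expr0n /= addr0 sqrtr_sqr ler_piMl ?normc_ge0.
  rewrite normcM expr2 mulrA ler_pM ?normc_ge0 //.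
  apply: le_trans (H _ (le_trans cz pr)) _.
  by rewrite ler_pM2l.
have Fd : F p - F p0 = d p - a * z p by rewrite /F /d /z; ring.
have vp : 1 *: v + p0 = p by rewrite scale1r subrK.
have [c1 c1b E1] := mvt_line p0 1 (fun q => @ex_derive _ _ _ _ _ _ _ (dF q).1).
have [c2 c2b E2] := mvt_line p0 1 (fun q => @ex_derive _ _ _ _ _ _ _ (dF q).2).
have {}E1 : Re (d p - a * z p) = Re ((h1 (c1 *: v + p0) - a) * z p).
  by rewrite -Fd ReD ReN -{1}vp E1 mul1r; have [[_ ->] _] := dF (c1 *: v + p0).
have {}E2 : Im (d p - a * z p) = Im ((h1 (c2 *: v + p0) - a) * z p).
  by rewrite -Fd ImD ImN -{1}vp E2 mul1r; have [_ [_ ->]] := dF (c2 *: v + p0).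
rewrite normr1 in c1b c2b.
apply: le_trans (normc_le_ReIm _) _; rewrite E1 E2 -mulrA mulr_natl mulr2n lerD //.
  exact: le_trans (Re_le_normc _) (bound _ c1b).
exact: le_trans (Im_le_normc _) (bound _ c2b).
Qed.

Let dV p := (d p)^-1.
Let zV p := (a * z p)^-1.
(** Both terms have the same simple pole at [p0]. [G1] and [G2] are the first and second
    z-derivatives of [G]. *)
Let G p := dV p - zV p.
Let G1 p := - (h1 p * (dV p * dV p)) + a * (zV p * zV p).
Let dV1 p := - (h1 p * (dV p * dV p)).
Let zV1 p := - (a * (zV p * zV p)).
Let G2 p := - (h2 p * (dV p * dV p) + h1 p * (dV1 p * dV p + dV p * dV1 p))
  + a * (zV1 p * zV p + zV p * zV1 p).

Let az_neq0 p : p != p0 -> a * z p != 0.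
Proof. by move=> pp; rewrite mulf_neq0 // z_neq0. Qed.

Let wdV p : p != p0 -> wder dV p (dV1 p) 0.
Proof.
move=> pp; have w : wder d p (h1 p - 0) (0 - 0) := wderB (wh p) (wder_cst (h p0) p).
by apply: (wder_eq (wderV (d_neq0 pp) w)); rewrite ?subr0 // mul0r oppr0.
Qed.

Let wzV p : p != p0 -> wder zV p (zV1 p) 0.
Proof.
move=> pp.
have w : wder (fun q => a * z q) p (0 * z p + a * (1 - 0)) (0 * z p + a * (0 - 0)).
  exact: wderM (wder_cst a p) (wderB (wder_p2c p) (wder_cst (p2c p0) p)).
apply: (wder_eq (wderV (az_neq0 pp) w)); first by rewrite mul0r add0r subr0 mulr1.
by rewrite mul0r add0r subr0 mulr0 mul0r oppr0.
Qed.

Let wG p : p != p0 -> wder G p (G1 p) 0.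
Proof.
by move=> pp; apply: (wder_eq (wderB (wdV pp) (wzV pp))); rewrite ?subr0 // opprK.
Qed.

Let wG1 p : p != p0 -> wder G1 p (G2 p) 0.
Proof.
move=> pp; have w1 := wdV pp; have w2 := wzV pp.
apply: (wder_eq (wderD (wderN (wderM (wh1 p) (wderM w1 w1)))
  (wderM (wder_cst a p) (wderM w2 w2)))).
  by rewrite mul0r add0r.
by rewrite !(mul0r, mulr0, add0r, addr0, oppr0).
Qed.

Let G_near : exists2 r, 0 < r & exists B, forall p, 0 < sqdist p0 p <= r -> normc (G p) <= B.
Proof.
have [K [r [r0 K0 H]]] := remainder_bound.
(* This radius gives [K |z|^2 <= |a| |z| / 2], hence [|d| >= |a| |z| / 2], and then
   [K |z|^2 / (|d| |a z|)] is at most [2 K / |a|^2]. *)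
pose t := Num.min r (normc a / (2 * K)).
have t0 : 0 < t by rewrite lt_min r0 divr_gt0 // mulr_gt0.
exists (t ^+ 2); first by rewrite exprn_gt0.
exists (2 * K / normc a ^+ 2) => p; rewrite sqdist_gt0 => /andP[pp].
rewrite -sq_z ler_pXn2r ?nnegrE ?normc_ge0 ?(ltW t0) // le_min => /andP[zr zK].
have z0 : 0 < normc (z p) by rewrite normc_gt0 z_neq0.
have Hp := H p zr.
have d_lb : normc a * normc (z p) / 2 <= normc (d p).
  have := normc_triangle (a * z p) (d p).
  have -> : normc (a * z p - d p) = normc (d p - a * z p) by rewrite -normcN opprB.
  rewrite normcM.
  have : K * normc (z p) ^+ 2 <= normc a * normc (z p) / 2.
    move: zK; rewrite ler_pdivlMr ?mulr_gt0 // => /(ler_wpM2l (ltW z0)).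
    by move: (normc (z p)) (normc a) => x y; lra.
  move: Hp; move: (normc (d p - _)) (K * _) (normc a * _) (normc (d p)) => x1 x2 x3 x4.
  by lra.
have -> : G p = - ((d p - a * z p) / (d p * (a * z p))).
  have az := az_neq0 pp; have dn := d_neq0 pp.
  rewrite /G /dV /zV; move: az dn; move: (a * z p) (d p) => u v u0 v0.
  by field; rewrite u0 v0.
rewrite normcN normcM normcV ler_pdivrMr; last first.
  by rewrite normc_gt0 mulf_neq0 ?d_neq0 ?az_neq0.
apply: le_trans Hp _; rewrite !normcM.
have -> : K * normc (z p) ^+ 2 = 2 * K / normc a ^+ 2 *
   (normc a * normc (z p) / 2 * (normc a * normc (z p))).
  by field; rewrite lt0r_neq0.
rewrite ler_pM2l ?divr_gt0 ?mulr_gt0 ?exprn_gt0 // ler_pM2r ?mulr_gt0 //.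
Qed.

Let G_inf e : 0 < e -> exists S, forall p, S <= sqdist p0 p -> normc (G p) <= e.
Proof.
move=> e0; pose M := 2 / e; have M0 : 0 < M by rewrite divr_gt0.
have [S1 H1] := h_proper M.
pose S := Num.max S1 ((M / normc a) ^+ 2).
have S0 : 0 < S by rewrite lt_max exprn_gt0 ?orbT // divr_gt0.
exists S => p Sp.
have pp : p != p0 by rewrite -sqdist_gt0 (lt_le_trans S0).
have h1' : M <= normc (d p) by apply: H1; apply: le_trans Sp; rewrite le_max lexx.
have h2' : M <= normc (a * z p).
  have Ma : 0 <= M / normc a by rewrite divr_ge0 // ltW.
  rewrite normcM mulrC -ler_pdivrMr // -(@ler_pXn2r _ 2) ?nnegrE ?normc_ge0 //.
  by rewrite sq_z (le_trans _ Sp) // /S le_max lexx orbT.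
apply: le_trans (normc_sub _ _) _; rewrite !normcV.
have eM : e = M^-1 + M^-1.
  by rewrite /M; field; rewrite lt0r_neq0.
by rewrite eM lerD // lef_pV2 ?posrE // (lt_le_trans M0).
Qed.

Let Re_G_le0 (k : C) p : p != p0 -> Re (k * G p) <= 0.
Proof.
have dc F q v e : cder F q v e -> cder (fun q => k * F q) q v (k * e).
  by move=> cF; apply: cder_eq (cderM (cder_cst k q v) cF) _; rewrite mul0r add0r.
(* Since [G] and [G1] have zero conjugate derivative, d/dx acts as d/dz and d/dy as i times it; the
   second derivatives in x and y are therefore opposite. *)
apply: (@punctured_max _ p0 (fun p => Re (k * G p)) (fun p => Re (k * G1 p))
  (fun p => Re ('i%C * (k * G1 p))) (fun p => Re (k * G2 p))).
- move=> q qp; have [x1 y1] := wG qp; have [x2 y2] := wG1 qp.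
  rewrite !addr0 in x1 x2; rewrite !subr0 in y1 y2; split.
  + by have [] := dc _ _ _ _ _ x1.
  + by have [+ _] := dc _ _ _ _ _ y1; rewrite mulrCA.
  + by have [] := dc _ _ _ _ _ x2.
  + have [yy _] := cderM (cder_cst 'i%C q ey) (dc _ _ _ _ _ y2).
    apply: (is_derive_eq yy); rewrite -ReN; congr Re.
    move: (G2 q) => g; rewrite mul0r add0r (mulrCA k).
    by apply: etrans (mulrA _ _ _) _; rewrite mulii mulN1r.
- move=> q qp.
  have cd : ccont d q by apply: ccontD; [exact: cdiff_ccont|exact/ccontN/ccont_cst].
  have cz : ccont (fun p => a * z p) q.
    apply: ccontM; first exact: ccont_cst.
    by apply: ccontD; [exact: ccont_p2c|exact/ccontN/ccont_cst].
  have [] // : ccont (fun p => k * G p) q.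
  apply: ccontM; first exact: ccont_cst.
  apply: ccontD; first by apply: ccontV => //; exact: d_neq0.
  by apply: ccontN; apply: ccontV => //; exact: az_neq0.
- have [r r0 [B HB]] := G_near; exists r => //; exists (normc k * B) => q qr.
  apply: le_trans (ler_norm _) _; apply: le_trans (Re_le_normc _) _.
  by rewrite normcM ler_wpM2l ?normc_ge0 // HB.
- move=> e e0; have kp : 0 < normc k + 1 by rewrite ltr_wpDl // normc_ge0.
  have [S HS] := G_inf (divr_gt0 e0 kp); exists S => q qS.
  apply: le_trans (ler_norm _) _; apply: le_trans (Re_le_normc _) _.
  rewrite normcM; apply: le_trans (ler_wpM2l (normc_ge0 k) (HS _ qS)) _.
  by rewrite mulrA ler_pdivrMr // mulrC ler_pM2l // lerDl.
Qed.

(* The difference [G] of [1 / (h - h p0)] and [1 / (a (p - p0))], [a = h1 p0], is bounded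
   near [p0] and tends to [0] at infinity, so that the maximum principle for [Re (k G)] gives
   [G = 0]. *)
Lemma proper_injective_affine p : h p = h p0 + h1 p0 * (p2c p - p2c p0).
Proof.
have [->|pp] := eqVneq p p0; first by rewrite subrr mulr0 addr0.
have key (g : C) : Re (conjc g * g) <= 0 -> g = 0.
  rewrite !ReImE mulNr opprK -!expr2 -normc_sqr => h'; apply: eq0_normc.
  by apply/eqP; rewrite -sqrf_eq0 eq_le h' sqr_ge0.
(* Taking [k] to be the conjugate of [G p] turns the real part into [|G p|^2]. *)
have /key /eqP := Re_G_le0 (conjc (G p)) pp; rewrite subr_eq0 => /eqP /invr_inj E.
by apply/eqP; rewrite addrC -subr_eq; apply/eqP.
Qed.

End Affine.
End Entire.

(** * Symmetries *)

Section Holomorphic.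
Context {R : realType}.
Local Notation C := R[i].

(** The difference quotient is unpacked into a first-order expansion with real constants; radii of
    balls in [C^o] are complex numbers, positive and hence real. *)
Lemma holomorphic_remainder (g : C -> C) z : holomorphic g ->
  exists c : C, forall e : R, 0 < e -> exists2 d : R, 0 < d &
    forall w, normc w <= d -> normc (g (w + z) - (g z + c * w)) <= e * normc w.
Proof.
move=> /(_ z) /cvg_ex [/= c H]; exists c => e e0.
have e0' : 0 < e%:C by rewrite ltcR.
move/cvgrPdist_le : H => /(_ _ e0').
move=> /nbhs_ballP [/= r r0 Hr].
have [r1 r2] : 0 < Re r /\ Im r = 0.
  by move: r0; rewrite ltcE /= => /andP[/eqP -> ->].
exists (Re r / 2); first by rewrite divr_gt0.
move=> w wr.
have [->|w0] := eqVneq w 0.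
  by rewrite add0r mulr0 addr0 subrr !normc0 mulr0.
have wr' : ball (0 : C^o) r (w : C^o).
  rewrite /ball /= sub0r normrN normc_def -normcE ltcE /= r2 eqxx /=.
  by rewrite (le_lt_trans wr) // ltr_pdivrMr // ltr_pMr // ltr1n.
have := Hr w wr' w0; rewrite normc_def -normcE lecR.
rewrite /GRing.scale /= mulr1 => h.
have -> : g (w + z) - (g z + c * w) = - w * (c - w^-1 * (g (w + z) - g z)).
  by field.
rewrite normcM normcN mulrC.
by apply: ler_wpM2r => //; exact: normc_ge0.
Qed.

Lemma holomorphic_cdiff (g : C -> C) : holomorphic g ->
  exists g' : plane R -> C, forall p, cdiff (fun q => g (p2c q)) p /\
    wder (fun q => g (p2c q)) p (g' p) 0.
Proof.
move=> hg; have /choice[g' Hg'] z := holomorphic_remainder z hg.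
exists (fun p => g' (p2c p)) => p; set c := g' (p2c p).
(* [r] stands for [Re] or [Im]: only real linearity and the bound by the modulus matter. *)
have key (r : C -> R) : (forall k x y, r (k%:C * x + y) = k * r x + r y) ->
    (forall x, `|r x| <= normc x) ->
    is_diff p (fun q => r (g (p2c q))) (fun v => r (c * p2c v)).
  move=> rl rn; pose L (v : plane R) : R := r (c * p2c v).
  have rB x y : r (x - y) = r x - r y.
    have E := rl (-1) y x; rewrite mulN1r in E.
    have -> : x - y = (-1)%:C * y + x by rewrite rmorphN rmorph1 mulN1r addrC.
    by rewrite E addrC.
  have linL : linear L.
    move=> k u v; rewrite /L -[RHS]rl; congr r.
    by apply: complex_ext; rewrite !ReImE /= /GRing.scale /=; ring.
  pose pL := GRing.isLinear.Build _ _ _ _ _ linL.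
  pose lL : {linear plane R -> R} := HB.pack L pL.
  have LE : (lL : plane R -> R) = fun v => v.1 * lL ex + v.2 * lL ey.
    by apply/funext => v; rewrite {1}(planeE v) linearD !linearZ.
  have cL : continuous lL.
    move=> v; rewrite /continuous_at LE; apply: cvgD.
      by apply: cvgM; [exact: cvg_fst|exact: cvg_cst].
    by apply: cvgM; [exact: cvg_snd|exact: cvg_cst].
  have H : (fun q => r (g (p2c q))) \o shift p = cst (r (g (p2c p))) + lL +o_ 0 id.
    apply/eqaddoP => _/posnumP[e].
    have e2 : 0 < e%:num / 2 :> R by rewrite divr_gt0.
    have [d d0 Hd] := Hg' (p2c p) _ e2.
    near=> v; rewrite !fctE /=.
    have nv : normc (p2c v) <= 2 * `|v|.
      apply: le_trans (normc_le_ReIm _) _; rewrite mulr_natl mulr2n.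
      by rewrite prod_normE lerD // le_max lexx ?orbT.
    have vd : normc (p2c v) <= d.
      apply: le_trans nv _; rewrite -ler_pdivlMl //.
      near: v; apply: (@cvgr0_norm_le _ _ _ _ _ id); first exact: cvg_id.
      by rewrite mulr_gt0.
    have := Hd _ vd; rewrite -/c => h.
    have -> : r (g (p2c (v + p))) - (r (g (p2c p)) + lL v) =
       r (g (p2c v + p2c p) - (g (p2c p) + c * p2c v)).
      have rD x y : r (x + y) = r x + r y.
        by have := rl 1 x y; rewrite !mul1r.
      by rewrite rB rD.
    apply: le_trans (rn _) _; apply: le_trans h _.
    by rewrite -mulrA ler_pM2l // mulrC ler_pdivrMr // mulrC.
  have dE := diff_unique cL H.
  apply: DiffDef; last by rewrite dE.
  by apply/diff_locallyP; rewrite dE.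
have kr := key (@Re R) _ (@Re_le_normc R).
have ki := key (@Im R) _ (@Im_le_normc R).
have {}kr : is_diff p (fun q => Re (g (p2c q))) (fun v => Re (c * p2c v)).
  by apply: kr => k x y; rewrite !ReImE /= mul0r subr0.
have {}ki : is_diff p (fun q => Im (g (p2c q))) (fun v => Im (c * p2c v)).
  by apply: ki => k x y; rewrite !ReImE /= mul0r addr0.
have [dr vr] := kr; have [di vi] := ki.
have cd v : cder (fun q => g (p2c q)) p v (c * p2c v).
  split; apply: DeriveDef; try exact: diff_derivable.
    by rewrite deriveE // vr.
  by rewrite deriveE // vi.
split; first by split.
split; apply: cder_eq (cd _) _.
  by rewrite addr0 -[RHS]mulr1; congr (_ * _); exact: complex_ext.
by rewrite subr0 mulrC; congr (_ * _); exact: complex_ext.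
Unshelve. all: by end_near. Qed.

End Holomorphic.

Section CDiff.
Context {R : realType}.
Local Notation C := R[i].
Implicit Types (F G : plane R -> C) (p : plane R).

Lemma cdiff_cst (c : C) p : cdiff (fun=> c) p.
Proof. by split; exact: differentiable_cst. Qed.

Lemma cdiffD F G p : cdiff F p -> cdiff G p -> cdiff (fun y => F y + G y) p.
Proof.
move=> [f1 f2] [g1 g2]; split.
  by rewrite (_ : (fun _ => _) = (fun y => Re (F y)) \+ (fun y => Re (G y)));
    [exact: differentiableD|apply/funext => y; rewrite ReD].
by rewrite (_ : (fun _ => _) = (fun y => Im (F y)) \+ (fun y => Im (G y)));
    [exact: differentiableD|apply/funext => y; rewrite ImD].
Qed.

Lemma cdiffM F G p : cdiff F p -> cdiff G p -> cdiff (fun y => F y * G y) p.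
Proof.
move=> [f1 f2] [g1 g2]; split.
  rewrite (_ : (fun _ => _) = (fun y => Re (F y)) * (fun y => Re (G y)) -
     (fun y => Im (F y)) * (fun y => Im (G y))).
    by apply: differentiableB; apply: differentiableM.
  by apply/funext => y; rewrite ReM.
rewrite (_ : (fun _ => _) = (fun y => Re (F y)) * (fun y => Im (G y)) +
     (fun y => Im (F y)) * (fun y => Re (G y))).
  by apply: differentiableD; apply: differentiableM.
by apply/funext => y; rewrite ImM.
Qed.

Lemma cdiffJ F p : cdiff F p -> cdiff (fun y => conjc (F y)) p.
Proof.
move=> [f1 f2]; split.
  by rewrite (_ : (fun _ => _) = (fun y => Re (F y))); [|apply/funext => y; rewrite ReJ].
rewrite (_ : (fun _ => _) = - (fun y => Im (F y))); first exact: differentiableN.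
by apply/funext => y; rewrite ImJ.
Qed.

Lemma cdiffV F p : F p != 0 -> cdiff F p -> cdiff (fun y => (F y)^-1) p.
Proof.
move=> F0 [f1 f2]; have N0 := normsq_neq0 F0.
pose N : plane R -> R := (fun y => Re (F y)) * (fun y => Re (F y)) +
     (fun y => Im (F y)) * (fun y => Im (F y)).
have dN : differentiable (fun y => (N y)^-1) p.
  apply: differentiableV; last by rewrite /N -![(_ + _) p]/(_ * _ + _ * _) -!expr2.
  by apply: differentiableD; apply: differentiableM.
split.
  rewrite (_ : (fun _ => _) = (fun y => Re (F y)) * (fun y => (N y)^-1)).
    exact: differentiableM.
  by apply/funext => y; rewrite ReV !expr2.
rewrite (_ : (fun _ => _) = - ((fun y => Im (F y)) * (fun y => (N y)^-1))).
  by apply: differentiableN; exact: differentiableM.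
by apply/funext => y; rewrite ImV !expr2.
Qed.

Lemma cdiff_sum (I : Type) (r : seq I) (F : I -> plane R -> C) p :
  (forall i, cdiff (F i) p) -> cdiff (fun y => \sum_(i <- r) F i y) p.
Proof.
move=> H; elim: r => [|i r IH].
  by rewrite (_ : (fun _ => _) = fun=> 0); [exact: cdiff_cst|apply/funext => y; rewrite big_nil].
rewrite (_ : (fun _ => _) = fun y => F i y + \sum_(i <- r) F i y).
  exact: cdiffD.
by apply/funext => y; rewrite big_cons.
Qed.

Definition mcdiff m n (M : plane R -> 'M[C]_(m, n)) p :=
  forall i j, cdiff (fun q => M q i j) p.

Lemma mcdiff_mul m n k (M : plane R -> 'M[C]_(m, n)) (N : plane R -> 'M[C]_(n, k)) p :
  mcdiff M p -> mcdiff N p -> mcdiff (fun q => M q *m N q) p.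
Proof.
move=> dM dN i j; rewrite (_ : (fun _ => _) = fun q => \sum_l M q i l * N q l j).
  by apply: cdiff_sum => l; exact: cdiffM.
by apply/funext => q; rewrite mxE.
Qed.

Lemma mcdiff_cst m n (M : 'M[C]_(m, n)) p : mcdiff (fun=> M) p.
Proof. by move=> i j; exact: cdiff_cst. Qed.

Lemma mcdiff_adj m n (M : plane R -> 'M[C]_(m, n)) p :
  mcdiff M p -> mcdiff (fun q => adj (M q)) p.
Proof.
move=> dM i j; rewrite (_ : (fun _ => _) = fun q => conjc (M q j i)); first exact: cdiffJ.
by apply/funext => q; rewrite adjE.
Qed.

Lemma cdiff_wder F p : cdiff F p -> exists d e, wder F p d e.
Proof.
move=> [f1 f2].
have c v : cder F p v (cpart v F p).
  by split; apply: derivableP; exact: diff_derivable.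
exists (dz F p), (dzb F p); have n2 : 2 != 0 :> C by rewrite pnatr_eq0.
split.
  apply: cder_eq (c ex) _; rewrite /dz /dzb.
  by move: (cpart ex F p) (cpart ey F p) => u v; field.
apply: cder_eq (c ey) _; rewrite /dz /dzb.
move: (cpart ey F p) (cpart ex F p) => u v.
transitivity (- ('i%C * 'i%C) * u); last by field.
by rewrite mulii opprK mul1r.
Qed.

Lemma mwder_comp m n (M : plane R -> 'M[C]_(m, n)) (h : plane R -> C) p d :
  msmooth M -> cdiff h p -> wder h p d 0 ->
  mwder (fun y => M (c2p (h y))) p (d *: mdz M (c2p (h p))) (conjc d *: mdzb M (c2p (h p))).
Proof.
move=> sM dh wh i j; rewrite !mxE mdzE mdzbE.
have w := wder_comp (sM i j) dh wh.
by apply: (wder_eq w); rewrite ?conjc0 !mulr0 ?addr0 ?add0r mulrC.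
Qed.

End CDiff.

Lemma mxtrace_mulrC (K : comPzRingType) n (M N : 'M[K]_n.+1) : \tr (M * N) = \tr (N * M).
Proof. exact: mxtrace_mulC. Qed.

Section Symmetry.
Context {R : realType}.
Local Notation C := R[i].
Local Notation mat := 'M[C]_3.
Variable P : plane R -> mat.
Hypotheses (cl : conformal_lagrangian P) (P_harmonic : is_harmonic P).
Local Notation a := (pa P).
Local Notation b := (pb P).
Local Notation lam := (plam P).
Let P_smooth := cl_smooth cl.
Let lam_neq0 := cl_lam cl.

Variables (g k : C -> C) (A : mat).
Hypotheses (gK : cancel g k) (kK : cancel k g) (hg : holomorphic g) (hk : holomorphic k)
  (AA : A * adj A = 1) (gP : forall z, P (c2p (g z)) = A * P (c2p z) * adj A).

Let h (p : plane R) := g (p2c p).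

Let AA' : adj A * A = 1.
Proof. exact: mulmx1C. Qed.

Let hP p : P (c2p (h p)) = A * P p * adj A.
Proof. by rewrite /h gP p2cK. Qed.

Section Derivative.
Variable h1 : plane R -> C.
Hypotheses (dh : forall p, cdiff h p) (wh : forall p, wder h p (h1 p) 0).

(** This is the z-derivative of [hP], multiplied by the projection; [h1] alone appears because the
    conjugate derivative of [h] is zero. *)
Lemma symmetry_a p : h1 p *: a (c2p (h p)) = A * a p * adj A.
Proof.
have w := mwder_comp P_smooth (dh p) (wh p).
have w' := mwderM (mwderM (mwder_cst A p) (mwderE p P_smooth)) (mwder_cst (adj A) p).
have [e _] := mwder_unique (mwder_ext hP w) w'.
rewrite mul0r add0r mulr0 addr0 in e.
rewrite !daE scalerAl e hP !mulrA -[A * _ * adj A * A]mulrA AA' mulr1.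
by rewrite -[X in X * adj A]mulrA.
Qed.

Lemma symmetry_lam p : h1 p * conjc (h1 p) * lam (c2p (h p)) = lam p.
Proof.
have := congr1 (fun M => \tr (adj M * M)) (symmetry_a p).
rewrite adjZ -scalerAl -scalerAr scalerA mxtraceZ plamE [conjc _ * _]mulrC => ->.
rewrite !adjM adjK -!mulrA (mulrA (adj A) A) AA' mul1r mxtrace_mulrC.
by rewrite -!mulrA AA' mulr1 plamE.
Qed.

Lemma h1_neq0 p : h1 p != 0.
Proof.
apply/eqP => h0; have := symmetry_lam p; rewrite h0 !mul0r => /esym /eqP.
by rewrite (negPf (lam_neq0 p)).
Qed.

(** Solving [symmetry_a] for [h1] expresses it through smooth functions and [h]; the
    differentiability of [h1] comes from here. *)
Let h1E : h1 = fun p => \tr (adj (a (c2p (h p))) * (A * a p * adj A)) / lam (c2p (h p)).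
Proof.
apply/funext => p; rewrite -symmetry_a -scalerAr mxtraceZ plamE.
by rewrite mulfK.
Qed.

Lemma lamE' : lam = fun p => \tr (adj (a p) * a p).
Proof. by apply/funext => p; rewrite plamE. Qed.

Lemma lam_smooth : csmooth lam.
Proof.
rewrite lamE'; apply: csmooth_tr; apply: msmoothM; first apply: msmooth_adj;
  exact: a_smooth cl.
Qed.

Lemma cdiff_h1 p : cdiff h1 p.
Proof.
have da : mcdiff (fun q => a (c2p (h q))) p.
  by move=> i j; apply: (cdiff_comp (a_smooth cl i j)).
rewrite h1E; apply: cdiffM.
  apply: cdiff_sum => i; apply: (mcdiff_mul (mcdiff_adj da)).
  apply: mcdiff_mul; last exact: mcdiff_cst.
  apply: mcdiff_mul; first exact: mcdiff_cst.
  by move=> k' l; exact: csmooth_cdiff (a_smooth cl k' l).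
apply: cdiffV; first exact: lam_neq0.
exact: cdiff_comp lam_smooth (dh p).
Qed.

(** By [dza] the conjugate derivative of [a] is built from [a] and [P], so the symmetry multiplies
    it by [|h1|^2]. In the conjugate derivative of [symmetry_a] these terms cancel, and the
    derivative of [h1] times [a] is all that remains. *)
Lemma holomorphic_h1 p : exists d, wder h1 p d 0.
Proof.
have [d [e w]] := cdiff_wder (cdiff_h1 p).
suff e0 : e = 0 by exists d; rewrite -[X in wder _ _ _ X]e0.
have wa := mwder_comp (a_smooth cl) (dh p) (wh p).
have w1 := mwderZ w wa.
have w2 := mwderM (mwderM (mwder_cst A p) (mwderE p (a_smooth cl))) (mwder_cst (adj A) p).
have [_ E] := mwder_unique (mwder_ext symmetry_a w1) w2.
move: E; rewrite !(dza cl P_harmonic).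
rewrite mul0r add0r mulr0 addr0.
have -> : A * (a p * adj (a p) - lam p *: P p) * adj A =
    h1 p *: (conjc (h1 p) *: (a (c2p (h p)) * adj (a (c2p (h p)))
      - lam (c2p (h p)) *: P (c2p (h p)))).
  have Ea := symmetry_a p.
  have Eas : conjc (h1 p) *: adj (a (c2p (h p))) = A * adj (a p) * adj A.
    by rewrite -adjZ Ea !adjM adjK mulrA.
  rewrite !scalerBr !scalerA symmetry_lam hP.
  have -> : (h1 p * conjc (h1 p)) *: (a (c2p (h p)) * adj (a (c2p (h p)))) =
    (h1 p *: a (c2p (h p))) * (conjc (h1 p) *: adj (a (c2p (h p)))).
    by rewrite -scalerAl -scalerAr scalerA.
  rewrite Ea Eas mulrBr mulrBl -scalerAr -scalerAl; congr (_ - _).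
  by rewrite !mulrA -[A * a p * adj A * A]mulrA AA' mulr1.
rewrite -[RHS]add0r => /addIr /(congr1 (fun M => \tr (adj (a (c2p (h p))) * M))).
rewrite -scalerAr mxtraceZ plamE mulr0 mxtrace0 => /eqP.
by rewrite mulf_eq0 (negPf (lam_neq0 _)) orbF => /eqP.
Qed.

Hypothesis dk : forall p, ccont (fun q => k (p2c q)) p.

Lemma symmetry_affine p0 p : h p = h p0 + h1 p0 * (p2c p - p2c p0).
Proof.
have /choice[h2 wh1] := holomorphic_h1.
apply: (proper_injective_affine dh wh cdiff_h1 wh1 (h1_neq0 p0)).
- move=> q; apply: contra_neq; rewrite /h => /(can_inj gK).
  by move=> /(congr1 (@c2p R)); rewrite !p2cK.
(* Properness: a point whose image lies in the closed disc of radius [M] about [h p0] belongs to the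
   image of that compact disc under the continuous inverse [k], so its distance to [p0] is
   bounded. *)
move=> M; pose q0 := c2p (h p0).
have cK : compact [set q | 0 <= sqdist q0 q <= M ^+ 2] := @annulus_compact _ q0 _ _.
have K0 : [set q | 0 <= sqdist q0 q <= M ^+ 2] !=set0.
  by exists q0; rewrite /= /sqdist !subrr expr0n /= addr0 lexx sqr_ge0.
pose w q := sqdist p0 (c2p (k (p2c q))).
have cw : {within [set q | 0 <= sqdist q0 q <= M ^+ 2], continuous w}.
  apply: continuous_subspaceT => q; have [c1 c2] := dk q.
  apply: cvgD; apply: cvgM; apply: cvgB; by [exact: c1|exact: c2|exact: cvg_cst].
have [q1 _ H] := compact_EVT_max K0 cK cw.
exists (w q1 + 1) => q qS; rewrite leNgt; apply/negP => hM.
have qM : sqdist q0 (c2p (h q)) <= M ^+ 2.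
  have -> : sqdist q0 (c2p (h q)) = normc (h q - h p0) ^+ 2 by rewrite normc_sqr !ReImE.
  by rewrite ler_pXn2r ?nnegrE ?normc_ge0 ?(ltW hM) // (le_trans (normc_ge0 _) (ltW hM)).
have := H (c2p (h q)); rewrite inE /= qM andbT => /(_ _).
rewrite /w c2pK /h gK p2cK => h'.
have : sqdist p0 q <= w q1.
  by apply: h'; rewrite /sqdist addr_ge0 ?sqr_ge0.
by rewrite leNgt (lt_le_trans _ qS) // ltrDl.
Qed.

Lemma symmetry_isometry p : lam (c2p (h p)) = lam p.
Proof.
have h1E0 q : h1 q = h1 0.
  have w : wder (fun q => h 0 + h1 0 * (p2c q - p2c 0)) q (h1 0) 0.
    apply: (wder_eq (wderD (wder_cst (h 0) q) (wderM (wder_cst (h1 0) q)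
      (wderB (wder_p2c q) (wder_cst (p2c 0) q))))).
      by rewrite mul0r !add0r subr0 mulr1.
    by rewrite subrr mulr0 mul0r !addr0.
  have [] // := wder_unique (wh q) (wder_ext (fun q => esym (symmetry_affine 0 q)) w).
have c1 : h1 0 * conjc (h1 0) = 1.
  have [->|cn1] := eqVneq (h1 0) 1; first by rewrite conjc1 mulr1.
  (* The fixed point of an affine map with linear part other than 1; there [symmetry_lam] compares
     [lam] with itself. *)
  pose z := (h 0 - h1 0 * p2c 0) / (1 - h1 0).
  have hz : h (c2p z) = z.
    have n1 : 1 - h1 0 != 0 by rewrite subr_eq0 eq_sym.
    rewrite (symmetry_affine 0) c2pK /z; move: n1; move: (h1 0) (h 0) (p2c 0) => x y t n1.
    by field.
  have := symmetry_lam (c2p z); rewrite hz h1E0 -[RHS]mul1r => /mulIf; apply.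
  exact: lam_neq0.
by have := symmetry_lam p; rewrite h1E0 c1 mul1r.
Qed.

End Derivative.
End Symmetry.

(** * Lines and their projections; constancy of the conformal factor *)

Section Lines.
Context {R : realType}.
Local Notation C := R[i].

Lemma line_vpick (L : CP2 R) : val L = <[vpick (val L)]>%VS.
Proof.
by apply/esym/eqP; rewrite eqEdim -memvE memv_pick (eqP (valP L)) dim_vline vpick_neq0.
Qed.

Lemma vpick_line (v : 'cV[C]_3) : v != 0 -> exists2 k, k != 0 & vpick <[v]>%VS = k *: v.
Proof.
move=> v0; have /vlineP[k kE] := memv_pick <[v]>%VS; exists k => //.
apply: contraNneq v0 => k0.
have : <[v]>%VS == 0%VS by rewrite -vpick0 kE k0 scale0r.
by rewrite -dimv_eq0 dim_vline; case: (v == 0).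
Qed.

Lemma line_proj_vpick (v : 'cV[C]_3) : v != 0 -> line_proj (vpick <[v]>%VS) = line_proj v.
Proof. by move=> /vpick_line[k k0 ->]; rewrite line_projZ. Qed.

Lemma line_proj_unitary (A : 'M[C]_3) (v : 'cV[C]_3) : adj A * A = 1 ->
  line_proj (A *m v) = A *m line_proj v *m adj A.
Proof.
move=> AA; rewrite /line_proj /sqn adjMm -!mulmxA [adj A *m (A *m v)]mulmxA.
by rewrite -[adj A *m A]/(adj A * A) AA mul1mx -scalemxAl -scalemxAr !mulmxA.
Qed.

Lemma line_eq_proj (u v : 'cV[C]_3) : u != 0 -> v != 0 -> line_proj u = line_proj v ->
  <[u]>%VS = <[v]>%VS.
Proof.
move=> u0 v0 h; apply/eqP; rewrite eqEdim !dim_vline u0 v0 andbT -memvE.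
apply/vlineP; exists ((sqn v)^-1 * (adj v *m u) 0 0).
rewrite -{1}(line_proj_id u0) h -scalemxAl -mulmxA {1}[adj v *m u]mx11_scalar.
by rewrite mul_mx_scalar scalerA.
Qed.

Lemma unitary_neq0 (A : 'M[C]_3) (v : 'cV[C]_3) : adj A * A = 1 -> v != 0 -> A *m v != 0.
Proof.
move=> AA; apply: contraNneq => h.
by rewrite -[v]mul1mx -[1%:M]/1 -AA -[_ * _]/(_ *m _) -mulmxA h mulmx0.
Qed.

Lemma projection_image f g (A : 'M[C]_3) z w : adj A * A = 1 ->
  val (f w : CP2 R) = (linfun (mulmx A) @: val (g z : CP2 R))%VS ->
  projection f (c2p w) = A * projection g (c2p z) * adj A.
Proof.
move=> AA h; rewrite /projection /realify /= -![_ +i* _]/(p2c (c2p _)) !c2pK h.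
rewrite {1}(line_vpick (g z)) limg_line lfunE /= line_proj_vpick ?unitary_neq0 ?vpick_neq0 //.
exact: line_proj_unitary.
Qed.

(** Transitivity provides a symmetry carrying 0 to [p]; its inverse is holomorphic as well, hence
    continuous as [symmetry_isometry] requires. *)
Lemma homogeneous_plam (f : C -> CP2 R) : conformal_lagrangian (projection f) -> is_harmonic (projection f) ->
  homogeneous f -> forall p, plam (projection f) p = plam (projection f) 0.
Proof.
move=> cl hP hf p.
have [g [[k [gK kK hg hk]] [A [/unitarymxP AA _ gA]]] g0] := hf 0 (p2c p).
have AA' : A * adj A = 1 by exact: AA.
have A'A : adj A * A = 1 by exact: mulmx1C AA'.
have [g' dg] := holomorphic_cdiff hg.
have [k' dk] := holomorphic_cdiff hk.
have h z : projection f (c2p (g z)) = A * projection f (c2p z) * adj A.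
  by apply: projection_image => //; exact: gA.
have := symmetry_isometry cl hP gK AA' h (fun p => (dg p).1) (fun p => (dg p).2)
  (fun p => cdiff_ccont (dk p).1) 0.
by rewrite (_ : p2c 0 = 0) // g0 p2cK.
Qed.

End Lines.

(** * Reconstruction of the Clifford torus *)

Section Exponential.
Context {R : realType}.
Local Notation C := R[i].

Lemma cexpD (x y : C) : cexp (x + y) = cexp x * cexp y.
Proof.
case: x => a b; case: y => c d; apply: complex_ext; rewrite /cexp /= expRD cosD sinD; ring.
Qed.

Lemma cexp0 : cexp (0 : C) = 1.
Proof. by apply: complex_ext; rewrite /cexp /= expR0 cos0 sin0; ring. Qed.

Lemma cexpJ (x : C) : conjc (cexp x) = cexp (conjc x).
Proof. by case: x => a b; apply: complex_ext; rewrite /cexp /= cosN sinN; ring. Qed.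

Lemma cder_cexp (V : normedModType R) (F : V -> C) p v d : cder F p v d ->
  cder (fun q => cexp (F q)) p v (d * cexp (F p)).
Proof.
move=> [h1 h2].
have e1 := is_derive_comp1 (is_derive_expR (Re (F p))) h1.
have c2 := is_derive_comp1 (is_derive_cos (Im (F p))) h2.
have s2 := is_derive_comp1 (is_derive_sin (Im (F p))) h2.
have ReE z : Re (@cexp R z) = expR (Re z) * cos (Im z) by rewrite /cexp /= mul0r subr0.
have ImE z : Im (@cexp R z) = expR (Re z) * sin (Im z) by rewrite /cexp /= mul0r addr0.
split.
  rewrite (_ : (fun _ => _) = (fun q => expR (Re (F q))) * (fun q => cos (Im (F q)))).
    apply: (is_derive_eq (is_deriveM e1 c2)); rewrite ReM ReE ImE /GRing.scale /=; ring.
  by apply/funext => q; rewrite ReE.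
rewrite (_ : (fun _ => _) = (fun q => expR (Re (F q))) * (fun q => sin (Im (F q)))).
  apply: (is_derive_eq (is_deriveM e1 s2)); rewrite ImM ReE ImE /GRing.scale /=; ring.
by apply/funext => q; rewrite ImE.
Qed.

Lemma wder_cexp (F : plane R -> C) p d e : wder F p d e ->
  wder (fun q => cexp (F q)) p (d * cexp (F p)) (e * cexp (F p)).
Proof.
move=> [h1 h2]; split.
  by apply: cder_eq (cder_cexp h1) _; ring.
by apply: cder_eq (cder_cexp h2) _; ring.
Qed.

Local Notation w := (@alpha R).

Lemma alpha_cube : w ^+ 3 = 1.
Proof.
rewrite !exprS expr0 mulr1 /alpha -!cexpD.
have -> : (0 +i* (2 * pi / 3) + (0 +i* (2 * pi / 3) + 0 +i* (2 * pi / 3))) = 0 +i* (pi *+ 2) :> C.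
  by apply: complex_ext => /=; rewrite ?addr0 //; rewrite mulr2n; field.
by apply: complex_ext; rewrite /cexp /= expR0 cos2pi sin2pi; ring.
Qed.

Lemma alpha_conj : conjc w * w = 1.
Proof.
rewrite cexpJ -cexpD -cexp0; congr cexp.
by apply: complex_ext => /=; rewrite ?addr0 // addNr.
Qed.

Lemma alpha_neq1 : w != 1.
Proof.
rewrite eq_complex /= expR0 !mul0r !mul1r addr0 negb_and; apply/orP; right.
apply: lt0r_neq0; apply: sin_gt0_pi; have := @pi_gt0 R.
by move: (@pi R) => p p0; apply/andP; split; lra.
Qed.

Lemma alpha_sum : 1 + w + w ^+ 2 = 0.
Proof.
have : (w - 1) * (1 + w + w ^+ 2) = 0.
  by transitivity (w ^+ 3 - 1); [ring|rewrite alpha_cube subrr].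
by move=> /eqP; rewrite mulf_eq0 subr_eq0 (negPf alpha_neq1) => /eqP.
Qed.

Lemma conj_alpha : conjc w = w ^+ 2.
Proof.
by rewrite -[RHS]mul1r -alpha_conj -mulrA -exprS alpha_cube mulr1.
Qed.

Lemma conj_alphaX (k : nat) : conjc (w ^+ k) * w ^+ k = 1.
Proof. by rewrite rmorphXn -exprMn alpha_conj expr1n. Qed.

(** As the conjugate of [alpha] is its square, the three exponents share the form of a unitary flow
    with eigenvalues [alpha ^+ k]. *)
Lemma clifford_vecE (z : C) (k : 'I_3) :
  clifford_vec z k 0 = cexp (w ^+ k * z - conjc (w ^+ k * z)).
Proof.
rewrite mxE; case: k => [[|[|[|//]]] i] /=; congr cexp.
- by rewrite expr0 mul1r.
- by rewrite expr1 conjcM conj_alpha.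
- rewrite conjcM conjcX conj_alpha -exprM; congr (_ - _ * _).
  by rewrite (_ : (2 * 2 = 3 + 1)%N) // exprD alpha_cube mul1r expr1.
Qed.

End Exponential.

Section Reconstruction.
Context {R : realType}.
Local Notation C := R[i].
Local Notation mat := 'M[C]_3.

Local Notation w := (@alpha R).

Section Frame.
Variables (l psi c : C) (P a b : mat) (v : 'cV[C]_3).
Hypotheses (fr : frame l P a b (adj a) (adj b)) (Pv : P = v *m adj v) (v1 : adj v *m v = 1%:M)
  (l0 : l != 0) (c3 : c ^+ 3 = - psi) (cc : conjc c * c = l).

Let c0 : c != 0.
Proof. by apply: contraNneq l0 => c0; rewrite -cc c0 mulr0. Qed.

Let X := a - adj b + (psi / l ^+ 2) *: (b * adj a).

Definition eigenvalue (k : 'I_3) : C := c * w ^+ k.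
Local Notation mu := eigenvalue.

Lemma w_neq0 : w != 0 :> C.
Proof. by apply/eqP => w0; have := @alpha_cube R; rewrite w0 expr0n => /esym /eqP; rewrite oner_eq0. Qed.

Lemma mu_neq0 k : mu k != 0.
Proof. by rewrite mulf_neq0 // expf_neq0 // w_neq0. Qed.

Lemma mu_cube k : mu k ^+ 3 = - psi.
Proof. by rewrite exprMn c3 -exprM mulnC exprM alpha_cube expr1n mulr1. Qed.

Lemma Pvv : P *m v = v.
Proof. by rewrite Pv -mulmxA v1 mulmx1. Qed.

Lemma Xv : X *m v = a *m v.
Proof.
rewrite -[in LHS]Pvv mulmxA -[X *m P]/(X * P).
have -> : X * P = a by rewrite /X; frame_simp fr.
by [].
Qed.

Lemma Xav : X *m (a *m v) = (psi / l) *: (b *m v).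
Proof.
rewrite mulmxA -[X *m a]/(X * a).
have -> : X * a = (psi / l) *: (b * P).
  rewrite /X; frame_simp fr; rewrite scalerA; congr (_ *: _); by field.
by rewrite -scalemxAl -[b * P]/(b *m P) -mulmxA Pvv.
Qed.

Lemma Xbv : X *m (b *m v) = - (l *: v).
Proof.
rewrite mulmxA -[X *m b]/(X * b).
have -> : X * b = - (l *: P) by rewrite /X; frame_simp fr.
by rewrite mulNmx -scalemxAl Pvv.
Qed.

Variable s : C.
Hypotheses (s_real : conjc s = s) (s2 : s * s * 3 = 1).

(** [X] permutes the orthogonal lines of [v], [a v], [b v] cyclically and [X^3 = - psi], so
    [v + X v / mu + X^2 v / mu^2] is an eigenvector for every cube root [mu] of [- psi]. Its three
    terms have length 1, whence the factor [s] with [3 s^2 = 1]. *)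
Definition eigenvector (k : 'I_3) : 'cV[C]_3 :=
  s *: (v + (mu k)^-1 *: (a *m v) + ((mu k)^-1 ^+ 2 * (psi / l)) *: (b *m v)).
Local Notation u := eigenvector.

Lemma eigenvectorP k : X *m u k = mu k *: u k.
Proof.
have m0 := mu_neq0 k.
rewrite /u; set t := (_ + _).
suff Xt : X *m t = mu k *: t.
  by rewrite -scalemxAr Xt !scalerA [s * _]mulrC.
rewrite /t !mulmxDr -!scalemxAr Xv Xav Xbv !scalerDr !scalerA scalerN scalerA -scaleNr.
rewrite mulfV // scale1r addrC addrA; congr (_ *: _ + _ + _ *: _).
  by rewrite -[psi]opprK -(mu_cube k); field; rewrite l0 m0.
by field; rewrite l0 m0.
Qed.

(** The three orthogonal terms contribute 1, r, r^2 with [r = w ^+ j / w ^+ k], and this sum over a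
    cube root of unity is 3 or 0. *)
Lemma eigenvector_dot j k : adj (u j) *m u k = ((j == k)%:R)%:M.
Proof.
have av_av : adj (a *m v) *m (a *m v) = l%:M.
  rewrite adjMm -mulmxA (mulmxA (adj a)) -[adj a *m a]/(adj a * a) (frame_a'a fr).
  by rewrite -scalemxAl Pvv -scalemxAr v1 scalemx1.
have bv_bv : adj (b *m v) *m (b *m v) = l%:M.
  rewrite adjMm -mulmxA (mulmxA (adj b)) -[adj b *m b]/(adj b * b) (frame_b'b fr).
  by rewrite -scalemxAl Pvv -scalemxAr v1 scalemx1.
have v_av : adj v *m (a *m v) = 0.
  rewrite -[in LHS]Pvv adjMm -mulmxA (mulmxA (adj P)).
  have -> : adj P = P by rewrite Pv adjMm adjK.
  by rewrite -[P *m a]/(P * a) (frame_Pa fr) mul0mx mulmx0.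
have v_bv : adj v *m (b *m v) = 0.
  rewrite -[in LHS]Pvv adjMm -mulmxA (mulmxA (adj P)).
  have -> : adj P = P by rewrite Pv adjMm adjK.
  by rewrite -[P *m b]/(P * b) (frame_Pb fr) mul0mx mulmx0.
have bv_av : adj (b *m v) *m (a *m v) = 0.
  rewrite adjMm -mulmxA (mulmxA (adj b)) -[adj b *m a]/(adj b * a) (frame_b'a fr).
  by rewrite mul0mx mulmx0.
have dual x y : adj x *m y = 0 -> adj y *m x = 0 :> 'M[C]_1.
  by move=> /(congr1 (@adj _ _ _)); rewrite adjMm adjK adj0.
have v_av' := dual _ _ _ v_av; have v_bv' := dual _ _ _ v_bv; have bv_av' := dual _ _ _ bv_av.
rewrite /u.
move: (a *m v) (b *m v) av_av bv_bv v_av v_bv bv_av v_av' v_bv' bv_av' => x y.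
move=> xx yy vx vy yx xv yv xy.
set al := (mu k)^-1; set be := _ * (psi / l); set al' := (mu j)^-1; set be' := _ * (psi / l).
rewrite adjZ !adjD !adjZ s_real -scalemxAl -scalemxAr scalerA.
rewrite !(mulmxDl, mulmxDr) -!(scalemxAl, scalemxAr) v1 xx yy vx vy yx xv yv xy.
rewrite !scaler0 !addr0 !add0r !scalerA !scale_scalar_mx.
rewrite -!raddfD /= scale_scalar_mx; congr (_%:M).
have cJ : conjc c != 0 by rewrite conjc_eq0.
have x0 : w ^+ j != 0 :> C by rewrite expf_neq0 // w_neq0.
have y0 : w ^+ k != 0 :> C by rewrite expf_neq0 // w_neq0.
have xJ : conjc (w ^+ j) = (w ^+ j)^-1 :> C by rewrite -[LHS](mulfK x0) conj_alphaX mul1r.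
have q1 : conjc al' * al * l = w ^+ j / w ^+ k.
  rewrite /al' /al /mu conjc_inv conjcM xJ -cc.
  by move: (w ^+ j) (w ^+ k) x0 y0 => x' y' x0 y0; field; rewrite x0 y0 c0 cJ.
have q2 : conjc be * be' * l = (w ^+ j / w ^+ k) ^+ 2.
  have be'' : conjc be = (conjc (mu j))^-1 ^+ 2 * (conjc psi / conjc l).
    by rewrite /be conjcM conjcX conjc_inv (conjcM psi) conjc_inv.
  have psiJ : conjc psi = - conjc c ^+ 3.
    by rewrite -[psi]opprK -c3 [LHS]rmorphN /= conjcX.
  have lJ : conjc l = l by rewrite -cc conjcM conjcK mulrC.
  rewrite be'' /be' psiJ lJ /mu conjcM xJ -[psi]opprK -c3 -cc.
  have -> : al = (c * w ^+ k)^-1 by [].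
  by move: (w ^+ j) (w ^+ k) x0 y0 => x' y' x0 y0; field; rewrite x0 y0 c0 cJ.
rewrite q1 q2.
(* Since [w ^+ (2 * k)] inverts [w ^+ k], all exponents become natural numbers, which are reduced
   modulo 3 in the nine cases. *)
have -> : w ^+ j / w ^+ k = w ^+ (j + 2 * k) :> C.
  have -> : (w ^+ k)^-1 = w ^+ (2 * k) :> C.
    by rewrite exprM -conj_alpha -conjcX -[RHS](mulfK y0) conj_alphaX mul1r.
  by rewrite exprD.
rewrite -exprM; have mod3 n : w ^+ n = w ^+ (n %% 3) :> C.
  by rewrite {1}(divn_eq n 3) exprD mulnC exprM alpha_cube expr1n mul1r.
rewrite mod3 [in X in _ + X](mod3 _).
have s3 := @alpha_sum R.
case: j {al' be be' xJ q1 q2 x0} => [[|[|[|//]]] hj];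
case: k {al y0} => [[|[|[|//]]] hk]; rewrite /= ?expr0 ?expr1;
  try by rewrite -[RHS]s2; ring.
all: try by rewrite s3 mulr0.
all: by rewrite addrAC s3 mulr0.
Qed.

Definition eigenmatrix : mat := \matrix_(i, k) u k i 0.

Lemma eigenmatrix_unitary : adj eigenmatrix * eigenmatrix = 1.
Proof.
apply/matrixP => j k; have /matrixP /(_ 0 0) := eigenvector_dot j k.
rewrite !mxE eqxx mulr1n => <-; apply: eq_bigr => i _.
by rewrite !adjE !mxE.
Qed.

Lemma eigenmatrixP : X *m eigenmatrix = eigenmatrix *m diag_mx (\row_k mu k).
Proof.
apply/matrixP => i k; have /matrixP /(_ i 0) := eigenvectorP k.
rewrite mul_mx_diag !mxE mulrC => <-.
by apply: eq_bigr => m _; rewrite !mxE.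
Qed.

(** Only the first term of each eigenvector meets [v]. Equal coordinates in the eigenbasis single
    out the Clifford torus among the orbits of the diagonal flow. *)
Lemma eigenmatrix_v : adj eigenmatrix *m v = const_mx s.
Proof.
have dual x : adj v *m x = 0 -> adj x *m v = 0 :> 'M[C]_1.
  by move=> /(congr1 (@adj _ _ _)); rewrite adjMm adjK adj0.
have Pa : adj P = P by rewrite Pv adjMm adjK.
have v_av : adj v *m (a *m v) = 0.
  by rewrite -[in LHS]Pvv adjMm -mulmxA (mulmxA (adj P)) Pa -[P *m a]/(P * a)
    (frame_Pa fr) mul0mx mulmx0.
have v_bv : adj v *m (b *m v) = 0.
  by rewrite -[in LHS]Pvv adjMm -mulmxA (mulmxA (adj P)) Pa -[P *m b]/(P * b)
    (frame_Pb fr) mul0mx mulmx0.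
have H k : adj (u k) *m v = s%:M.
  rewrite /u adjZ !adjD !adjZ s_real -scalemxAl !mulmxDl -!scalemxAl v1.
  by rewrite (dual _ v_av) (dual _ v_bv) !scaler0 !addr0 scalemx1.
apply/matrixP => k i; rewrite ord1; have /matrixP /(_ 0 0) := H k.
rewrite !mxE eqxx mulr1n => <-; apply: eq_bigr => m _.
by rewrite !adjE !mxE.
Qed.


End Frame.
End Reconstruction.

(** With [w] the flow, [w'] its adjoint, [x] the generator and [q] the projection, these are the
    terms of the z-derivative of [w' * q * w]. In [conj_flow'], for the conjugate derivative, [x] is
    the adjoint of the generator. *)
Lemma conj_flow (A : pzRingType) (w' w x q : A) :
  (- (w' * x) * q + w' * (x * q - q * x)) * w + w' * q * (x * w) = 0.
Proof.
rewrite mulrBr mulNr addrA !mulrA addNr add0r mulNr.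
by rewrite addNr.
Qed.

Lemma conj_flow' (A : pzRingType) (w' w x q : A) :
  (w' * x * q + w' * (q * x - x * q)) * w + w' * q * - (x * w) = 0.
Proof.
rewrite mulrBr !mulrA [_ + (_ - _)]addrC subrK mulrN !mulrA.
by rewrite subrr.
Qed.

Section Reconstruct.
Context {R : realType}.
Local Notation C := R[i].
Local Notation mat := 'M[C]_3.
Variable P : plane R -> mat.
Hypotheses (cl : conformal_lagrangian P) (P_harmonic : is_harmonic P).
Variable l : C.
Hypothesis lamE : forall p, plam P p = l.
Local Notation a := (pa P).
Local Notation b := (pb P).
Local Notation X := (screw P l 0).
Local Notation psi := (cubic P 0).

Let l0 : l != 0. Proof. by rewrite -(lamE 0); exact: cl_lam. Qed.

Lemma screw_frame p : X = a p - adj (b p) + (psi / l ^+ 2) *: (b p * adj (a p)).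
Proof. by rewrite -(screw_const cl P_harmonic lamE p) /screw (cubic_const cl P_harmonic lamE p). Qed.

(** The frame relations give [X * P = a] and [P * X = - adj b]. *)
Lemma mdz_P p : mdz P p = X * P p - P p * X.
Proof.
have fr := frame_l cl lamE p.
rewrite (screw_frame p) (DE cl); move: fr.
move: (a p) (b p) (adj (a p)) (adj (b p)) (P p) => x y x' y' Q fr.
by frame_simp fr; rewrite opprK.
Qed.

Lemma mdzb_P p : mdzb P p = P p * adj X - adj X * P p.
Proof. by rewrite -(adjD_E cl p).1 mdz_P adjB !adjM cl_adj. Qed.

Variables (c s : C) (v : 'cV[C]_3).
Hypotheses (c3 : c ^+ 3 = - psi) (cc : conjc c * c = l)
  (Pv : P 0 = v *m adj v) (v1 : adj v *m v = 1%:M)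
  (s_real : conjc s = s) (s2 : s * s * 3 = 1).

Let fr0 := frame_l cl lamE 0.
Local Notation mu := (eigenvalue c).
Let U := eigenmatrix l psi c (a 0) (b 0) v s.

Let UU : adj U * U = 1.
Proof. exact: eigenmatrix_unitary fr0 Pv v1 l0 c3 cc _ s_real s2. Qed.

Let UU' : U * adj U = 1. Proof. exact: mulmx1C. Qed.

Let M : mat := diag_mx (\row_k mu k).

Let XU : X * U = U * M.
Proof. by rewrite (screw_frame 0); exact: eigenmatrixP fr0 Pv v1 l0 c3 cc _. Qed.

(** [X] is normal: a unitary matrix that diagonalises it also diagonalises its adjoint. *)
Let XaU : adj X * U = U * adj M.
Proof.
have : adj U * adj X = adj M * adj U by rewrite -adjM XU adjM.
move=> /(congr1 (fun N => U * N * U)).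
by rewrite mulrA UU' mul1r -!mulrA UU mulr1.
Qed.

Let e (k : 'I_3) (p : plane R) : C := clifford_vec (c * p2c p) k 0.
Let G (p : plane R) : mat := diag_mx (\row_k e k p).
(** The flow exp(z X - conj(z) adj X) in the eigenbasis of [X]; its diagonal entries there are the
    Clifford coordinates at [c z]. *)
Let W p := U * G p * adj U.

Let e_wder k p : wder (e k) p (mu k * e k p) (- conjc (mu k) * e k p).
Proof.
have wz : wder (fun q => @alpha R ^+ k * (c * p2c q)) p (mu k) 0.
  apply: (wder_eq (wderM (wder_cst _ p) (wderM (wder_cst c p) (wder_p2c p)))).
    by rewrite !mul0r !add0r mulr1 mulrC.
  by rewrite !mul0r !add0r !mulr0.
have wc := wder_cexp (wderB wz (wderJ wz)).
have eE q : cexp (alpha ^+ k * (c * p2c q) - conjc (alpha ^+ k * (c * p2c q))) = e k q.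
  by rewrite /e clifford_vecE.
by apply: (wder_eq (wder_ext eE wc)); rewrite ?conjc0 ?subr0 ?sub0r eE.
Qed.

Let e_unit k p : e k p * conjc (e k p) = 1.
Proof.
rewrite /e clifford_vecE; set t := alpha ^+ k * _.
rewrite cexpJ -cexpD -cexp0; congr cexp.
by rewrite [conjc (_ - _)]rmorphB /= conjcK -[X in X + _]opprB addNr.
Qed.

Let G_wder p : mwder G p (M * G p) (- (adj M * G p)).
Proof.
move=> i j; rewrite -![_ * _]/(_ *m _).
have aM : adj M = diag_mx (\row_k conjc (mu k)).
  by apply/matrixP => i' j'; rewrite adjE !mxE eq_sym; case: eqP => [->|_];
    rewrite ?mulr1n ?mulr0n ?conjc0.
rewrite aM /M mul_diag_mx mul_diag_mx !mxE.
have [->|ij] := eqVneq i j.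
  apply: (wder_ext (F := e j)); first by move=> q; rewrite !mxE eqxx mulr1n.
  by apply: (wder_eq (e_wder j p)); rewrite mulr1n // mulNr.
apply: (wder_ext (F := fun=> 0)); first by move=> q; rewrite !mxE (negPf ij) mulr0n.
by apply: (wder_eq (wder_cst _ p)); rewrite mulr0n mulr0 ?oppr0.
Qed.

Let W_wder p : mwder W p (X * W p) (- (adj X * W p)).
Proof.
apply: (mwder_eq (mwderM (mwderM (mwder_cst U p) (G_wder p)) (mwder_cst (adj U) p))).
  by rewrite mul0r add0r mulr0 addr0 !mulrA -XU.
by rewrite mul0r add0r mulr0 addr0 mulrN mulNr !mulrA -XaU.
Qed.

Let G_unit p : G p * adj (G p) = 1.
Proof.
have aG : adj (G p) = diag_mx (\row_k conjc (e k p)).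
  by apply/matrixP => i' j'; rewrite adjE !mxE eq_sym; case: eqP => [->|_];
    rewrite ?mulr1n ?mulr0n ?conjc0.
rewrite aG -[_ * _]/(_ *m _) mul_diag_mx; apply/matrixP => i j; rewrite !mxE.
by case: eqP => [->|_]; rewrite ?mulr1n ?mulr0n ?mulr0 // e_unit.
Qed.

Let W_unit p : W p * adj (W p) = 1.
Proof.
rewrite /W !adjM adjK -!mulrA (mulrA (adj U)) UU mul1r (mulrA (G p)) G_unit mul1r.
exact: UU'.
Qed.

Let W0 : W 0 = 1.
Proof.
have -> : W 0 = U * 1 * adj U.
  congr (_ * _ * _); apply/matrixP => i j; rewrite !mxE.
  case: eqP => [->|_]; rewrite ?mulr1n ?mulr0n //.
  by rewrite /e clifford_vecE (_ : p2c 0 = 0) ?mulr0 ?conjc0 ?subrr ?cexp0.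
by rewrite mulr1 UU'.
Qed.

(** [P] satisfies the same linear differential equations as an orbit of conjugation by [W], so
    undoing the flow leaves a constant. *)
Let K_const p : adj (W p) * P p * W p = P 0.
Proof.
have h q : mwder (fun q => adj (W q) * P q * W q) q 0 0.
  apply: (mwder_eq (mwderM (mwderM (mwder_adj (W_wder q)) (mwderE q (cl_smooth cl))) (W_wder q))).
    by rewrite mdz_P adjN (adjM (adj X)) adjK conj_flow.
  by rewrite mdzb_P (adjM X) conj_flow'.
rewrite (mwder_const h p 0) W0 mulr1.
by rewrite (_ : adj 1 = 1) ?mul1r //; exact: adj1.
Qed.

Lemma reconstruction : exists2 U' : mat, adj U' * U' = 1 & forall p,
  P p = (s *: (U' *m clifford_vec (c * p2c p))) *m
    adj (s *: (U' *m clifford_vec (c * p2c p))).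
Proof.
exists U => // p.
have Wv : W p *m v = s *: (U *m clifford_vec (c * p2c p)).
  rewrite /W -[_ * _]/(_ *m _) -mulmxA.
  have -> : adj U *m v = const_mx s by exact: eigenmatrix_v fr0 Pv v1 _ s_real.
  rewrite -[U * _]/(U *m _) -mulmxA scalemxAr; congr (_ *m _).
  rewrite mul_diag_mx; apply/matrixP => i j.
  rewrite (ord1 j) [RHS]mxE [LHS]mxE [X in X * _]mxE [X in _ * X]mxE mulrC.
  by [].
have PW : P p = W p *m P 0 *m adj (W p).
  rewrite -(K_const p) -[RHS]/(W p * (adj (W p) * P p * W p) * adj (W p)).
  by rewrite (mulrA (W p)) (mulrA (W p)) W_unit mul1r -mulrA W_unit mulr1.
rewrite PW Pv -Wv (adjMm (W p) v); move: (W p) => N.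
by rewrite !mulmxA.
Qed.

End Reconstruct.

(** * Unitary maps act by isometries *)

Section UnitaryAction.
Context {R : realType}.
Local Notation C := R[i].

Lemma CP2_eq (L L' : CP2 R) : line_proj (vpick (val L)) = line_proj (vpick (val L')) -> L = L'.
Proof.
move=> h; apply: val_inj; rewrite (line_vpick L) (line_vpick L').
by apply: line_eq_proj => //; exact: vpick_neq0.
Qed.

Definition unitary_act (A : 'M[C]_3) (AA : adj A * A = 1) (L : CP2 R) : CP2 R :=
  proj_point (unitary_neq0 AA (vpick_neq0 L)).

Lemma line_proj_act A (AA : adj A * A = 1) L :
  line_proj (vpick (val (unitary_act AA L))) = A *m line_proj (vpick (val L)) *m adj A.
Proof. by rewrite /= line_proj_vpick ?unitary_neq0 ?vpick_neq0 // line_proj_unitary. Qed.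

Lemma unitary_actK A B (AA : adj A * A = 1) (BB : adj B * B = 1) : B * A = 1 ->
  cancel (unitary_act AA) (unitary_act BB).
Proof.
move=> BA.
move=> L; apply: CP2_eq; apply: (etrans (line_proj_act BB _)); rewrite (line_proj_act AA L).
move: (line_proj _) => P.
rewrite !mulmxA -[B *m A]/(B * A) BA mul1mx -mulmxA -adjMm -[B *m A]/(B * A) BA.
by rewrite adj1 mulmx1.
Qed.

Lemma unitary_act_point A (AA : adj A * A = 1) v (v0 : v != 0) :
  unitary_act AA (proj_point v0) = proj_point (unitary_neq0 AA v0).
Proof.
apply: CP2_eq; rewrite line_proj_act /= !line_proj_vpick ?unitary_neq0 //.
by rewrite line_proj_unitary.
Qed.

Lemma chart_dom_point j (v : 'cV[C]_3) (v0 : v != 0) : chart_dom j (proj_point v0) = (v j 0 != 0).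
Proof. by have [k k0] := vpick_line v0; rewrite /chart_dom /= => ->; rewrite mxE mulf_eq0 negb_or k0. Qed.

Lemma affine_vec_point j (v : 'cV[C]_3) (v0 : v != 0) : v j 0 != 0 ->
  affine_vec j (chart j (proj_point v0)) = (v j 0)^-1 *: v.
Proof.
move=> vj; have d : chart_dom j (proj_point v0) by rewrite chart_dom_point.
have [k k0 kE] := vpick_line v0.
have := vpick_chart d; rewrite /= kE mxE -scalerA => /(scalerI k0).
move: (affine_vec _ _) => X h.
by apply: (scalerI vj); rewrite -h scalerA mulfV // scale1r.
Qed.

Lemma csmooth_C2_coord l : csmooth_on setT (fun y : C2 R => C2_complex y l 0).
Proof.
split=> n.
  rewrite (_ : (fun _ => _) = re_coord l); last by apply/funext => y; rewrite C2_complexE.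
  apply: Cn_on_linear; first exact: re_coord_continuous.
  by move=> x v; apply: is_derive_linear; [exact: re_coord_linear|exact: re_coord_continuous].
rewrite (_ : (fun _ => _) = im_coord l); last by apply/funext => y; rewrite C2_complexE.
apply: Cn_on_linear; first exact: im_coord_continuous.
by move=> x v; apply: is_derive_linear; [exact: im_coord_linear|exact: im_coord_continuous].
Qed.

Lemma open_neq0 (V : normedModType R) (F : V -> C) :
  csmooth_on setT F -> open [set y | F y != 0].
Proof.
move=> [h1 h2].
have c1 := Cn_on_continuous (h1 0%N); have c2 := Cn_on_continuous (h2 0%N).
rewrite (_ : [set y | F y != 0] = [set y | Re (F y) != 0] `|` [set y | Im (F y) != 0]).
  apply: openU.
    apply: (@open_comp _ _ (fun y => Re (F y)) [set x : R | x != 0]); last exact: open_neq.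
    by move=> x _; apply: c1; rewrite inE.
  apply: (@open_comp _ _ (fun y => Im (F y)) [set x : R | x != 0]); last exact: open_neq.
  by move=> x _; apply: c2; rewrite inE.
apply/seteqP; split=> y /=; rewrite eq_complex negb_and /=; first by move/orP.
by move=> h; apply/orP.
Qed.

Lemma csmooth_onW (V : normedModType R) (U : set V) (F : V -> C) :
  csmooth_on setT F -> csmooth_on U F.
Proof.
move=> [h1 h2]; split=> n; [move: (h1 n)|move: (h2 n)].
all: move: (fun y => _) => G; elim: n G => [|n IH] G /= [cG HG]; split=> //.
all: try by move=> x _; apply: cG; rewrite inE.
all: move=> v; have [d c] := HG v; split; last exact: IH.
all: by move=> x _; apply: d; rewrite inE.
Qed.

Section Chart.
Variables (A : 'M[C]_3) (AA : adj A * A = 1) (i : 'I_3).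

Definition lift_act (y : C2 R) : 'cV[C]_3 := A *m affine_vec i y.

Lemma lift_act_neq0 y : lift_act y != 0.
Proof. by rewrite unitary_neq0 // affine_vec_neq0. Qed.

Lemma csmooth_lift_act k : csmooth_on setT (fun y => lift_act y k 0).
Proof.
rewrite (_ : (fun _ => _) = fun y => \sum_l A k l * affine_vec i y l 0); last first.
  by apply/funext => y; rewrite mxE.
apply: csmooth_on_sum => [|l]; first exact: openT.
apply: csmooth_onM; [exact: openT|exact: csmooth_on_cst|].
rewrite (_ : (fun _ => _) = fun y => if unlift i l is Some l' then C2_complex y l' 0 else 1).
  by case: unlift => [l'|]; [exact: csmooth_C2_coord|exact: csmooth_on_cst].
by apply/funext => y; rewrite mxE.
Qed.

Lemma mder_lift_act y u : mder lift_act y u (A *m tangent_vec i u).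
Proof.
have h := @mder_affine_vec R (C2 R) id i y u (@derivable_id _ _ y u).
rewrite derive_id in h.
apply: mder_eq (mder_mul (mder_cst A y u) h) _.
by rewrite mul0mx add0r.
Qed.

Lemma unitary_act_chart_inv y :
  unitary_act AA (chart_inv i y) = proj_point (lift_act_neq0 y).
Proof. by rewrite /chart_inv unitary_act_point; apply: val_inj. Qed.

Definition act_dom j := [set y : C2 R | lift_act y j 0 != 0].

Lemma chart_dom_act j y :
  chart_dom j (unitary_act AA (chart_inv i y)) = (lift_act y j 0 != 0).
Proof. by rewrite unitary_act_chart_inv chart_dom_point. Qed.

Lemma open_act_dom j : open (act_dom j).
Proof. exact: open_neq0 (csmooth_lift_act j). Qed.

Lemma affine_vec_act j y : y \in act_dom j ->
  affine_vec j (chart j (unitary_act AA (chart_inv i y))) = (lift_act y j 0)^-1 *: lift_act y.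
Proof. by rewrite inE => d; rewrite unitary_act_chart_inv affine_vec_point. Qed.

Lemma smooth_act j : smooth_on (act_dom j) (chart j \o (unitary_act AA \o chart_inv i)).
Proof.
have oU : open (act_dom j) by exact: open_act_dom.
apply: smooth_on_C2 => // l.
apply: (@csmooth_on_ext _ _ _ (fun y => (lift_act y j 0)^-1 * lift_act y (lift j l) 0)) => //.
  move=> y /(affine_vec_act) /matrixP /(_ (lift j l) 0) h.
  by apply: (etrans (etrans _ (esym h))); [rewrite [RHS]mxE|rewrite [LHS]mxE liftK].
apply: csmooth_onM => //; last exact/csmooth_onW/csmooth_lift_act.
apply: csmooth_onV => //; last exact/csmooth_onW/csmooth_lift_act.
by move=> y; rewrite inE.
Qed.

Lemma smooth_to_CP2_act : smooth_to_CP2 (unitary_act AA \o chart_inv i).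
Proof.
move=> x j /=; rewrite chart_dom_act => d; exists (act_dom j); split.
- by split=> //; exact: open_act_dom.
- by move=> y; rewrite inE /= chart_dom_act.
- exact: smooth_act.
Qed.

(** Any lift [m] of the point computes the metric: differentiating [s *: m] adds multiples of [m],
    which [1 - P] kills, and the two factors [s] cancel against the squared length of the lift. *)
Lemma hermitian_fs_lift j (W a b : C2 R) (m ma mb : 'cV[C]_3) (s sa sb : C) :
  s != 0 -> m != 0 -> affine_vec j W = s *: m ->
  tangent_vec j a = s *: ma + sa *: m -> tangent_vec j b = s *: mb + sb *: m ->
  hermitian_fs W a b = (sqn m)^-1 * (adj mb *m (1%:M - line_proj m) *m ma) 0 0.
Proof.
move=> s0 m0 hW ha hb; rewrite (hermitian_fsE j) hW ha hb line_projZ // sqnZ.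
have Pm := line_proj_id m0; have Pm' : adj m *m line_proj m = adj m.
  by move: (congr1 (@adj _ _ _) Pm); rewrite adjMm line_proj_adj.
move: (line_proj m) Pm Pm' => P Pm Pm'.
have -> : adj (s *: mb + sb *: m) *m (1%:M - P) = conjc s *: (adj mb *m (1%:M - P)).
  rewrite adjD !adjZ mulmxDl -!scalemxAl [adj m *m (1%:M - P)]mulmxBr mulmx1 Pm'.
  by rewrite subrr scaler0 addr0.
rewrite -scalemxAl (mulmxDr (adj mb *m (1%:M - P))) -!scalemxAr -[adj mb *m (1%:M - P) *m m]mulmxA.
rewrite [(1%:M - P) *m m]mulmxBl mul1mx Pm subrr mulmx0 scaler0 addr0.
rewrite !mxE; move: (\sum_(_ < _) _) => t.
have n0 : sqn m != 0 by rewrite sqn_eq0.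
have s0' : conjc s != 0 by rewrite conjc_eq0.
by field; rewrite n0 s0 s0'.
Qed.

(** The image has the lift [A *m affine_vec i w], and a unitary [A] preserves every inner product in
    [hermitian_fs_lift]. *)
Lemma isometry_act j w u v : chart_dom j (unitary_act AA (chart_inv i w)) ->
  let Tij := chart j \o unitary_act AA \o chart_inv i in
  fubini_study (Tij w) ('D_u Tij w) ('D_v Tij w) = fubini_study w u v.
Proof.
rewrite chart_dom_act => d Tij; rewrite !fubini_studyE; congr Re.
have wU : w \in act_dom j by rewrite inE.
have oU : open (act_dom j) by exact: open_act_dom.
have sT : smooth_on (act_dom j) Tij by exact: smooth_act.
have dT x : exists sx, tangent_vec j ('D_x Tij w) =
    (lift_act w j 0)^-1 *: (A *m tangent_vec i x) + sx *: lift_act w.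
  have hm := mder_lift_act w x; have hV := cderV d (hm j 0).
  have h1 := mderZ hV hm; exists (- ((A *m tangent_vec i x) j 0 * ((lift_act w j 0)^-1 * (lift_act w j 0)^-1))).
  rewrite [RHS]addrC.
  have hT := mder_affine_vec j (smooth_on_derivable (v:=x) sT wU).
  apply: (mder_unique hT).
  apply: mder_near h1; apply: (near_openW oU wU) => y yU.
  by rewrite -affine_vec_act.
have [su hu] := dT u; have [sv hv] := dT v.
have s0 : (lift_act w j 0)^-1 != 0 by rewrite invr_eq0.
rewrite (hermitian_fs_lift s0 (lift_act_neq0 w) (affine_vec_act wU) hu hv).
rewrite (hermitian_fsE i) /lift_act line_proj_unitary //.
rewrite /sqn adjMm -!mulmxA [adj A *m (A *m affine_vec i w)]mulmxA -[adj A *m A]/(adj A * A) AA mul1mx.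
congr (_ * _); rewrite adjMm.
move: (line_proj _) => P; rewrite !mulmxA.
have -> : adj (tangent_vec i v) *m adj A *m (1%:M - A *m P *m adj A) *m A = adj (tangent_vec i v) *m (1%:M - P).
  rewrite -!mulmxA; congr (_ *m _); rewrite mulmxBl mulmxBr mul1mx -[adj A *m A]/(adj A * A) AA.
  congr (_ - _); rewrite -!mulmxA -[adj A *m A]/(adj A * A) AA mulmx1 mulmxA -[adj A *m A]/(adj A * A) AA.
  by rewrite mul1mx.
by [].
Qed.

End Chart.

Lemma CP2_isometry_act (A : 'M[C]_3) (AA : adj A * A = 1) : CP2_isometry (unitary_act AA).
Proof.
have AA' : adj (adj A) * adj A = 1 by rewrite adjK; exact: mulmx1C AA.
split; last by move=> i j w u v; exact: isometry_act.
exists (unitary_act AA'); split.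
- exact: unitary_actK.
- by apply: unitary_actK; move: AA'; rewrite adjK.
- by move=> i; exact: smooth_to_CP2_act.
- by move=> i; exact: smooth_to_CP2_act.
Qed.

End UnitaryAction.

(** Any cube root works: [conjc c * c] and [plam] are nonnegative and, by [cubic_gauss], have equal
    cubes. *)
Lemma conformal_cube_root (R : realType) (P : plane R -> 'M[R[i]]_3) :
  conformal_lagrangian P -> is_harmonic P -> (forall p, plam P p = plam P 0) ->
  exists2 c, c ^+ 3 = - cubic P 0 & conjc c * c = plam P 0.
Proof.
move=> cl hP lamE; pose c := 3.-root (- cubic P 0).
have cE : c ^+ 3 = - cubic P 0 by apply: rootCK.
exists c => //; have [_ h] := cubic_gauss cl hP lamE 0.
apply/eqP; rewrite -(@eqrXn2 _ 3) //.
- by rewrite exprMn -conjcX cE rmorphN mulrNN mulrC h.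
- by rewrite mulrC; exact: mul_conjC_ge0.
- rewrite -plamE -[_ * _]/(_ *m _) tr_adj_mul.
  by apply: sumr_ge0 => i _; apply: sumr_ge0 => j _; exact: exprn_ge0.
Qed.

Lemma biholomorphic_scale (R : realType) (c : R[i]) : c != 0 -> biholomorphic (fun z => c * z).
Proof.
have H (k : R[i]) : holomorphic (fun z => k * z).
  by move=> z; apply: (@derivableZ _ _ _ id k z 1); exact: derivable_id.
move=> c0; exists (fun z => c^-1 * z); split=> // z; first by rewrite mulKf.
by rewrite mulVKf.
Qed.

Theorem theorem7p5 (R : realType) (f : R[i] -> CP2 R)
    (f_immersion : immersion f) (f_conformal : conformal f)
    (f_minimal : minimal f) (f_lagrangian : lagrangian f)
    (f_homogeneous : homogeneous f) :
  exists (T : CP2 R -> CP2 R) (phi : R[i] -> R[i]),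
    [/\ CP2_isometry T, biholomorphic phi & f = T \o clifford \o phi].
Proof.
have [sf _] := f_immersion.
have cl := conformal_lagrangian_projection sf f_conformal f_lagrangian.
have hP := harmonic_projection sf f_conformal f_lagrangian f_minimal.
have lamE := homogeneous_plam cl hP f_homogeneous.
have [c c3 cc] := conformal_cube_root cl hP lamE.
have c0 : c != 0 by apply: contraNneq (cl_lam cl 0) => c0; rewrite -cc c0 mulr0.
have [v PE v1] := cl_unit cl 0.
(* The three equal coordinates of a unit vector in the eigenbasis: [s = 1 / sqrt 3]. *)
pose s : R[i] := (Num.sqrt (3^-1))%:C.
have sJ : conjc s = s by apply: complex_ext; rewrite //= oppr0.
have ss : s * s * 3 = 1.
  rewrite /s -rmorphM /= -expr2 sqr_sqrtr ?invr_ge0 //.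
  by rewrite fmorphV rmorph_nat mulVf // pnatr_eq0.
have [A AA H] := reconstruction cl hP lamE c3 cc PE v1 sJ ss.
exists (unitary_act AA), (fun z => c * z); split.
- exact: CP2_isometry_act.
- exact: biholomorphic_scale.
apply/funext => z; apply: CP2_eq.
have TE : line_proj (vpick (val (unitary_act AA (clifford (c * z))))) =
    line_proj (A *m clifford_vec (c * z)).
  rewrite (line_proj_act AA (clifford (c * z))) (line_proj_vpick (clifford_vec_neq0 (c * z))).
  by rewrite (line_proj_unitary _ AA).
apply: (etrans _ (esym TE)).
have := H (c2p z); rewrite c2pK; set w := A *m _ => hw.
have w0 : w != 0 by rewrite unitary_neq0 // clifford_vec_neq0.
have s0 : s != 0 by apply: contra_eq_neq ss => ->; rewrite mulr0 mul0r eq_sym oner_neq0.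
rewrite -(line_projZ w s0).
have fz : projection f (c2p z) = line_proj (vpick (val (f z))).
  by rewrite /projection /realify -[_ +i* _]/(p2c (c2p z)) c2pK.
(* The projection has trace 1, so the vector given by [reconstruction] has length 1 and its dyad is
   already [line_proj]. *)
have n1 : sqn (s *: w) = 1.
  have := tr_line_proj (vpick_neq0 (f z)); rewrite -fz hw mxtrace_mulC sqnE mxtrace_scalar.
  by rewrite mulr1n.
by apply: (etrans (esym fz)); rewrite hw /line_proj n1 invr1 scale1r.
Qed.
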